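(* $k$-DSP can be solved in $O(k\cdot n^{16k\cdot k!+k+1})$ time. That is, there is an algorithm that, given a connected undirected graph $G$ with $n$ vertices and $k$ pairs of vertices $(s_1,t_1),\dots,(s_k,t_k)$, runs in $O(k\cdot n^{16k\cdot k!+k+1})$ time and finds pairwise vertex-disjoint paths $P_1,\dots,P_k$ such that $P_i$ is a shortest $s_i$-$t_i$-path in $G$ for each $i\in[k]$, or correctly reports that no such paths exist.
   Context: Graphs are unweighted; the length of a path is its number of edges. $[k]=\{1,\dots,k\}$. The problem $k$-DSP ($k$ Disjoint Shortest Paths): the input is a graph $G=(V,E)$ and $k\in\mathbb{N}$ pairs $(s_i,t_i)_{i\in[k]}$ of vertices; the task is to find $k$ pairwise (vertex-)disjoint paths $P_i$ such that $P_i$ is a shortest $s_i$-$t_i$-path for each $i\in[k]$. Throughout, $G$ is undirected and connected and $n=|V|$. *)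

(* Defs.v *)
From mathcomp Require Import all_boot.

Set Implicit Arguments.
Unset Strict Implicit.
Unset Printing Implicit Defensive.

(** * Disjoint shortest paths *)

(* A path is the full list of its vertices, endpoints included. *)
Definition is_path (V : finType) (e : rel V) (x y : V) (p : seq V) : Prop :=
  exists2 q, p = x :: q & [/\ path e x q, last x q = y & uniq (x :: q)].

Definition path_length (V : finType) (p : seq V) : nat := (size p).-1.

Definition is_shortest_path (V : finType) (e : rel V) (x y : V) (p : seq V) :
    Prop :=
  is_path e x y p /\
  forall q, is_path e x y q -> path_length p <= path_length q.

Definition dsp_solution (V : finType) (e : rel V) (k : nat) (s t : 'I_k -> V)
    (P : 'I_k -> seq V) : Prop :=
  (forall i, is_shortest_path e (s i) (t i) (P i)) /\
  (forall i j, i != j -> [disjoint P i & P j]).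

(** * Random access machine *)

(* Uniform-cost RAM over natural numbers, with structured control flow.  The
   machine has registers, addressed by constants of the program, and a memory,
   addressed indirectly through registers.  As in the classical uniform-cost
   model, words are unbounded but addition and (truncated) subtraction are the
   only arithmetic, so that a step lengthens the largest number by at most one
   bit. *)
Inductive cmd : Type :=
| Skip
| Const of nat & nat         (* r_x := c         *)
| Add of nat & nat & nat     (* r_x := r_y + r_z *)
| Sub of nat & nat & nat     (* r_x := r_y - r_z *)
| Fetch of nat & nat         (* r_x := mem[r_y]  *)
| Store of nat & nat         (* mem[r_x] := r_y  *)
| Seq of cmd & cmd
| IfLt of nat & nat & cmd & cmd   (* if r_x < r_y *)
| WhileLt of nat & nat & cmd.     (* while r_x < r_y *)

Record state : Type := State { reg : nat -> nat; mem : nat -> nat }.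

Definition set_reg (st : state) (x v : nat) : state :=
  State [eta reg st with x |-> v] (mem st).

Definition set_mem (st : state) (a v : nat) : state :=
  State (reg st) [eta mem st with a |-> v].

(* [exec p st T st']: started in [st], [p] halts in [st'] after [T] steps; every
   basic command and every evaluation of a test is one step. *)
Inductive exec : cmd -> state -> nat -> state -> Prop :=
| ExecSkip st : exec Skip st 1 st
| ExecConst st x c : exec (Const x c) st 1 (set_reg st x c)
| ExecAdd st x y z :
    exec (Add x y z) st 1 (set_reg st x (reg st y + reg st z))
| ExecSub st x y z :
    exec (Sub x y z) st 1 (set_reg st x (reg st y - reg st z))
| ExecFetch st x y : exec (Fetch x y) st 1 (set_reg st x (mem st (reg st y)))
| ExecStore st x y : exec (Store x y) st 1 (set_mem st (reg st x) (reg st y))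
| ExecSeq p q st st1 st2 T1 T2 :
    exec p st T1 st1 -> exec q st1 T2 st2 -> exec (Seq p q) st (T1 + T2) st2
| ExecIfTrue x y p q st st' T :
    reg st x < reg st y -> exec p st T st' -> exec (IfLt x y p q) st T.+1 st'
| ExecIfFalse x y p q st st' T :
    reg st y <= reg st x -> exec q st T st' -> exec (IfLt x y p q) st T.+1 st'
| ExecWhileFalse x y p st :
    reg st y <= reg st x -> exec (WhileLt x y p) st 1 st
| ExecWhileTrue x y p st st1 st2 T1 T2 :
    reg st x < reg st y -> exec p st T1 st1 ->
    exec (WhileLt x y p) st1 T2 st2 ->
    exec (WhileLt x y p) st (T1 + T2).+1 st2.

(* The input word is written from address 0 on; everything else is zero. *)
Definition init_state (w : seq nat) : state := State (fun=> 0) (nth 0 w).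

(* On halting, the output word is read off the memory from address 0 on. *)
Definition outputs (st : state) (w : seq nat) : Prop :=
  forall i, i < size w -> mem st i = nth 0 w i.

(** * Encoding of instances and answers *)

(* n, k, s_0, t_0, ..., s_(k-1), t_(k-1), adjacency matrix row by row *)
Definition dsp_input (n k : nat) (e : rel 'I_n) (s t : 'I_k -> 'I_n) : seq nat :=
  [:: n, k & flatten [seq [:: val (s i); val (t i)] | i <- enum 'I_k]
             ++ [seq nat_of_bool (e u v) | u <- enum 'I_n, v <- enum 'I_n]].

(* 1, then each path as its number of vertices followed by its vertices *)
Definition dsp_found (n k : nat) (P : 'I_k -> seq 'I_n) : seq nat :=
  1 :: flatten [seq size (P i) :: map val (P i) | i <- enum 'I_k].

Definition dsp_none : seq nat := [:: 0].

(* Main.v *)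
Require Import Defs.
From mathcomp Require Import all_boot zify.

Set Implicit Arguments.
Unset Strict Implicit.
Unset Printing Implicit Defensive.

(** Pebbles replace the paths.  Cut each of the [k] paths of a solution into
    [R = 4 k! + 1] pieces, [M = k R] in all, and let one pebble walk along each
    piece.  A configuration consists of the start and of the present position
    of every pebble; these are [2 M = 8 k k! + 2 k] vertices, so there are
    [n ^ (2 M)] configurations.  They are searched exhaustively, and the
    polynomial work on each of them fits below the exponent [16 k k! + k + 1]
    because [M ^ 3] is at most a constant times [n ^ (3 k k!)].

    Start vertices of different paths differ.  A pebble moves to a neighbour
    that is one step further from its start, provided that this neighbour is on
    no geodesic between the start and the position of a pebble of another path.
    Soundness ([accepting_sound]): the trail of a pebble is a geodesic from its
    start to its position, hence contained in the set of vertices that the rule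
    protects, so trails of different paths stay disjoint; if the trails of one
    path abut and their distances to [s_i] match, they form a shortest path.

    Completeness ([search_complete]) says that the pebbles of a solution can be
    moved in some order without violating the rule.  Give a vertex [v] the
    coordinates [x_c v = dist (s_c) v].  Along [P_c] the coordinate [x_c]
    changes with unit speed.  For a chain [j, i, ..., c] of distinct indices, a
    vertex of [P_j] is in the zone of the chain if it agrees in all coordinates
    of the chain with a vertex of [P_i] in the zone of [i, ..., c].  On a zone
    the unit speed of [x_c] along [P_c] is inherited by [P_j] ([zone_color]);
    moreover a zone is an interval of [P_j] ([zone_convex]), so two cuts of
    [P_j] separate it from the rest.  At most [k!] chains start at [j]
    ([size_tails]).  Two more cuts for every [i] ensure that a vertex of [P_i]
    between the ends of a piece of [P_j] agrees in the coordinate [i] with the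
    vertex of the piece at the same distance from [s_j] ([crossing_cut]).
    Altogether each path receives at most [4 k!] cuts ([path_cuts]).

    Each piece is now inside or outside of each zone; its label is the least
    last index of a chain whose zone contains it.  If a piece of [P_i] has a
    vertex between the ends of a piece of [P_j], the chain behind the label of
    the second piece yields a chain with the same last index for the first one,
    so labels satisfy [lab p <= lab q] ([label_mono]).  Handle the labels in
    increasing order, and for the label [c] sweep a front through the values of
    [x_c]: a pebble with label [c] starts from the end of its piece where [x_c]
    is smaller, waits for the front and then moves with it.  If a move of [h]
    to [v] were prevented by [q], then [q] would have moved already and
    [lab h <= lab q], so the labels would agree; but all vertices between the
    start and the position of [q] have a coordinate at most that of the
    position, which is at most that of [v], so [v] would be the position of
    [q], against disjointness of the paths ([timetable_move]).

    The algorithm is written in a small language of bounded loops, for which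
    running time is a syntactic matter ([cost_monomial]), and compiled to the
    machine ([compile_ok]).  It tabulates distances and the multiples of powers
    of [n], treats a configuration as the number with these [2 M] digits in
    base [n], and marks reachable configurations in [n M] rounds, which exceeds
    the total number of moves.  A parent pointer of each configuration lets it
    retrace the moves of an accepting one and print the trails.  If [k > n] the
    starts cannot be distinct, and the answer is immediate. *)

(** * Distances in a connected graph *)

Section Distance.

Variables (V : finType) (e : rel V).

Fixpoint walk (l : nat) (u v : V) : bool :=
  if l is l'.+1 then [exists w, walk l' u w && e w v] else u == v.

(** Without repeated vertices a walk has fewer than [#|V|] edges; the value [#|V|]
    would mean that there is none. *)
Definition dist (u v : V) : nat := find (fun l => walk l u v) (iota 0 #|V|).

Lemma walkP l u v :
  reflect (exists p, [/\ path e u p, last u p = v & size p = l]) (walk l u v).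
Proof.
elim: l v => [|l IHl] v /=.
  apply: (iffP eqP) => [->|[p [_ <- /size0nil ->]]] //.
  by exists [::].
apply: (iffP existsP) => [[w /andP[/IHl[p [pth <- <-]] ewv]]|[p]].
  by exists (rcons p v); rewrite rcons_path pth last_rcons size_rcons.
case: (lastP p) => [|{}p z] [] //.
rewrite rcons_path last_rcons size_rcons => /andP[pth ez] <- [sz].
by exists (last u p); rewrite ez andbT; apply/IHl; exists p.
Qed.

Lemma walkD l m u w v : walk l u w -> walk m w v -> walk (l + m) u v.
Proof.
move=> /walkP[p [pp lp <-]] /walkP[q [pq lq <-]]; apply/walkP.
by exists (p ++ q); rewrite cat_path last_cat size_cat lp pp pq lq.
Qed.

Lemma dist_min l u v : walk l u v -> dist u v <= l.
Proof.
move=> wl; rewrite /dist; case: (ltnP l #|V|) => [lV|Vl].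
  rewrite leqNgt; apply/negP => /(before_find 0).
  by rewrite nth_iota // add0n wl.
by apply: leq_trans (find_size _ _) _; rewrite size_iota.
Qed.

Hypothesis e_conn : forall x y, connect e x y.

Lemma dist_walk_lt u v : dist u v < #|V| /\ walk (dist u v) u v.
Proof.
suff hs : has (fun l => walk l u v) (iota 0 #|V|).
  split; first by move: (hs); rewrite has_find size_iota.
  have := nth_find 0 hs; rewrite nth_iota ?add0n //.
  by move: hs; rewrite has_find size_iota.
case/connectP: (e_conn u v) => p0 pth0 ->.
case/shortenP: pth0 => p pth up _; apply/hasP; exists (size p).
  by rewrite mem_iota add0n /= -[(size p).+1]/(size (u :: p)) -(card_uniqP up) max_card.
by apply/walkP; exists p.
Qed.

Lemma dist_walk u v : walk (dist u v) u v.
Proof. by case: (dist_walk_lt u v). Qed.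

Lemma dist_lt u v : dist u v < #|V|.
Proof. by case: (dist_walk_lt u v). Qed.

Lemma dist_eq0 u v : (dist u v == 0) = (u == v).
Proof.
apply/eqP/eqP => [d0|->]; first by have := dist_walk u v; rewrite d0 => /eqP.
by apply/eqP; rewrite -leqn0 dist_min //=.
Qed.

Lemma dist0 u : dist u u = 0.
Proof. by apply/eqP; rewrite dist_eq0. Qed.

Lemma dist_tri w u v : dist u v <= dist u w + dist w v.
Proof. exact/dist_min/walkD/dist_walk/dist_walk. Qed.

Lemma dist_le1 u v : e u v -> dist u v <= 1.
Proof.
move=> euv; apply: dist_min => /=; apply/existsP.
by exists u; rewrite eqxx.
Qed.

Lemma dist1_edge u v : dist u v = 1 -> e u v.
Proof.
move=> d1; have := dist_walk u v; rewrite d1 => /existsP[w].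
by case/andP=> /eqP->.
Qed.

Lemma dist_pred l u v : dist u v = l.+1 -> exists2 w, dist u w = l & e w v.
Proof.
move=> dl; have := dist_walk u v; rewrite dl => /existsP[w /andP[wl ewv]].
exists w => //; apply/eqP; rewrite eqn_leq dist_min //=.
by have := dist_tri w u v; have := dist_le1 ewv; lia.
Qed.

Hypothesis e_sym : symmetric e.

Lemma dist_sym u v : dist u v = dist v u.
Proof.
suff H x y : dist x y <= dist y x by apply/eqP; rewrite eqn_leq !H.
apply/dist_min/walkP; have /walkP[p [pp lp sp]] := dist_walk y x.
exists (rev (belast y p)); split; last by rewrite size_rev size_belast.
  rewrite -lp rev_path (@eq_path _ _ e) // => a b; exact: e_sym.
by case: p pp lp sp => [|z p] //= _ _ _; rewrite rev_cons last_rcons.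
Qed.

Lemma path_walk x q i j : path e x q -> i <= j <= size q ->
  walk (j - i) (nth x (x :: q) i) (nth x (x :: q) j).
Proof.
move=> /(pathP x) pq; elim: j => [|j IHj] /andP[ij js].
  by move: ij; rewrite leqn0 => /eqP->; rewrite subnn /=.
move: ij; rewrite leq_eqVlt ltnS => /orP[/eqP->|ij]; first by rewrite subnn /=.
rewrite subSn //; apply/existsP; exists (nth x (x :: q) j).
apply/andP; split; last exact: pq.
by apply: IHj; rewrite ij ltnW.
Qed.

(** Parts of a shortest walk are shortest: otherwise the triangle inequality
    would shorten the whole. *)
Lemma geodesic_dist x q i j : path e x q -> size q = dist x (last x q) ->
  i <= j <= size q -> dist (nth x (x :: q) i) (nth x (x :: q) j) = j - i.
Proof.
move=> pq sq /andP[ij js]; apply/eqP; rewrite eqn_leq.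
rewrite dist_min ?path_walk ?ij //=.
have H a b : a <= b <= size q ->
  dist (nth x (x :: q) a) (nth x (x :: q) b) <= b - a.
  by move=> abq; rewrite dist_min ?path_walk.
have h1 := H 0 i; have h2 := H j (size q).
have t1 := dist_tri (nth x (x :: q) i) x (last x q).
have t2 := dist_tri (nth x (x :: q) j) (nth x (x :: q) i) (last x q).
rewrite (last_nth x) in sq t1 t2; move: h1 h2 => /= h1 h2.
lia.
Qed.

Lemma geodesic_uniq x q : path e x q -> size q = dist x (last x q) ->
  uniq (x :: q).
Proof.
move=> pq sq; apply/(uniqP x) => i j; rewrite !inE !ltnS => iq jq nij.
wlog ij : i j iq jq nij / i <= j.
  by move=> W; case/orP: (leq_total i j) => /W; [apply|move=> ->].
have := geodesic_dist pq sq (i := i) (j := j); rewrite ij jq => /(_ isT).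
by rewrite nij dist0; lia.
Qed.

(** A walk with as many edges as the distance has distinct vertices, because a
    repetition could be skipped; so walks and paths have the same minimal
    length. *)
Lemma shortest_pathP x y p : is_shortest_path e x y p <->
  exists2 q, p = x :: q & [/\ path e x q, last x q = y & size q = dist x y].
Proof.
have len q : path e x q -> last x q = y -> dist x y <= size q.
  by move=> pq lq; apply/dist_min/walkP; exists q.
split=> [[[q -> [pq lq uq]] min]|[q -> [pq lq sq]]].
  exists q => //; split=> //; apply/eqP; rewrite eqn_leq len // andbT.
  have /walkP[r [pr lr sr]] := dist_walk x y.
  rewrite -sr; apply: (min (x :: r)); exists r => //; split=> //.
  by apply: geodesic_uniq => //; rewrite lr.
split=> [|_ [r -> [pr lr _]]]; last by rewrite /path_length /= sq len.
by exists q => //; split=> //; apply: geodesic_uniq => //; rewrite lq.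
Qed.

End Distance.

(** * The pebble search *)

Lemma bounded_choice (X : Type) (x0 : X) (Q : nat -> X -> Prop) (m : nat) :
  (forall i, i < m -> exists x, Q i x) ->
  exists f, forall i, i < m -> Q i (f i).
Proof.
elim: m => [|m IHm] H; first by exists (fun=> x0).
have [i im|f Hf] := IHm; first exact/H/ltnW.
have [x Hx] := H m (leqnn _); exists (fun i => if i == m then x else f i) => i.
by rewrite ltnS leq_eqVlt; case: eqVneq => [->|_ /Hf].
Qed.

Section Search.

Variables (V : finType) (e : rel V).
Hypothesis e_conn : forall x y, connect e x y.
Hypothesis e_sym : symmetric e.
Variables (k R : nat) (S T : nat -> V).

Local Notation d := (dist e).

Definition geodesic (x y : V) (p : seq V) : Prop :=
  exists2 q, p = x :: q & [/\ path e x q, last x q = y & size q = d x y].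

Definition disjoint_geodesics (P : nat -> seq V) : Prop :=
  (forall i, i < k -> geodesic (S i) (T i) (P i)) /\
  (forall i j v, i < k -> j < k -> i != j -> v \in P i -> v \notin P j).

(** Vertices on geodesics from [a] to [b], described by distances alone, so that
    the test is cheap once all distances are known. *)
Definition between (a x b : V) : bool := d a x + d x b == d a b.

(** Pebble [p = i * R + r] belongs to the piece [r] of the path [i]. *)
Definition own (p : nat) : nat := p %/ R.

Definition distinct_starts (a : nat -> V) : Prop :=
  forall p q, p < k * R -> q < k * R -> own p != own q -> a p != a q.

(** The vertices between a start and a position stand for the trail, which is
    not recorded in a configuration.  Pebbles of the same path are exempt, since
    their trails are to be joined. *)
Definition move_ok (a y : nat -> V) (p : nat) (x : V) : Prop :=
  [/\ d (a p) x = (d (a p) (y p)).+1, d (y p) x = 1 &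
      forall q, q < k * R -> own q != own p -> ~~ between (a q) x (y q)].

(** The trail [W] is ghost data: moves and acceptance depend on the starts [a]
    and the positions [y] only.  Conditions are imposed below [k * R], since
    nothing outside has a meaning. *)
Inductive play : (nat -> V) -> (nat -> V) -> (nat -> seq V) -> Prop :=
| PlayStart a y W : distinct_starts a -> (forall p, p < k * R -> y p = a p) ->
    (forall p, p < k * R -> W p = [:: a p]) -> play a y W
| PlayMove a y W a' y' W' p : play a y W -> p < k * R ->
    (forall q, q < k * R -> a' q = a q) ->
    (forall q, q < k * R -> q != p -> y' q = y q /\ W' q = W q) ->
    move_ok a y p (y' p) -> W' p = y' p :: W p -> play a' y' W'.

Section Accept.

Variables a y : nat -> V.

(** A pebble may run towards [S i] or away from it; the distances to [S i] tell
    which of its two vertices comes first on the path. *)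
Definition near_end (i p : nat) : V :=
  if d (S i) (a p) < d (S i) (y p) then a p else y p.
Definition far_end (i p : nat) : V :=
  if d (S i) (a p) < d (S i) (y p) then y p else a p.
Definition reached (i r : nat) : V := if r is r'.+1 then far_end i (i * R + r') else S i.

(** A piece either continues at the vertex where its predecessor stopped or at
    a neighbour of it, except that the first piece begins at [S i] itself.  The
    two equations make the concatenation a geodesic from [S i]. *)
Definition link_ok (i r : nat) : bool :=
  let l := near_end i (i * R + r) in let h := far_end i (i * R + r) in
  [&& d (S i) l + d l h == d (S i) h,
      d (S i) (reached i r) + d (reached i r) l == d (S i) l &
      d (reached i r) l <= (0 < r)].

Definition accepting : Prop :=
  forall i, i < k -> (forall r, r < R -> link_ok i r) /\ reached i R = T i.

End Accept.

(** ** Soundness *)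

Lemma geodesic_rev x y p : geodesic x y p -> geodesic y x (rev p).
Proof.
case=> q -> [pq lq sq].
case: (lastP q) lq pq sq => [|{}q z] lq pq sq.
  by move: lq sq => /= <- _; exists [::] => //=; rewrite dist0.
move: lq pq sq; rewrite last_rcons => <- pq sq.
exists (rev (x :: q)); first by rewrite -rcons_cons rev_rcons.
split; last by rewrite size_rev dist_sym // -sq size_rcons.
  have := rev_path e x (rcons q z); rewrite last_rcons belast_rcons => ->.
  by rewrite (@eq_path _ (fun a b => e b a) e) // => a b; exact: e_sym.
by rewrite rev_cons last_rcons.
Qed.

Lemma geodesic_between x y p v : geodesic x y p -> v \in p -> between x v y.
Proof.
case=> q -> [pq lq sq] vq; rewrite /between.
have [m mq ->] : exists2 m, m <= size q & v = nth x (x :: q) m.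
  exists (index v (x :: q)); last by rewrite nth_index.
  by rewrite -ltnS -[(size q).+1]/(size (x :: q)) index_mem.
have sq' : size q = d x (last x q) by rewrite lq.
have := geodesic_dist e_conn pq sq' (i := 0) (j := m).
have := geodesic_dist e_conn pq sq' (i := m) (j := size q).
rewrite mq leqnn -last_nth lq => /(_ isT) h1 /(_ isT) /= h2.
by rewrite h1 h2; lia.
Qed.

Lemma geodesic_cat x y z p q : geodesic x y p -> geodesic y z q ->
  d x y + d y z = d x z -> geodesic x z (p ++ behead q).
Proof.
case=> p' -> [pp lp sp] [q' -> [pq lq sq]] h; exists (p' ++ q') => //.
by rewrite cat_path last_cat size_cat lp pp pq lq sp sq.
Qed.

Lemma geodesic_edge x y : d x y = 1 -> geodesic x y [:: x; y].
Proof. by move=> d1; exists [:: y]; rewrite //= d1 (dist1_edge e_conn d1). Qed.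

Lemma geodesic1 x : geodesic x x [:: x].
Proof. by exists [::]; rewrite //= dist0. Qed.

Lemma geodesic_mem x y p : geodesic x y p -> (x \in p) && (y \in p).
Proof. by case=> q -> [_ <- _]; rewrite mem_head mem_last. Qed.

(** The protected set of a pebble contains its trail, because the trail is a
    geodesic with the same ends; so a vertex that obeys the move rule is new to
    all trails of other paths. *)
Lemma play_inv a y W : play a y W ->
  [/\ forall p, p < k * R -> geodesic (y p) (a p) (W p) &
      forall p q v, p < k * R -> q < k * R -> own p != own q -> v \in W p ->
        v \notin W q].
Proof.
elim=> {a y W} [a y W da ya Wa|a y W a' y' W' p _ [IHg IHd] pM aa yW mv W'p].
  split=> [p pM|p q v pM qM npq]; first by rewrite ya // Wa //; apply: geodesic1.
  by rewrite !Wa // !inE => /eqP->; rewrite da.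
have gp : geodesic (y' p) (a' p) (W' p).
  case: mv => d1 d2 _; have [q Wp [pq lq sq]] := IHg p pM.
  rewrite W'p aa //; exists (W p) => //; rewrite Wp /= pq lq sq.
  rewrite (dist1_edge e_conn) 1?dist_sym // (dist_sym e_conn e_sym (y' p)) d1.
  by rewrite dist_sym.
have Wq q : q < k * R -> q != p -> W' q = W q by move=> qM /(yW q qM)[].
have new q : q < k * R -> own q != own p -> y' p \notin W q.
  move=> qM nqp; apply/negP => /(geodesic_between (IHg q qM)).
  case: mv => _ _ /(_ q qM nqp); rewrite /between => /negP h1 h2; apply: h1.
  have ds := dist_sym e_conn e_sym; move/eqP: h2.
  by rewrite (ds (y q)) (ds (y' p) (a q)) (ds (y q) (a q)) addnC => ->.
split=> [q qM|q r v qM rM nqr].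
  have [->|nqp] := eqVneq q p; first exact: gp.
  by have [-> ->] := yW q qM nqp; rewrite aa //; apply: IHg.
have [qp|nqp] := eqVneq q p; have [rp|nrp] := eqVneq r p.
- by rewrite qp rp eqxx in nqr.
- rewrite qp W'p Wq // inE => /orP[/eqP->|]; first by rewrite new -?qp // eq_sym.
  by apply: IHd; rewrite // -qp.
- move: rM nqr; rewrite rp => rM nqr.
  rewrite W'p Wq // inE => vq; rewrite negb_or (IHd q p) // andbT.
  by apply: contraTneq vq => ->; rewrite new.
- by rewrite !Wq //; apply: IHd.
Qed.

(** The trails are concatenated in the order of the pieces, reversing those that
    were walked towards [S i]. *)
Lemma play_path a y W i r : play a y W -> i < k -> r <= R ->
  (forall r', r' < r -> link_ok a y i r') ->
  exists2 p, geodesic (S i) (reached a y i r) p &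
    forall v, (v \in p) = (v == S i) || has (fun r' => v \in W (i * R + r')) (iota 0 r).
Proof.
move=> pl ik; have [Wg _] := play_inv pl.
elim: r => [|r IHr] rR lk.
  by exists [:: S i] => [|v]; [apply: geodesic1 | rewrite !inE orbF].
have [|p gp mp] := IHr (ltnW rR); first by move=> r' r'r; apply/lk/ltnW.
have pM : i * R + r < k * R by nia.
have /and3P[/eqP l1 /eqP l2 l3] := lk r (leqnn _).
set l := near_end a y i _ in l1 l2 l3; set h := far_end a y i _ in l1.
have [w gw mw] : exists2 w, geodesic l h w & w =i W (i * R + r).
  rewrite /l /h /near_end /far_end; case: ifP => _; last by exists (W (i * R + r)); first exact: Wg.
  exists (rev (W (i * R + r))); first exact/geodesic_rev/Wg.
  by move=> v; rewrite mem_rev.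
have wh : w = l :: behead w by case: gw => q ->.
have [g gg mg] : exists2 g, geodesic (S i) l g &
    forall v, (v \in g) || (v \in w) = (v \in p) || (v \in w).
  have [d0|d1] : d (reached a y i r) l = 0 \/ d (reached a y i r) l = 1.
  - by move: l3; case: (0 < r); lia.
  - by exists p => //; move/eqP: d0; rewrite dist_eq0 // => /eqP<-.
  exists (p ++ [:: l]).
    exact: geodesic_cat gp (geodesic_edge d1) l2.
  move=> v; rewrite mem_cat inE; case: eqP => [->|]; last by rewrite orbF.
  by rewrite wh mem_head !orbT.
exists (g ++ behead w); first exact: geodesic_cat gg gw l1.
move=> v; rewrite -addn1 iotaD has_cat /= orbF add0n orbA -mp -mw -mg mem_cat.
rewrite wh inE /=; case: eqP => [->|//]; rewrite orbT.
by have /andP[_ ->] := geodesic_mem gg.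
Qed.

(** The path [i] is glued from the trails of its pebbles and contains no other
    vertex, which is what lets the trails be printed in place of the paths. *)
Lemma accepting_sound a y W : 0 < R -> play a y W -> accepting a y ->
  exists2 P, disjoint_geodesics P &
    forall i, i < k -> P i =i flatten [seq W (i * R + r) | r <- iota 0 R].
Proof.
move=> R0 pl acc; have [Wg Wd] := play_inv pl.
have H i : i < k -> exists p, geodesic (S i) (T i) p /\
    p =i flatten [seq W (i * R + r) | r <- iota 0 R].
  move=> ik; have [lk <-] := acc i ik.
  have [p gp mp] := play_path pl ik (leqnn R) lk.
  exists p; split=> // v; rewrite mp.
  have -> : (v \in flatten [seq W (i * R + r) | r <- iota 0 R]) =
      has (fun r' => v \in W (i * R + r')) (iota 0 R).
    apply/flattenP/hasP => [[s /mapP[r rI ->] vs]|[r rI vr]]; first by exists r.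
    by exists (W (i * R + r)) => //; apply: map_f.
  case: eqP => //= ->; apply/esym/hasP; exists 0; first by rewrite mem_iota.
  rewrite addn0; have /and3P[_ _] := lk 0 R0.
  rewrite addn0 ltnn /= leqn0 dist_eq0 // => /eqP.
  have := Wg (i * R); rewrite /= => /(_ ltac:(nia)) /geodesic_mem /andP[m1 m2].
  by move=> ->; rewrite /near_end; case: ifP.
have [f Hf] := bounded_choice [::] H.
exists f => [|i ik]; last by have [] := Hf i ik.
split=> [i ik|i j v ik jk nij]; first by have [] := Hf i ik.
have [_ ->] := Hf i ik; have [_ ->] := Hf j jk.
case/flattenP=> s /mapP[r]; rewrite mem_iota add0n => /= rR -> vr.
apply/flattenP => -[s' /mapP[r']]; rewrite mem_iota add0n => /= r'R -> vr'.
suff : v \notin W (j * R + r') by rewrite vr'.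
by apply: Wd vr; rewrite ?/own ?divnMDl ?divn_small ?addn0 //; nia.
Qed.

End Search.

(** * Chains of indices and cuts *)
Section Tails.

Variable k : nat.

(** Sequences of distinct indices that can follow [j] in a chain. *)
Definition tails (j : 'I_k) : seq (seq nat) :=
  flatten [seq [seq map val (tval t) |
                 t <- enum [set t : m.-tuple 'I_k | all (predC1 j) t & uniq t]]
          | m <- iota 0 k].

(** For each of the [k] possible lengths [m] there are at most [(k - 1)!]
    injective sequences of [m] indices different from [j]. *)
Lemma size_tails j : size (tails j) <= k`!.
Proof.
have k0 : 0 < k by apply: leq_ltn_trans (ltn_ord j).
rewrite size_flatten /shape -map_comp sumnE big_map.
have -> : k`! = \sum_(m <- iota 0 k) (k.-1)`!.
  by rewrite big_const_seq count_predT size_iota iter_addn_0 -{1}(prednK k0) factS prednK // mulnC.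
rewrite big_seq [X in _ <= X]big_seq; apply: leq_sum => m.
rewrite mem_iota /= add0n => mk.
rewrite size_map -cardE card_uniq_tuples cardC1 card_ord.
have mk' : m <= k.-1 by lia.
by rewrite -(ffact_fact mk') leq_pmulr // fact_gt0.
Qed.

Lemma mem_tails (j : 'I_k) t :
  (t \in tails j) = uniq (val j :: t) && all (fun c => c < k) t.
Proof.
apply/flattenP/idP => [[s /mapP[m _ ->] /mapP[u uI ->]]|/andP[/= /andP[jt ut] tk]].
  move: uI; rewrite mem_enum inE => /andP[al un] /=.
  rewrite (map_inj_uniq val_inj) un andbT; apply/andP; split; last first.
    by apply/allP => c /mapP[c' _ ->]; apply: ltn_ord.
  apply/mapP => -[c cu /val_inj jc]; move/allP: al => /(_ c cu) /=.
  by rewrite jc eqxx.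
have [u ut'] : exists u : seq 'I_k, t = map val u.
  elim: t tk {jt ut} => [|c t IH] /=; first by exists [::].
  by case/andP=> ck /IH[u ->]; exists (Ordinal ck :: u).
rewrite ut' in jt ut *; rewrite (map_inj_uniq val_inj) in ut.
have sk : size u < k.
  have : uniq (j :: u) by rewrite /= ut andbT; apply: contra jt; apply: map_f.
  by move/card_uniqP => /= <-; rewrite -[X in _ <= X]card_ord max_card.
exists [seq map val (tval t) | t <-
   enum [set t : (size u).-tuple 'I_k | all (predC1 j) t & uniq t]].
  by apply: map_f; rewrite mem_iota.
apply/mapP; exists (in_tuple u) => //; rewrite mem_enum inE ut andbT /=.
apply/allP => c cu /=; apply: contra jt => /eqP<-; exact: map_f.
Qed.

End Tails.

Lemma leq_fact k : k <= k`!.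
Proof. by case: k => // k; rewrite factS leq_pmulr ?fact_gt0. Qed.

(** A cut [c] separates the positions [c - 1] and [c]. *)
Definition uncut (cs : seq nat) (lo hi : nat) : bool :=
  all (fun c => ~~ (lo < c <= hi)) cs.

(** Fewer than [R] cuts leave at most [R] pieces; surplus pieces repeat the last
    position, so that the number of pieces is exact.  This is why a piece may
    also begin where its predecessor ends. *)
Lemma pieces_exist (cs : seq nat) (l : nat) R :
  size cs < R -> exists f : (nat -> nat) * (nat -> nat),
  [/\ f.1 0 = 0, f.2 R.-1 = l,
      forall r, r < R -> f.1 r <= f.2 r <= l /\ uncut cs (f.1 r) (f.2 r) &
      forall r, r.+1 < R -> f.1 r.+1 = f.2 r \/ f.1 r.+1 = (f.2 r).+1].
Proof.
have: 0 <= l by []; move: {1 3}0 => a al csR.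
have {csR} : count (fun c => a < c <= l) cs < R.
  exact: leq_ltn_trans (count_size _ _) csR.
elim: R a al => // R IH a al cR.
have [exc|noc] := boolP (has (fun c => a < c <= l) cs); last first.
  have na c : c \in cs -> ~~ (a < c <= l) by move/hasPn: noc; apply.
  exists (fun r => if r is 0 then a else l, fun=> l); split=> //=.
    case=> [|r] _; rewrite ?al leqnn; split=> //; apply/allP => c cs'.
      exact: na.
    by lia.
  by move=> r _; left.
have exb : exists c, (c \in cs) && (a < c <= l) by case/hasP: exc => c; exists c; apply/andP.
(* The first piece ends just before the least cut above [a]. *)
case: (ex_minnP exb) => c0 /andP[c0s /andP[ac0 c0l]] minc.
have [|[g h] /= [g0 hl gh lk]] := IH c0 c0l.
  have cU := count_predUI (fun c => c0 < c <= l) (pred1 c0) cs.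
  have cI : count (predI (fun c => c0 < c <= l) (pred1 c0)) cs = 0.
    by rewrite (@eq_count _ _ pred0) ?count_pred0 // => c /=; apply/negP; lia.
  have c1 : 0 < count (pred1 c0) cs by rewrite -has_count has_pred1.
  have sub : count (predU (fun c => c0 < c <= l) (pred1 c0)) cs <=
         count (fun c => a < c <= l) cs by apply: sub_count => c /=; lia.
  rewrite cI addn0 in cU; rewrite -ltnS; apply: leq_trans cR; rewrite ltnS.
  by apply: leq_trans sub; rewrite cU -addn1 leq_add2l.
have R0 : 0 < R.
  case: R {IH gh lk hl} cR => //; rewrite ltnS leqn0 -leqn0 leqNgt -has_count.
  by rewrite exc.
exists (fun r => if r is r'.+1 then g r' else a,
        fun r => if r is r'.+1 then h r' else c0.-1); split=> //=.
- by case: R R0 hl {IH cR gh lk}.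
- case=> [|r] rR; last exact: gh.
  split; first lia; apply/allP => c cs'; apply/negP => hc.
  by have := minc c; rewrite cs' /= => /(_ ltac:(lia)); lia.
- case=> [|r] rR; last exact: lk.
  by right; rewrite g0; lia.
Qed.

(** * Completeness *)

Section Completeness.

Variables (V : finType) (e : rel V).
Hypothesis e_conn : forall x y, connect e x y.
Hypothesis e_sym : symmetric e.
Variables (k : nat) (S T : nat -> V) (P : nat -> seq V).
Hypothesis solP : disjoint_geodesics e k S T P.

Local Notation d := (dist e).
Local Notation x c v := (dist e (S c) v).
Local Notation L i := (dist e (S i) (T i)).

Definition pt (i m : nat) : V := nth (S i) (P i) m.

(** The absolute difference, written so that linear arithmetic applies. *)
Definition gap (a b : nat) : nat := (a - b) + (b - a).

Let ds u v : d u v = d v u. Proof. exact: dist_sym. Qed.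

Lemma gap_dist c u v : gap (x c u) (x c v) <= d u v.
Proof.
have := dist_tri e_conn u (S c) v; have := dist_tri e_conn v (S c) u.
by rewrite (ds v u) /gap; lia.
Qed.

Section OnePath.

Variable i : nat.
Hypothesis ik : i < k.

Lemma pt_dist m m' : m <= m' <= L i -> d (pt i m) (pt i m') = m' - m.
Proof.
have [/(_ i ik)[q Pq [pq lq sq]] _] := solP.
rewrite /pt Pq -sq => mm; apply: geodesic_dist => //.
by rewrite lq.
Qed.

Lemma pt_x m : m <= L i -> x i (pt i m) = m.
Proof.
move=> mL; have := @pt_dist 0 m; rewrite mL subn0 => /(_ isT).
by have [/(_ i ik)[q Pq _] _] := solP; rewrite /pt Pq.
Qed.

Lemma pt_mem m : m <= L i -> pt i m \in P i.
Proof.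
have [/(_ i ik)[q Pq [pq lq sq]] _] := solP.
by rewrite /pt => mL; rewrite mem_nth // Pq /= sq ltnS.
Qed.

Lemma mem_pt v : v \in P i -> x i v <= L i /\ v = pt i (x i v).
Proof.
move=> vP; suff [m mL vm] : exists2 m, m <= L i & v = pt i m.
  by rewrite vm pt_x.
have [/(_ i ik)[q Pq [pq lq sq]] _] := solP.
exists (index v (P i)); last by rewrite /pt nth_index.
by have := vP; rewrite -index_mem {2}Pq /= sq ltnS.
Qed.

Lemma mem_dist u v : u \in P i -> v \in P i -> d u v = gap (x i u) (x i v).
Proof.
move=> /mem_pt[uL {1}->] /mem_pt[vL {1}->]; rewrite /gap.
case/orP: (leq_total (x i u) (x i v)) => h; first by rewrite pt_dist ?h //; lia.
by rewrite ds pt_dist ?h //; lia.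
Qed.

End OnePath.

Lemma mem_inj i u v : i < k -> u \in P i -> v \in P i -> x i u = x i v -> u = v.
Proof.
by move=> ik /(mem_pt ik)[_ eu] /(mem_pt ik)[_ ev] uv; rewrite eu ev uv.
Qed.

(** ** Zones *)

(** The vertex [u] chosen in the zone of the remaining chain agrees with [v] in
    the coordinates of the whole chain, the head [j] included; this is what
    transports unit speed in both directions. *)
Fixpoint zone (t : seq nat) (v : V) : bool :=
  if t is j :: t' then
    (v \in P j) && ((t' == [::]) ||
      [exists u, zone t' u && all (fun c => x c u == x c v) t])
  else false.

Lemma zone_mem j t v : zone (j :: t) v -> v \in P j.
Proof. by case/andP. Qed.

Lemma zoneP j i t v : zone [:: j, i & t] v -> exists2 u, zone (i :: t) u &
  forall c, c \in [:: j, i & t] -> x c u = x c v.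
Proof.
case/andP=> _ /orP[//|/existsP[u /andP[zu /allP al]]].
by exists u => // c /al/eqP.
Qed.

(** The distance of [u] and [v] is the difference of their [j]-coordinates, hence
    of those of [u'] and [v'], hence at most [d u' v']; conversely [d u' v'] is
    a difference of [i]-coordinates, hence at most [d u v]. *)
Lemma zone_color_step j i t u v u' v' : all (fun c => c < k) [:: j, i & t] ->
  u \in P j -> v \in P j -> 
  (forall c, c \in [:: j, i & t] -> x c u' = x c u) ->
  (forall c, c \in [:: j, i & t] -> x c v' = x c v) ->
  (forall c, c \in i :: t -> gap (x c u') (x c v') = d u' v') ->
  d u v = d u' v' /\ forall c, c \in [:: j, i & t] -> gap (x c u) (x c v) = d u v.
Proof.
move=> /andP[jk _] uP vP eu ev IH.
have ji : j \in [:: j, i & t] by rewrite mem_head.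
have ij : i \in [:: j, i & t] by rewrite in_cons mem_head orbT.
have duv := mem_dist jk uP vP.
have l1 := gap_dist j u' v'; have l2 := gap_dist i u v.
have := IH i (mem_head _ _); rewrite !eu ?ev // in l1 l2 * => h1.
have E : d u v = d u' v' by lia.
split=> // c; rewrite in_cons => /orP[/eqP->|ct]; first by rewrite duv.
by rewrite E -(IH c ct) eu ?ev // in_cons ct orbT.
Qed.

Lemma zone_color t u v c : all (fun c => c < k) t -> zone t u -> zone t v ->
  c \in t -> gap (x c u) (x c v) = d u v.
Proof.
elim: t u v c => [//|j [|i t] IH] u v c tk zu zv.
  case/andP: tk => jk _; rewrite inE => /eqP->.
  by rewrite (mem_dist jk (zone_mem zu) (zone_mem zv)).
have [u' zu' eu] := zoneP zu; have [v' zv' ev] := zoneP zv => ct.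
have uP := zone_mem zu; have vP := zone_mem zv.
have [|_ /(_ c ct)//] := zone_color_step tk uP vP eu ev.
by move=> c'; apply: IH => //; case/andP: tk.
Qed.

(** If [x c] changes with unit speed from [a] to [b], then it does so along every
    geodesic from [a] to [b]; so it depends only on the distance from [a]. *)
Lemma same_coord c a b w w' : gap (x c a) (x c b) = d a b ->
  between e a w b -> d a w' = d a w -> between e a w' b -> x c w = x c w'.
Proof.
move=> h /eqP b1 ew /eqP b2.
have := gap_dist c a w; have := gap_dist c a w'.
by have := gap_dist c w b; have := gap_dist c w' b; rewrite /gap in h *; lia.
Qed.

Lemma same_coord2 c a b w a' b' w' : gap (x c a) (x c b) = d a b ->
  x c a' = x c a -> x c b' = x c b -> d a' b' = d a b ->
  between e a w b -> d a' w' = d a w -> between e a' w' b' -> x c w' = x c w.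
Proof.
move=> h ea eb dab /eqP b1 ew /eqP b2.
have := gap_dist c a w; have := gap_dist c a' w'.
by have := gap_dist c w b; have := gap_dist c w' b'; rewrite /gap in h *; lia.
Qed.

Lemma mem_between i u w v : i < k -> u \in P i -> w \in P i -> v \in P i ->
  (x i u <= x i w <= x i v) || (x i v <= x i w <= x i u) -> between e u w v.
Proof.
move=> ik uP wP vP h; rewrite /between (mem_dist ik uP wP).
by rewrite (mem_dist ik wP vP) (mem_dist ik uP vP) /gap; lia.
Qed.

Lemma mem_at i u v m : i < k -> u \in P i -> v \in P i -> m <= d u v ->
  exists2 w, w \in P i & d u w = m /\ between e u w v.
Proof.
move=> ik uP vP mle; have [uL _] := mem_pt ik uP; have [vL _] := mem_pt ik vP.
rewrite (mem_dist ik uP vP) /gap in mle.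
have [uv|/ltnW vu] := leqP (x i u) (x i v).
  have wL : x i u + m <= L i by lia.
  exists (pt i (x i u + m)); first exact: pt_mem.
  split; first by rewrite (mem_dist ik) ?pt_mem // pt_x // /gap; lia.
  by apply: (mem_between ik) => //; rewrite ?pt_mem // pt_x //; lia.
have wL : x i u - m <= L i by lia.
exists (pt i (x i u - m)); first exact: pt_mem.
split; first by rewrite (mem_dist ik) ?pt_mem // pt_x // /gap; lia.
by apply: (mem_between ik) => //; rewrite ?pt_mem // pt_x //; lia.
Qed.

(** The partners [u'] and [v'] of [u] and [v] have the same distance as these.
    By induction the vertex of the next path at the distance [d u w] from [u']
    is in the zone of the remaining chain, and it agrees with [w] in all
    coordinates of the chain because these have unit speed. *)
Lemma zone_convex j t u v w : all (fun c => c < k) (j :: t) ->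
  zone (j :: t) u -> zone (j :: t) v -> w \in P j -> between e u w v ->
  zone (j :: t) w.
Proof.
elim: t j u v w => [|i t IH] j u v w tk zu zv wP bw; first by rewrite /= wP.
have [u' zu' eu] := zoneP zu; have [v' zv' ev] := zoneP zv.
have uP := zone_mem zu; have vP := zone_mem zv.
have tk' : all (fun c => c < k) (i :: t) by case/andP: tk.
have ik : i < k by case/andP: tk'.
have [|E col] := zone_color_step tk uP vP eu ev.
  by move=> c; apply: zone_color.
have uP' := zone_mem zu'; have vP' := zone_mem zv'.
have dle : d u w <= d u' v' by rewrite -E -(eqP bw) leq_addr.
have [w' wP' dw] := mem_at ik uP' vP' dle.
have zw' : zone (i :: t) w' by apply: IH zu' zv' wP' dw.2.
have al : all (fun c => x c w' == x c w) [:: j, i & t].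
  apply/allP => c ct; apply/eqP; case: dw => dw1 dw2.
  by apply: (same_coord2 (col c ct) (eu c ct) (ev c ct) _ bw dw1 dw2).
apply/andP; split=> //; apply/orP; right; apply/existsP; exists w'.
by apply/andP; split; [exact: zw'|exact: al].
Qed.

(** Following the partners down the chain reaches the zone of any suffix without
    changing the coordinate of the head of this suffix. *)
Lemma zone_suffix j t1 i t2 v : zone (j :: t1 ++ i :: t2) v ->
  exists2 u, zone (i :: t2) u & x i u = x i v.
Proof.
elim: t1 j v => [|j' t1 IH] j v /zoneP[u zu eu].
  by exists u => //; apply: eu; rewrite in_cons mem_head orbT.
have [w zw wu] := IH _ _ zu; exists w => //.
by rewrite wu eu // -cat_cons -cat_cons !(mem_cat, in_cons) eqxx !orbT.
Qed.

(** ** Cutting the paths *)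

Lemma combine_cuts (A : eqType) (s : seq A) (l : nat) (G : A -> nat -> nat -> Prop) :
  (forall a, a \in s -> exists2 cs, size cs <= 2 &
     forall lo hi, lo <= hi <= l -> uncut cs lo hi -> G a lo hi) ->
  exists2 cs, size cs <= 2 * size s &
    forall lo hi, lo <= hi <= l -> uncut cs lo hi ->
      forall a, a \in s -> G a lo hi.
Proof.
elim: s => [|a s IH] H; first by exists [::].
have [|cs szc Hc] := IH; first by move=> b bs; apply: H; rewrite in_cons bs orbT.
have [|cs' szc' Hc'] := H a; first exact: mem_head.
exists (cs' ++ cs) => [|lo hi lh]; first by rewrite size_cat /=; lia.
rewrite /uncut all_cat => /andP[u1 u2] b.
by rewrite in_cons => /orP[/eqP->|bs]; [apply: Hc'|apply: Hc].
Qed.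

Section Crossing.

Variable j : nat.
Hypothesis jk : j < k.

Lemma between_level lo hi v : lo <= hi <= L j ->
  between e (pt j lo) v (pt j hi) -> lo <= x j v <= hi.
Proof.
move=> /[dup] lh /andP[_ hL] /eqP; rewrite (pt_dist jk lh) => b.
have := gap_dist j (pt j lo) v; have := gap_dist j v (pt j hi).
by rewrite !(pt_x jk) /gap; lia.
Qed.

(** A vertex between the ends of an uncut interval is reached from [pt j c] by a
    geodesic through one of these ends. *)
Lemma uncut_dist lo hi c v : lo <= hi <= L j -> c <= L j ->
  ~~ (lo < c <= hi) -> between e (pt j lo) v (pt j hi) ->
  d (pt j c) v = gap c (x j v).
Proof.
move=> /[dup] lh /andP[_ hL] cL nc /eqP; rewrite (pt_dist jk lh) => b.
have := gap_dist j (pt j lo) v; have := gap_dist j v (pt j hi).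
have := gap_dist j (pt j c) v.
have t1 := dist_tri e_conn (pt j lo) (pt j c) v.
have t2 := dist_tri e_conn (pt j hi) (pt j c) v.
rewrite !(pt_x jk) // /gap; try lia.
have [cl|lc] := leqP c lo.
  have e1 : d (pt j c) (pt j lo) = lo - c by rewrite (pt_dist jk) ?cl //; lia.
  by lia.
have hc : hi < c by lia.
have e1 : d (pt j c) (pt j hi) = c - hi by rewrite ds (pt_dist jk) ?(ltnW hc).
by rewrite (ds (pt j hi) v) in t2 *; lia.
Qed.

Lemma level_mate lo hi v : lo <= hi <= L j ->
  between e (pt j lo) v (pt j hi) ->
  between e (pt j lo) (pt j (x j v)) (pt j hi) /\
  d (pt j lo) v = d (pt j lo) (pt j (x j v)).
Proof.
move=> /[dup] lh /andP[lohi hL] bv; have /andP[l1 l2] := between_level lh bv.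
have lL : lo <= L j := leq_trans lohi hL; have vL := leq_trans l2 hL.
split; first by apply: (mem_between jk); rewrite ?pt_mem // !pt_x // l1 l2.
rewrite pt_dist ?l1 // (uncut_dist lh lL _ bv) ?ltnn // /gap.
by rewrite (eqP l1).
Qed.

Variable i : nat.
Hypothesis ik : i < k.

(** The position on [P j] with the [j]-coordinate of [v], or the last one if the
    path is too short. *)
Definition level (v : V) : nat := minn (x j v) (L j).

Definition below (v : V) : bool := x i v < x i (pt j (level v)).
Definition above (v : V) : bool := x i (pt j (level v)) < x i v.

(** Cut at the level of the vertex [w0] of [P i] below [P j] with the greatest
    [i]-coordinate.  For another such vertex [v] between the ends of an uncut
    interval, the distance from [v] to the cut position is a difference of
    [j]-coordinates, at most the distance of [v] and [w0]; the latter is a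
    difference of [i]-coordinates, since both are on [P i].  So the
    [i]-coordinate at the cut position is at most that of [w0], while [w0] is
    below. *)
Lemma below_cut : exists2 cs, size cs <= 1 &
  forall lo hi, lo <= hi <= L j -> uncut cs lo hi ->
    forall v, v \in P i -> between e (pt j lo) v (pt j hi) -> ~~ below v.
Proof.
case: (pickP (fun v => (v \in P i) && below v)) => [v0 v0P|nb]; last first.
  by exists [::] => // lo hi _ _ v vP _; have := nb v; rewrite vP /= => ->.
have [{v0P} w0 /andP[w0P b0] max] :=
  @arg_maxnP V v0 (fun v => (v \in P i) && below v) (fun v => x i v) v0P.
exists [:: level w0] => // lo hi lh; rewrite /uncut /= andbT => uc v vP bv.
apply/negP => bl; have := max v; rewrite /= vP bl => /(_ isT) vw0.
have lL : level w0 <= L j by exact: geq_minr.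
have := uncut_dist lh lL uc bv; have := between_level lh bv.
have := gap_dist i (pt j (level w0)) v; have := gap_dist j w0 v.
by rewrite (mem_dist ik w0P vP); rewrite /gap /below /level in b0 *; lia.
Qed.

Lemma above_cut : exists2 cs, size cs <= 1 &
  forall lo hi, lo <= hi <= L j -> uncut cs lo hi ->
    forall v, v \in P i -> between e (pt j lo) v (pt j hi) -> ~~ above v.
Proof.
case: (pickP (fun v => (v \in P i) && above v)) => [v0 v0P|nb]; last first.
  by exists [::] => // lo hi _ _ v vP _; have := nb v; rewrite vP /= => ->.
have [{v0P} w0 /andP[w0P b0] min] :=
  @arg_minnP V v0 (fun v => (v \in P i) && above v) (fun v => x i v) v0P.
exists [:: level w0] => // lo hi lh; rewrite /uncut /= andbT => uc v vP bv.
apply/negP => bl; have := min v; rewrite /= vP bl => /(_ isT) vw0.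
have lL : level w0 <= L j by exact: geq_minr.
have := uncut_dist lh lL uc bv; have := between_level lh bv.
have := gap_dist i (pt j (level w0)) v; have := gap_dist j w0 v.
by rewrite (mem_dist ik w0P vP); rewrite /gap /above /level in b0 *; lia.
Qed.

(** Each of the deviations [below] and [above] is excluded by a single cut. *)
Lemma crossing_cut : exists2 cs, size cs <= 2 &
  forall lo hi, lo <= hi <= L j -> uncut cs lo hi ->
    forall v, v \in P i -> between e (pt j lo) v (pt j hi) ->
      x i (pt j (x j v)) = x i v.
Proof.
have [cs sc Hc] := below_cut; have [cs' sc' Hc'] := above_cut.
exists (cs ++ cs') => [|lo hi lh]; first by rewrite size_cat; lia.
rewrite /uncut all_cat => /andP[u u'] v vP bv.
have := Hc _ _ lh u v vP bv; have := Hc' _ _ lh u' v vP bv.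
have lv := between_level lh bv.
rewrite /below /above /level (minn_idPl _); last by lia.
by rewrite -!leqNgt => ? ?; lia.
Qed.

End Crossing.

(** The zone is an interval of positions, so two cuts isolate it. *)
Lemma zone_cut j t : all (fun c => c < k) (j :: t) -> exists2 cs, size cs <= 2 &
  forall lo hi, lo <= hi <= L j -> uncut cs lo hi ->
    forall m, lo <= m <= hi ->
      zone (j :: t) (pt j m) = zone (j :: t) (pt j lo).
Proof.
move=> tk; have /andP[jk _] := tk.
pose b m := (m <= L j) && zone (j :: t) (pt j m).
have bL m : b m -> m <= L j by case/andP.
have bz m : m <= L j -> zone (j :: t) (pt j m) = b m by rewrite /b => ->.
have [exb|nb] : (exists m, b m) \/ forall m, b m = false.
- have [/existsP[m bm]|/existsPn nb] := boolP [exists m : 'I_(L j).+1, b m].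
    by left; exists m.
  right=> m; apply/negP => bm; have mL := bL m bm.
  by have := nb (inord m); rewrite inordK ?ltnS // bm.
- case: (ex_minnP exb) => al bal minal; case: (ex_maxnP exb bL) => om bom maxom.
  exists [:: al; om.+1] => // lo hi lh /and3P[u1 u2 _] m ml.
  have bE m' : m' <= L j -> b m' = (al <= m' <= om).
    move=> m'L; apply/idP/idP => [bm|am]; first by rewrite minal ?maxom.
    rewrite /b m'L; apply: (@zone_convex j t (pt j al) (pt j om)) => //.
    - by case/andP: bal.
    - by case/andP: bom.
    - exact: pt_mem.
    - have := bL _ bal; have := bL _ bom => omL aL.
      by apply: (mem_between jk); rewrite ?pt_mem // !pt_x //; lia.
  by rewrite !bz ?bE; try lia; apply/idP/idP; lia.
by exists [::] => // lo hi lh _ m ml; rewrite !bz ?nb //; lia.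
Qed.

(** ** Pieces *)

Local Notation tls j t :=
  (uniq (j :: t) && all (fun c => c < k) t).

(** Two cuts for each of the [k <= k!] paths and two for each of at most [k!]
    chains. *)
Lemma path_cuts j : j < k -> exists2 cs, size cs <= 4 * k`! &
  forall lo hi, lo <= hi <= L j -> uncut cs lo hi ->
    (forall i v, i < k -> v \in P i -> between e (pt j lo) v (pt j hi) ->
       x i (pt j (x j v)) = x i v) /\
    (forall t m, tls j t -> lo <= m <= hi ->
       zone (j :: t) (pt j m) = zone (j :: t) (pt j lo)).
Proof.
move=> jk.
have [|cs1 s1 H1] := @combine_cuts _ (iota 0 k) (L j) (fun i lo hi =>
    forall v, v \in P i -> between e (pt j lo) v (pt j hi) ->
       x i (pt j (x j v)) = x i v).
  by move=> i; rewrite mem_iota add0n => ik; exact: crossing_cut.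
have [|cs2 s2 H2] := @combine_cuts _ (tails (Ordinal jk)) (L j) (fun t lo hi =>
    forall m, lo <= m <= hi -> zone (j :: t) (pt j m) = zone (j :: t) (pt j lo)).
  move=> t; rewrite mem_tails => /andP[_ tk].
  by apply: zone_cut; rewrite /= jk.
exists (cs1 ++ cs2).
  have st := size_tails (Ordinal jk); have kf := leq_fact k.
  rewrite size_iota in s1; rewrite size_cat.
  apply: leq_trans (leq_add s1 s2) _; rewrite -mulnDr.
  by apply: leq_trans (leq_mul (leqnn 2) (leq_add kf st)) _; rewrite addnn; lia.
move=> lo hi lh; rewrite /uncut all_cat => /andP[u1 u2]; split=> [i v ik|t m tt].
  by apply: H1; rewrite ?mem_iota.
by apply: H2; rewrite ?mem_tails.
Qed.

Variable R : nat.
Hypothesis kR : 4 * k`! < R.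

Definition pieces_ok (j : nat) (f : (nat -> nat) * (nat -> nat)) : Prop :=
  [/\ f.1 0 = 0, f.2 R.-1 = L j,
    forall r, r.+1 < R ->
      f.1 r.+1 = f.2 r \/ f.1 r.+1 = (f.2 r).+1 &
    forall r, r < R -> let lo := f.1 r in let hi := f.2 r in
     [/\ lo <= hi <= L j,
    (forall i v, i < k -> v \in P i -> between e (pt j lo) v (pt j hi) ->
       x i (pt j (x j v)) = x i v) &
    (forall t m, tls j t -> lo <= m <= hi ->
       zone (j :: t) (pt j m) = zone (j :: t) (pt j lo))]].

Lemma pieces_of_paths : exists f : nat -> (nat -> nat) * (nat -> nat),
  forall j, j < k -> pieces_ok j (f j).
Proof.
apply: (bounded_choice (id, id)) => j jk.
have [cs scs Hcs] := path_cuts jk.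
have [f [f0 fR fu fl]] := pieces_exist (L j) (leq_ltn_trans scs kR).
exists f; split=> // r rR; have [lh u] := fu r rR.
by have [h1 h2] := Hcs _ _ lh u; split.
Qed.

Variable F : nat -> (nat -> nat) * (nat -> nat).
Hypothesis HF : forall j, j < k -> pieces_ok j (F j).

Local Notation M := (k * R).
Local Notation own := (own R).

Definition piece_lo (p : nat) : nat := (F (own p)).1 (p %% R).
Definition piece_hi (p : nat) : nat := (F (own p)).2 (p %% R).
Definition piece_len (p : nat) : nat := piece_hi p - piece_lo p.

Local Notation lo := piece_lo.
Local Notation hi := piece_hi.
Local Notation len := piece_len.

Let R0 : 0 < R. Proof. by case: R kR. Qed.

Lemma own_lt p : p < M -> own p < k.
Proof. by move=> pM; rewrite /own ltn_divLR. Qed.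

Lemma piece_range p : p < M -> lo p <= hi p <= L (own p).
Proof.
by move/own_lt/HF => [_ _ _ /(_ (p %% R))]; rewrite ltn_mod => /(_ R0)[].
Qed.

Lemma piece_cross p i v : p < M -> i < k -> v \in P i ->
  between e (pt (own p) (lo p)) v (pt (own p) (hi p)) ->
  x i (pt (own p) (x (own p) v)) = x i v.
Proof.
move=> /own_lt/HF [_ _ _ /(_ (p %% R))]; rewrite ltn_mod => /(_ R0)[_ H _].
exact: H.
Qed.

Lemma piece_zone p t m : p < M -> tls (own p) t -> lo p <= m <= hi p ->
  zone (own p :: t) (pt (own p) m) = zone (own p :: t) (pt (own p) (lo p)).
Proof.
move=> /own_lt/HF [_ _ _ /(_ (p %% R))]; rewrite ltn_mod => /(_ R0)[_ _ H].
exact: H.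
Qed.

(** *** Labels *)

(** By the choice of the cuts the first vertex of a piece represents all of
    them. *)
Definition has_label (p c : nat) : Prop := exists2 t, tls (own p) t &
  last (own p) t = c /\ zone (own p :: t) (pt (own p) (lo p)).

Definition least_label (p c : nat) : Prop :=
  has_label p c /\ forall c', has_label p c' -> c <= c'.

Lemma label_exists : exists lab : nat -> nat, forall p, p < M ->
  least_label p (lab p).
Proof.
apply: (bounded_choice 0) => p pM; have jk := own_lt pM.
pose b c := has (fun t => (last (own p) t == c) &&
  zone (own p :: t) (pt (own p) (lo p))) (tails (Ordinal jk)).
have bP c : reflect (has_label p c) (b c).
  apply: (iffP hasP) => [[t]|[t tt [<- zt]]].
    by rewrite mem_tails => tt /andP[/eqP lt zt]; exists t.
  by exists t; rewrite ?mem_tails // eqxx.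
have exb : exists c, b c.
  exists (own p); apply/bP; exists [::] => //; split=> //=.
  by rewrite pt_mem //; have := piece_range pM; lia.
by case: (ex_minnP exb) => c /bP hc minc; exists c; split=> // c' /bP/minc.
Qed.

Variable lab : nat -> nat.
Hypothesis labP : forall p, p < M -> least_label p (lab p).

(** The vertex [v] agrees with the vertex [y] of [q] at the same level in the
    coordinate [i], and [y] is in the zone of the chain [j :: t] behind the
    label of [q].  If [i] occurs in the chain, its suffix from [i] on is a chain
    for [p], as the partner of [y] on [P i] is [v] itself.  If not, [i] can be
    put in front of the chain, because [v] and [y] have the same distances to
    the ends of [q] and hence agree in all coordinates with unit speed. *)
Lemma label_mono p q m : p < M -> q < M -> own p != own q -> lo p <= m <= hi p ->
  between e (pt (own q) (lo q)) (pt (own p) m) (pt (own q) (hi q)) ->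
  lab p <= lab q.
Proof.
move=> pM qM npq mp bv; set v := pt (own p) m in bv.
set i := own p in npq v bv *; set j := own q in npq bv *.
have ik : i < k := own_lt pM; have jk : j < k := own_lt qM.
have lhp := piece_range pM; have lhq := piece_range qM.
have vP : v \in P i by apply: pt_mem; rewrite // -/i in lhp *; lia.
have ev := piece_cross qM ik vP bv; rewrite -/j in ev lhq.
have lv := between_level jk lhq bv.
have [[t tt [<- zt]] _] := labP qM; rewrite -/j in tt zt *.
set y := pt j (x j v) in ev.
have zy : zone (j :: t) y by rewrite /y (piece_zone qM).
have zv_lab t' : tls i t' -> zone (i :: t') v -> lab p <= last i t'.
  move=> tt' zv; have [_] := labP pM; apply; exists t' => //; split=> //.
  by rewrite -(piece_zone (m := m) pM).
have [it|nit] := boolP (i \in t).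
  case/splitPr: it tt zy {zt} => t1 t2 /andP[ut kt] zy.
  have [u zu xu] := zone_suffix zy.
  have uv : u = v.
    by apply: (mem_inj ik (zone_mem zu) vP); rewrite xu ev.
  rewrite last_cat /=; apply: zv_lab; rewrite -?uv //.
  move: ut kt; rewrite -cat_cons cat_uniq all_cat /= => /and3P[_ _ ->].
  by case/and3P.
have nij : i \notin j :: t by rewrite inE negb_or npq.
have /andP[ut kt] := tt.
suff zv : zone (i :: j :: t) v.
  have -> : last j t = last i (j :: t) by [].
  by apply: zv_lab; rewrite // cons_uniq nij ut /= jk kt.
apply/andP; split=> //; apply/orP; right; apply/existsP; exists y.
apply/andP; split=> //; apply/allP => c; rewrite in_cons => /orP[/eqP->|cjt].
  by rewrite ev.
have zlo : zone (j :: t) (pt j (lo q)) by [].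
have zhi : zone (j :: t) (pt j (hi q)).
  by rewrite (piece_zone qM) // leqnn andbT; case/andP: lhq.
have jkt : all (fun c => c < k) (j :: t) by rewrite /= jk.
have [by_ dy] := level_mate jk lhq bv.
by apply/eqP/(same_coord (zone_color jkt zlo zhi cjt) by_ dy bv).
Qed.

(** *** Timetable *)

(** The pebble walks in the direction in which its label coordinate grows. *)
Definition forward (p : nat) : bool :=
  x (lab p) (pt (own p) (lo p)) <= x (lab p) (pt (own p) (hi p)).

Definition stop (p m : nat) : V :=
  pt (own p) (if forward p then lo p + m else hi p - m).

(** Labels and label coordinates are combined into one clock: coordinates are
    smaller than [#|V|], so the front of the label [c] occupies the times from
    [c * #|V|] on. *)
Definition departure (p : nat) : nat := lab p * #|V| + x (lab p) (stop p 0).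

(** At the time [tau] the pebbles move one after another; [p < h] says that [p]
    has had its turn. *)
Definition elapsed (h tau p : nat) : nat :=
  minn (len p) (tau + (p < h) - departure p).

Definition timetable (h tau p : nat) : V := stop p (elapsed h tau p).

Local Notation start := (stop^~ 0).

Lemma stop_mem p m : p < M -> m <= len p -> stop p m \in P (own p).
Proof.
move=> pM ml; have := piece_range pM; rewrite /len in ml.
by move=> lh; apply: pt_mem; [exact: own_lt | case: ifP => _; lia].
Qed.

Lemma stop_dist p m m' : p < M -> m <= m' <= len p ->
  d (stop p m) (stop p m') = m' - m.
Proof.
move=> pM ml; have lh := piece_range pM; rewrite /len in ml.
have jk := own_lt pM; rewrite /stop; case: ifP => _.
  by rewrite (pt_dist jk); lia.
by rewrite ds (pt_dist jk); lia.
Qed.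

(** The label coordinate grows with unit speed from end to end, so it must do so
    on the way. *)
Lemma stop_label p m : p < M -> m <= len p ->
  x (lab p) (stop p m) = x (lab p) (stop p 0) + m.
Proof.
move=> pM ml; have lh := piece_range pM.
have E : x (lab p) (stop p (len p)) = x (lab p) (stop p 0) + len p.
  have [[t tt [lt zt]] _] := labP pM; have /andP[_ tk] := tt.
  have jk := own_lt pM.
  have jtk : all (fun c => c < k) (own p :: t) by rewrite /= jk.
  have zt' : zone (own p :: t) (pt (own p) (hi p)).
    by rewrite (piece_zone pM) // leqnn andbT; case/andP: lh.
  have ct : lab p \in own p :: t by rewrite -lt mem_last.
  have := zone_color jtk zt zt' ct; rewrite (pt_dist jk) // /gap.
  rewrite /stop /forward /len; case/andP: lh => lh _.
  by case: ifP => f; rewrite ?addn0 ?subn0 ?subnKC ?subKn //; lia.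
have := gap_dist (lab p) (stop p 0) (stop p m).
have := gap_dist (lab p) (stop p m) (stop p (len p)).
by rewrite !stop_dist ?E ?ml //; rewrite /gap; lia.
Qed.

Lemma stop_piece p m : p < M -> m <= len p ->
  exists2 l, lo p <= l <= hi p & stop p m = pt (own p) l.
Proof.
move=> pM ml; have lh := piece_range pM; rewrite /len in ml.
by rewrite /stop; case: ifP => _; [exists (lo p + m)|exists (hi p - m)] => //; lia.
Qed.

Lemma stop_neq p q m m' : p < M -> q < M -> own p != own q ->
  m <= len p -> m' <= len q -> stop p m != stop q m'.
Proof.
move=> pM qM npq ml ml'; have [_ H] := solP.
have := H _ _ (stop p m) (own_lt pM) (own_lt qM) npq (stop_mem pM ml).
by apply: contraNneq => ->; apply: stop_mem.
Qed.

Lemma label_lt p : p < M -> lab p < k.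
Proof.
move=> pM; have [[t /andP[_ tk] [<- _]] _] := labP pM.
have := mem_last (own p) t; rewrite in_cons => /orP[/eqP->|]; first exact: own_lt.
by move/allP: tk; apply.
Qed.

(** A geodesic from the start of [q] to a position of its pebble extends to the
    other end of the piece, so [label_mono] applies. *)
Lemma stop_between p q m m' : p < M -> q < M -> own p != own q ->
  m <= len p -> m' <= len q -> between e (stop q 0) (stop p m) (stop q m') ->
  lab p <= lab q.
Proof.
move=> pM qM npq ml ml' b; have [l lp el] := stop_piece pM ml.
apply: (label_mono pM qM npq lp); rewrite -el; move: b; rewrite /between.
rewrite (stop_dist qM) ?ml' // subn0 => /eqP b.
have := dist_tri e_conn (stop q m') (stop p m) (stop q (len q)).
rewrite (stop_dist qM) ?ml' ?leqnn // => t1.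
have := dist_tri e_conn (stop p m) (stop q 0) (stop q (len q)).
rewrite (stop_dist qM) ?leqnn // => t2.
have E : d (stop q 0) (stop p m) + d (stop p m) (stop q (len q)) = len q by lia.
have lhq := piece_range qM; case/andP: (lhq) => lhq' _.
rewrite (pt_dist (own_lt qM)) // -/(len q) -{}E.
move: (stop p m) => v; rewrite /stop /len.
case: ifP => f; rewrite ?addn0 ?subn0 ?subnKC ?subKn //.
by rewrite addnC (ds v) (ds (pt (own q) (lo q))).
Qed.

(** A pebble [q] that prevents the move has left its start, hence has a label and
    a coordinate not ahead of the clock; together with [stop_between] this puts
    [h] and [q] on the same front, where the target of [h] can be between the
    start and the position of [q] only as this position. *)
Lemma timetable_move h tau : h < M -> departure h <= tau < departure h + len h ->
  move_ok e k R start (timetable h tau) h (stop h (tau - departure h).+1).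
Proof.
move=> hM tl; have jl : (tau - departure h).+1 <= len h by lia.
have ih : elapsed h tau h = tau - departure h by rewrite /elapsed ltnn; lia.
rewrite /timetable; split; rewrite ?ih.
- by rewrite !stop_dist //; lia.
- by rewrite stop_dist // ?leqnSn ?jl //; lia.
move=> q qM nqh; set v := stop h _; set jq := elapsed h tau q.
have jql : jq <= len q by exact: geq_minl.
have nhq : own h != own q by rewrite eq_sym.
have neq m' : m' <= len q -> v != stop q m' by move=> ?; apply: stop_neq.
apply/negP => b.
have [j0|j0] := posnP jq.
  move: b; rewrite j0 /between dist0 // (ds v) addnn double_eq0 dist_eq0 //.
  by rewrite eq_sym; apply/negP/neq.
have xv : x (lab h) v = x (lab h) (stop h 0) + (tau - departure h).+1.
  exact: stop_label.
(* The target of [h] is where the front arrives next. *)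
have key : lab h * #|V| + x (lab h) v = tau.+1.
  by rewrite xv; move: tl; rewrite /departure; lia.
have jqE : departure q + jq <= tau.+1.
  by move: j0; rewrite /jq /elapsed; case: (q < h); lia.
have lhq : lab h <= lab q := stop_between hM qM nhq jl jql b.
have xV : x (lab h) v < #|V| by exact: dist_lt.
have lqh : lab q <= lab h.
  by rewrite leqNgt; apply/negP => lt; move: jqE; rewrite /departure; nia.
have el : lab q = lab h by apply/eqP; rewrite eqn_leq lhq lqh.
have xq := stop_label qM (leq0n (len q)).
have := gap_dist (lab h) (stop q 0) v; rewrite /gap => g.
move: b; rewrite /between (stop_dist qM) ?jql // subn0 => /eqP b.
have : d v (stop q jq) == 0 by move: jqE; rewrite /departure el; lia.
by rewrite dist_eq0 //; apply/negP/neq.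
Qed.

Lemma elapsed_step h tau : h < M -> elapsed h.+1 tau h = elapsed h tau h \/
  departure h <= tau < departure h + len h /\
  elapsed h.+1 tau h = (tau - departure h).+1.
Proof. by rewrite /elapsed ltnn ltnSn; lia. Qed.

Lemma play_ext a y W y' : play e k R a y W -> (forall p, p < M -> y' p = y p) ->
  play e k R a y' W.
Proof.
case=> {a y W} [a y W da ya Wa|a y W a' z W' p pl pM aa yW mv W'p] yy'.
  by apply: PlayStart => // p pM; rewrite yy' // ya.
apply: (PlayMove pl pM aa) => [q qM nqp||]; rewrite ?yy' //.
exact: yW.
Qed.

Lemma play_timetable_step h tau W : h < M ->
  play e k R start (timetable h tau) W ->
  exists W', play e k R start (timetable h.+1 tau) W'.
Proof.
move=> hM pl; have oth q : q != h -> timetable h.+1 tau q = timetable h tau q.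
  by move=> nqh; rewrite /timetable /elapsed ltnS leq_eqVlt (negPf nqh).
case: (elapsed_step tau hM) => [E|[hl E]].
  exists W; apply: play_ext pl _ => q qM.
  by case: (eqVneq q h) => [->|/oth//]; rewrite /timetable E.
pose v := timetable h.+1 tau h.
exists (fun q => if q == h then v :: W h else W q).
apply: (PlayMove pl hM) => // [q qM nqh||]; last by rewrite eqxx.
  by rewrite oth // (negPf nqh).
by rewrite /timetable E; apply: timetable_move.
Qed.

(** Time [tau.+1] before the first turn is time [tau] after the last one. *)
Lemma play_timetable h tau : h <= M ->
  exists W, play e k R start (timetable h tau) W.
Proof.
elim: tau h => [|tau IHtau]; elim=> [|h IHh] hM.
- exists (fun p => [:: start p]); apply: PlayStart => // p q pM qM npq.
  exact: stop_neq.
- have [W pl] := IHh (ltnW hM); exact: play_timetable_step pl.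
- have [W pl] := IHtau M (leqnn _); exists W; apply: play_ext pl _ => p pM.
  by rewrite /timetable /elapsed ltn0 pM addn0 addn1.
- have [W pl] := IHh (ltnW hM); exact: play_timetable_step pl.
Qed.

(** After the time [k * #|V|] the fronts of all labels have passed. *)
Lemma arrived p : p < M -> timetable 0 (k * #|V|) p = stop p (len p).
Proof.
move=> pM; rewrite /timetable /elapsed ltn0 addn0; congr stop; apply/minn_idPl.
have := dist_lt e_conn (S (lab p)) (stop p (len p)).
rewrite (stop_label pM) // /departure => lt.
by have := label_lt pM; nia.
Qed.

Lemma own_piece i r : r < R -> own (i * R + r) = i /\ (i * R + r) %% R = r.
Proof.
by move=> rR; rewrite /own divnMDl // modnMDl modn_small // divn_small // addn0.
Qed.

Lemma timetable_lohi i r : i < k -> r < R ->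
  let p := i * R + r in let y := timetable 0 (k * #|V|) in
  near_end e S start y i p = pt i (lo p) /\ far_end e S start y i p = pt i (hi p).
Proof.
move=> ik rR p y; have [ow _] := own_piece i rR.
have pM : p < M by rewrite /p; nia.
have lh := piece_range pM; rewrite -/p in ow; have /andP[loh hL] := lh.
rewrite ow in hL; have lL : lo p <= L i := leq_trans loh hL.
rewrite /near_end /far_end /y arrived // /stop ow /len.
case: (forward p); rewrite ?addn0 ?subn0 ?subnKC ?subKn //.
  rewrite !pt_x //; case: ltnP => // hl.
  by have -> : lo p = hi p by apply/eqP; rewrite eqn_leq loh hl.
by rewrite !pt_x // ltnNge loh.
Qed.

Lemma timetable_accepting : accepting e k R S T start (timetable 0 (k * #|V|)).
Proof.
move=> i ik; set y := timetable _ _.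
have [F0 FL Fl Fp] := HF ik.
have loE r : r < R -> lo (i * R + r) = (F i).1 r.
  by move=> rR; rewrite /piece_lo; have [-> ->] := own_piece i rR.
have hiE r : r < R -> hi (i * R + r) = (F i).2 r.
  by move=> rR; rewrite /piece_hi; have [-> ->] := own_piece i rR.
have prevE r : r < R -> reached e R S start y i r.+1 = pt i ((F i).2 r).
  by move=> rR; rewrite /= (timetable_lohi ik rR).2 hiE.
have LE : pt i (L i) = T i.
  have [/(_ i ik)[q Pq [pq lq sq]] _] := solP.
  by rewrite /pt Pq -sq -last_nth.
split=> [r rR|]; last by have := prevE R.-1; rewrite prednK // => ->; rewrite ?FL.
have [lh _ _] := Fp r rR; have /andP[loh hL] := lh.
have [lE hE] := timetable_lohi ik rR.
have lL : (F i).1 r <= L i := leq_trans loh hL.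
rewrite loE // in lE; rewrite hiE // in hE.
rewrite /link_ok lE hE (pt_dist ik lh) (pt_x ik lL) (pt_x ik hL).
rewrite subnKC // eqxx /=; case: r rR lh loh hL lL {lE hE} => [|r] rR lh loh hL lL.
  rewrite /= F0; have -> : S i = pt i 0 by rewrite /pt; have [/(_ i ik)[q ->]] := solP.
  by rewrite dist0.
have [lh' _ _] := Fp r (ltnW rR); have /andP[loh' hL'] := lh'.
rewrite (prevE r (ltnW rR)) (pt_x ik hL') (pt_dist ik).
  by case: (Fl r rR) => ->; rewrite ?subnn ?addn0 ?eqxx // subSnn addn1 eqxx.
by rewrite (leq_trans loh hL) andbT; case: (Fl r rR) => ->.
Qed.

End Completeness.

Lemma search_complete (V : finType) (e : rel V) (k R : nat) (S T : nat -> V) P :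
  (forall x y, connect e x y) -> symmetric e -> 4 * k`! < R ->
  disjoint_geodesics e k S T P ->
  exists a y W, play e k R a y W /\ accepting e k R S T a y.
Proof.
move=> e_conn e_sym kR solP.
have [F HF] := pieces_of_paths e_conn e_sym solP kR.
have [lab labP] := label_exists solP kR HF.
have [W pl] := play_timetable e_conn e_sym solP kR HF labP (k * #|V|) (leq0n _).
exists (fun p => stop e S P R F lab p 0); exists (timetable e S P R F lab 0 (k * #|V|)); exists W.
by split=> //; move=> i ik; apply: (timetable_accepting _ _ solP kR HF labP).
Qed.

(** * A language of bounded loops and its compilation *)

Inductive expr : Type :=
| Var of nat
| Cst of nat
| Plus of expr & expr
| Minus of expr & expr
| Less of expr & expr
| Get of nat & expr
| Inp of expr.

(** [When] takes the first branch on a nonzero value.  [Repeat x b s] runs [s] as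
    often as the variable [b] says, with [x] counting from [0]. *)
Inductive stmt : Type :=
| Let of nat & expr
| Put of nat & expr & expr
| Emit of expr & expr
| Then of stmt & stmt
| When of expr & stmt & stmt
| Repeat of nat & nat & stmt.

(** Besides variables there are unbounded arrays, called banks, and the memory
    below a base address, which holds first the input and finally the output. *)
Record store : Type :=
  MkStore { var : nat -> nat; arr : nat -> nat -> nat; inp : nat -> nat }.

Definition set_var (g : store) (x v : nat) : store :=
  MkStore (fun y => if y == x then v else var g y) (arr g) (inp g).

Definition set_arr (g : store) (b i v : nat) : store :=
  MkStore (var g)
    (fun b' i' => if (b' == b) && (i' == i) then v else arr g b' i') (inp g).

Definition set_inp (g : store) (i v : nat) : store :=
  MkStore (var g) (arr g) (fun i' => if i' == i then v else inp g i').

Section Semantics.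

Variable B : nat.

Fixpoint eval (g : store) (e : expr) : nat :=
  match e with
  | Var x => var g x
  | Cst c => c
  | Plus e1 e2 => eval g e1 + eval g e2
  | Minus e1 e2 => eval g e1 - eval g e2
  | Less e1 e2 => eval g e1 < eval g e2
  | Get b e1 => arr g b (eval g e1)
  | Inp e1 => if eval g e1 < B then inp g (eval g e1) else 0
  end.

Fixpoint run (s : stmt) (g : store) : store :=
  match s with
  | Let x e => set_var g x (eval g e)
  | Put b e1 e2 => set_arr g b (eval g e1) (eval g e2)
  | Emit e1 e2 =>
      if eval g e1 < B then set_inp g (eval g e1) (eval g e2) else g
  | Then s1 s2 => run s2 (run s1 g)
  | When e s1 s2 => if 0 < eval g e then run s1 g else run s2 g
  | Repeat x b s1 => iteri (var g b) (fun i g' => run s1 (set_var g' x i)) g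
  end.

(** Invariants are indexed by the number of completed turns. *)
Lemma run_repeat (I : nat -> store -> Prop) x b s g : I 0 g ->
  (forall i g', i < var g b -> I i g' -> I i.+1 (run s (set_var g' x i))) ->
  I (var g b) (run (Repeat x b s) g).
Proof.
move=> I0 IS /=; have: var g b <= var g b by [].
elim: {1 3 4}(var g b) => //= m IHm mb.
by apply: IS => //; apply/IHm/ltnW.
Qed.

Fixpoint vars_of (s : stmt) : seq nat :=
  match s with
  | Let x _ => [:: x]
  | Then s1 s2 | When _ s1 s2 => vars_of s1 ++ vars_of s2
  | Repeat x _ s1 => x :: vars_of s1
  | _ => [::]
  end.

Fixpoint banks_of (s : stmt) : seq nat :=
  match s with
  | Put b _ _ => [:: b]
  | Then s1 s2 | When _ s1 s2 => banks_of s1 ++ banks_of s2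
  | Repeat _ _ s1 => banks_of s1
  | _ => [::]
  end.

Fixpoint emits (s : stmt) : bool :=
  match s with
  | Emit _ _ => true
  | Then s1 s2 | When _ s1 s2 => emits s1 || emits s2
  | Repeat _ _ s1 => emits s1
  | _ => false
  end.

Lemma run_var s g x : x \notin vars_of s -> var (run s g) x = var g x.
Proof.
elim: s g => [y e|b e1 e2|e1 e2|s1 IH1 s2 IH2|e s1 IH1 s2 IH2|y b s IH] g //=.
- by rewrite inE => /negPf->.
- by case: ifP.
- by rewrite mem_cat negb_or => /andP[n1 n2]; rewrite IH2 ?IH1.
- by rewrite mem_cat negb_or => /andP[n1 n2]; case: ifP => _; rewrite ?IH2 ?IH1.
rewrite inE negb_or => /andP[nxy ns].
by elim: (var g b) => //= m <-; rewrite IH //= (negPf nxy).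
Qed.

Lemma run_arr s g b i : b \notin banks_of s -> arr (run s g) b i = arr g b i.
Proof.
elim: s g => [y e|b' e1 e2|e1 e2|s1 IH1 s2 IH2|e s1 IH1 s2 IH2|y b' s IH] g //=.
- by rewrite inE => /negPf->.
- by case: ifP.
- by rewrite mem_cat negb_or => /andP[n1 n2]; rewrite IH2 ?IH1.
- by rewrite mem_cat negb_or => /andP[n1 n2]; case: ifP => _; rewrite ?IH2 ?IH1.
by move=> ns; elim: (var g b') => //= m <-; rewrite IH.
Qed.

Lemma run_inp s g i : ~~ emits s -> inp (run s g) i = inp g i.
Proof.
elim: s g => [y e|b' e1 e2|e1 e2|s1 IH1 s2 IH2|e s1 IH1 s2 IH2|y b' s IH] g //=.
- by rewrite negb_or => /andP[n1 n2]; rewrite IH2 ?IH1.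
- by rewrite negb_or => /andP[n1 n2]; case: ifP => _; rewrite ?IH2 ?IH1.
by move=> ns; elim: (var g b') => //= m <-; rewrite IH.
Qed.

End Semantics.

(** ** Compilation *)

(** Registers modulo 4: variables, temporaries, loop counters and loop limits.
    The first four registers stay outside this scheme; register 0 holds zero and
    register 1 the base address. *)
Notation rV x := (4 * x + 4).
Notation rT t := (4 * t + 5).
Notation rC l := (4 * l + 6).
Notation rN l := (4 * l + 7).

Fixpoint seqs (c : cmd) (cs : seq cmd) : cmd :=
  if cs is c' :: cs' then Seq c (seqs c' cs') else c.

(** The cell [i] of the bank [b] is at [B + 16 * i + b]: interleaving gives each
    of the 16 banks infinitely many cells, so that no sizes have to be known in
    advance.  Four doublings multiply by 16. *)
Definition address (b t : nat) : cmd :=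
  seqs (Add (rT t) (rT t) (rT t))
    [:: Add (rT t) (rT t) (rT t); Add (rT t) (rT t) (rT t);
        Add (rT t) (rT t) (rT t); Const (rT t.+1) b;
        Add (rT t) (rT t) (rT t.+1); Add (rT t) (rT t) 1].

Fixpoint compile_expr (e : expr) (t : nat) : cmd :=
  match e with
  | Var x => Add (rT t) (rV x) 0
  | Cst c => Const (rT t) c
  | Plus e1 e2 => seqs (compile_expr e1 t)
      [:: compile_expr e2 t.+1; Add (rT t) (rT t) (rT t.+1)]
  | Minus e1 e2 => seqs (compile_expr e1 t)
      [:: compile_expr e2 t.+1; Defs.Sub (rT t) (rT t) (rT t.+1)]
  | Less e1 e2 => seqs (compile_expr e1 t)
      [:: compile_expr e2 t.+1;
          IfLt (rT t) (rT t.+1) (Const (rT t) 1) (Const (rT t) 0)]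
  | Get b e1 => seqs (compile_expr e1 t) [:: address b t; Fetch (rT t) (rT t)]
  | Inp e1 => Seq (compile_expr e1 t)
      (IfLt (rT t) 1 (Fetch (rT t) (rT t)) (Const (rT t) 0))
  end.

Fixpoint compile (s : stmt) (l : nat) : cmd :=
  match s with
  | Let x e => Seq (compile_expr e 0) (Add (rV x) (rT 0) 0)
  | Put b e1 e2 => seqs (compile_expr e2 0)
      [:: compile_expr e1 1; address b 1; Store (rT 1) (rT 0)]
  | Emit e1 e2 => seqs (compile_expr e2 0)
      [:: compile_expr e1 1; IfLt (rT 1) 1 (Store (rT 1) (rT 0)) Skip]
  | Then s1 s2 => Seq (compile s1 l) (compile s2 l)
  | When e s1 s2 =>
      Seq (compile_expr e 0) (IfLt 0 (rT 0) (compile s1 l) (compile s2 l))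
  | Repeat x b s1 => seqs (Add (rN l) (rV b) 0)
      [:: Const (rC l) 0;
          WhileLt (rC l) (rN l)
            (seqs (Add (rV x) (rC l) 0)
               [:: compile s1 l.+1; Const (rT 0) 1; Add (rC l) (rC l) (rT 0)])]
  end.

Fixpoint expr_cost (e : expr) : nat :=
  match e with
  | Var _ | Cst _ => 1
  | Plus e1 e2 | Minus e1 e2 => expr_cost e1 + expr_cost e2 + 1
  | Less e1 e2 => expr_cost e1 + expr_cost e2 + 2
  | Get _ e1 => expr_cost e1 + 8
  | Inp e1 => expr_cost e1 + 2
  end.

(** Bounds the steps for given values [r] of the loop bounds; both branches of a
    test are charged. *)
Fixpoint cost (r : nat -> nat) (s : stmt) : nat :=
  match s with
  | Let _ e => expr_cost e + 1
  | Put _ e1 e2 => expr_cost e1 + expr_cost e2 + 8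
  | Emit e1 e2 => expr_cost e1 + expr_cost e2 + 2
  | Then s1 s2 => cost r s1 + cost r s2
  | When e s1 s2 => expr_cost e + cost r s1 + cost r s2 + 1
  | Repeat _ b s1 => r b * (cost r s1 + 4) + 3
  end.

Fixpoint expr_banks (e : expr) : bool :=
  match e with
  | Var _ | Cst _ => true
  | Plus e1 e2 | Minus e1 e2 | Less e1 e2 => expr_banks e1 && expr_banks e2
  | Get b e1 => (b < 16) && expr_banks e1
  | Inp e1 => expr_banks e1
  end.

(** The variables in [K] are never assigned, so the loop bounds, taken from [K],
    have the same value wherever they are read; and bank numbers are below
    16. *)
Fixpoint wellformed (K : seq nat) (s : stmt) : bool :=
  match s with
  | Let x e => (x \notin K) && expr_banks e
  | Put b e1 e2 => [&& b < 16, expr_banks e1 & expr_banks e2]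
  | Emit e1 e2 => expr_banks e1 && expr_banks e2
  | Then s1 s2 => wellformed K s1 && wellformed K s2
  | When e s1 s2 => [&& expr_banks e, wellformed K s1 & wellformed K s2]
  | Repeat x b s1 => [&& x \notin K, b \in K & wellformed K s1]
  end.

Lemma wellformed_vars K s : wellformed K s -> forall x, x \in K -> x \notin vars_of s.
Proof.
move=> wf x xK; elim: s wf => [y e|b e1 e2|e1 e2|s1 IH1 s2 IH2|e s1 IH1 s2 IH2|y b s IH] //=.
- by case/andP=> yK _; rewrite inE; apply: contraNneq yK => <-.
- by case/andP=> /IH1 n1 /IH2 n2; rewrite mem_cat negb_or n1.
- by case/and3P=> _ /IH1 n1 /IH2 n2; rewrite mem_cat negb_or n1.
case/and3P=> yK _ /IH n1; rewrite inE negb_or n1 andbT.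
by apply: contraNneq yK => <-.
Qed.

Definition represents (B : nat) (g : store) (st : state) : Prop :=
  [/\ reg st 0 = 0, reg st 1 = B, forall x, reg st (rV x) = var g x,
      forall b i, b < 16 -> Defs.mem st (B + (16 * i + b)) = arr g b i &
      forall a, a < B -> Defs.mem st a = inp g a].

Lemma exec_seqs c c' cs st st1 st2 T1 T2 : exec c st T1 st1 ->
  exec (seqs c' cs) st1 T2 st2 -> exec (seqs c (c' :: cs)) st (T1 + T2) st2.
Proof. exact: ExecSeq. Qed.

(** Only the temporaries [t] and [t.+1] are touched. *)
Lemma address_ok b t st : reg st 0 = 0 ->
  exists2 st', exec (address b t) st 7 st' &
    [/\ reg st' (rT t) = reg st 1 + (16 * reg st (rT t) + b),
        forall r, r != rT t -> r != rT t.+1 -> reg st' r = reg st r &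
        Defs.mem st' = Defs.mem st].
Proof.
move=> r0; eexists.
  rewrite /address -[7]/(1 + (1 + (1 + (1 + (1 + (1 + 1)))))).
  do 6 (apply: exec_seqs; [by constructor|]); by constructor.
have n1 : (rT t.+1 == rT t) = false by lia.
have n2 : (1 == rT t) = false by lia.
have n3 : (1 == rT t.+1) = false by lia.
have n4 : (rT t == rT t.+1) = false by lia.
split=> //=; first by rewrite !(eqxx, n1, n2, n3, n4) /=; lia.
by move=> r /negPf nr /negPf nr'; rewrite !(nr, nr').
Qed.

(** Temporaries below [t] hold pending operands and survive. *)
Definition computes B g (e : expr) : Prop := forall t st, represents B g st ->
  exists2 st', exec (compile_expr e t) st (expr_cost e) st' &
    [/\ reg st' (rT t) = eval B g e,
        forall r, (forall t', t <= t' -> r != rT t') -> reg st' r = reg st r &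
        Defs.mem st' = Defs.mem st].

Lemma compile_expr_ok B e g : expr_banks e -> computes B g e.
Proof.
have low t1 t2 : t1 < t2 -> forall t', t2 <= t' -> rT t1 != rT t' by lia.
have rep st1 st2 t1 : (forall r, (forall t', t1 <= t' -> r != rT t') ->
    reg st2 r = reg st1 r) -> Defs.mem st2 = Defs.mem st1 ->
    represents B g st1 -> represents B g st2.
  move=> rr mm [r0 r1 rv ma mi]; split; rewrite ?mm //.
  - by rewrite rr // => t' _; lia.
  - by rewrite rr // => t' _; lia.
  - by move=> x; rewrite rr // => t' _; lia.
have bin e1 e2 t1 st1 : computes B g e1 -> computes B g e2 -> represents B g st1 ->
   exists2 st2, exec (Seq (compile_expr e1 t1) (compile_expr e2 t1.+1)) st1
                   (expr_cost e1 + expr_cost e2) st2 &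
    [/\ reg st2 (rT t1) = eval B g e1, reg st2 (rT t1.+1) = eval B g e2,
        forall r, (forall t', t1 <= t' -> r != rT t') -> reg st2 r = reg st1 r &
        Defs.mem st2 = Defs.mem st1].
  move=> IH1 IH2 R1; have [st2 x2 [v2 f2 m2]] := IH1 t1 st1 R1.
  have [st3 x3 [v3 f3 m3]] := IH2 t1.+1 st2 (rep _ _ _ f2 m2 R1).
  exists st3; first exact: ExecSeq x2 x3.
  split=> //; last by rewrite m3.
    by rewrite f3 //; apply: low.
  by move=> r rt; rewrite f3 ?f2 // => t' tt'; exact/rt/ltnW.
have seqA c1 c2 c3 st1 T1 T2 st2 st3 : exec (Seq c1 c2) st1 T1 st2 ->
    exec c3 st2 T2 st3 -> exec (Seq c1 (Seq c2 c3)) st1 (T1 + T2) st3.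
  move=> x12 x3; inversion x12; subst; rewrite -addnA.
  by apply: ExecSeq; [eassumption|apply: ExecSeq; eassumption].
have fin t st1 st2 v : (forall r, (forall t', t <= t' -> r != rT t') ->
    reg st2 r = reg st1 r) -> Defs.mem st2 = Defs.mem st1 ->
    [/\ reg (set_reg st2 (rT t) v) (rT t) = v,
      forall r, (forall t', t <= t' -> r != rT t') ->
        reg (set_reg st2 (rT t) v) r = reg st1 r &
      Defs.mem (set_reg st2 (rT t) v) = Defs.mem st1].
  by move=> rr mm; split=> [|r rt|] //=; rewrite ?eqxx // (negPf (rt t (leqnn _))) rr.
elim: e => [x|c|e1 IH1 e2 IH2|e1 IH1 e2 IH2|e1 IH1 e2 IH2|b e1 IH1|e1 IH1] /=.
- move=> _ t st [r0 r1 rv ma mi]; eexists; first by constructor.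
  by rewrite /= -rv r0 addn0; apply: fin.
- by move=> _ t st _; eexists; [constructor|apply: fin].
- case/andP=> w1 w2 t st Rst; have [st2 x2 [v1 v2 f2 m2]] := bin e1 e2 t st (IH1 w1) (IH2 w2) Rst.
  by eexists; [apply: seqA x2 _; constructor|rewrite /= -v1 -v2; apply: fin].
- case/andP=> w1 w2 t st Rst; have [st2 x2 [v1 v2 f2 m2]] := bin e1 e2 t st (IH1 w1) (IH2 w2) Rst.
  by eexists; [apply: seqA x2 _; constructor|rewrite /= -v1 -v2; apply: fin].
- case/andP=> w1 w2 t st Rst; have [st2 x2 [v1 v2 f2 m2]] := bin e1 e2 t st (IH1 w1) (IH2 w2) Rst.
  rewrite [eval _ _ _]/=; case: ltnP => h; eexists; try apply: fin f2 m2.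
    by apply: seqA x2 _; apply: ExecIfTrue; rewrite ?v1 ?v2 //; constructor.
  by apply: seqA x2 _; apply: ExecIfFalse; rewrite ?v1 ?v2 //; constructor.
- case/andP=> b16 w1 t st Rst; have [st1 x1 [v1 f1 m1]] := IH1 w1 t st Rst.
  have [r0 r1 rv ma mi] := rep _ _ _ f1 m1 Rst.
  have [st2 x2 [v2 f2 m2]] := address_ok b t r0.
  eexists.
    apply: ExecSeq x1 _; rewrite -[8]/(7 + 1).
    by apply: ExecSeq x2 _; constructor.
  rewrite v2 m2 r1 v1 ma // [eval _ _ _]/=; apply: fin => [r rt|]; last by rewrite m2.
  by rewrite f2 ?f1 //; exact: rt.
move=> w1 t st Rst; have [st1 x1 [v1 f1 m1]] := IH1 w1 t st Rst.
have [r0 r1 rv ma mi] := rep _ _ _ f1 m1 Rst.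
rewrite [eval _ _ _]/=; case: ltnP => h; eexists.
- by apply: ExecSeq x1 _; apply: ExecIfTrue; rewrite ?v1 ?r1 //; constructor.
- by rewrite v1 mi //; apply: fin.
- by apply: ExecSeq x1 _; apply: ExecIfFalse; rewrite ?v1 ?r1 //; constructor.
exact: fin.
Qed.

Lemma represents_keep B g st st' : represents B g st ->
  (forall r, r \in [:: 0; 1] -> reg st' r = reg st r) ->
  (forall x, reg st' (rV x) = reg st (rV x)) -> Defs.mem st' = Defs.mem st ->
  represents B g st'.
Proof.
move=> [r0 r1 rv ma mi] kr kv km; split; rewrite ?km ?kr //.
by move=> x; rewrite kv.
Qed.

Lemma represents_var B g st x v st' : represents B g st ->
  reg st' =1 reg (set_reg st (rV x) v) -> Defs.mem st' = Defs.mem st ->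
  represents B (set_var g x v) st'.
Proof.
move=> [r0 r1 rv ma mi] E km; split; rewrite ?km //.
- by rewrite E /=; case: eqP => //; lia.
- by rewrite E /=; case: eqP => //; lia.
move=> y; rewrite E /=; have [->|nxy] := eqVneq y x; first by rewrite eqxx.
by case: eqP => // Exy; move: nxy; case: eqP => //; lia.
Qed.

(** Counters and limits of the enclosing loops, at depths below [l], survive;
    this makes the induction go through for nested loops. *)
Lemma compile_ok B K rho s l g st : wellformed K s ->
  (forall v, v \in K -> var g v = rho v) -> represents B g st ->
  exists T st', [/\ exec (compile s l) st T st', T <= cost rho s,
    represents B (run B s g) st' &
    forall l', l' < l -> reg st' (rC l') = reg st (rC l') /\
      reg st' (rN l') = reg st (rN l')].
Proof.
have kT st1 st2 t l' : (forall r, (forall t', t <= t' -> r != rT t') ->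
    reg st2 r = reg st1 r) -> reg st2 (rC l') = reg st1 (rC l') /\
    reg st2 (rN l') = reg st1 (rN l').
  by move=> H; split; apply: H => t' _; lia.
have kR g1 st1 st2 t : represents B g1 st1 ->
    (forall r, (forall t', t <= t' -> r != rT t') -> reg st2 r = reg st1 r) ->
    Defs.mem st2 = Defs.mem st1 -> represents B g1 st2.
  move=> R H; apply: represents_keep => // [r|x]; last by apply: H => t' _; lia.
  by rewrite !inE => /orP[]/eqP->; apply: H => t' _; lia.
elim: s l g st => [x e|b e1 e2|e1 e2|s1 IH1 s2 IH2|e s1 IH1 s2 IH2|x b s IH] l g st /=.
- case/andP=> _ we _ Rst; have [st1 x1 [v1 f1 m1]] := compile_expr_ok we 0 Rst.
  have R1 := kR _ _ _ _ Rst f1 m1; have [r0 _ _ _ _] := R1.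
  exists (expr_cost e + 1), (set_reg st1 (rV x) (reg st1 (rT 0) + reg st1 0)).
  split=> //; first by apply: ExecSeq x1 _; constructor.
    by apply: represents_var R1 _ _ => // r /=; rewrite v1 r0 addn0.
  move=> l' _ /=; have [<- <-] := kT _ _ _ l' f1.
  by split; case: eqP => //; lia.
- case/and3P=> b16 w1 w2 _ Rst; have [st1 x1 [v1 f1 m1]] := compile_expr_ok w2 0 Rst.
  have R1 := kR _ _ _ _ Rst f1 m1.
  have [st2 x2 [v2 f2 m2]] := compile_expr_ok w1 1 R1.
  have R2 := kR _ _ _ _ R1 f2 m2; have [r0 r1 rv ma mi] := R2.
  have [st3 x3 [v3 f3 m3]] := address_ok b 1 r0.
  have e0 : reg st3 (rT 0) = eval B g e2.
    by rewrite f3 // f2 ?v1 // => t' t'1; lia.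
  have e1' : reg st3 (rT 1) = B + (16 * eval B g e1 + b) by rewrite v3 v2 r1.
  exists (expr_cost e2 + (expr_cost e1 + (7 + 1))).
  exists (set_mem st3 (B + (16 * eval B g e1 + b)) (eval B g e2)); split.
  + apply: ExecSeq x1 _; apply: ExecSeq x2 _; apply: ExecSeq x3 _.
    by rewrite -e1' -e0; constructor.
  + by lia.
  + split=> /=; rewrite ?f3 ?m3 //; first by move=> y; rewrite f3 ?rv //; lia.
      move=> b' i b'16.
      have [/andP[/eqP-> /eqP->]|nbi] := boolP ((b' == b) && (i == eval B g e1)).
        by rewrite eqxx.
      case: eqP => [E|_]; last by rewrite ma.
      by case/negP: nbi; apply/andP; split; apply/eqP; lia.
    by move=> a aB; case: eqP => [|_]; [lia|rewrite mi].
  + move=> l' _ /=; rewrite !f3 ?(kT _ _ _ l' f2).1 ?(kT _ _ _ l' f2).2; try lia.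
    exact: kT f1.
- case/andP=> w1 w2 _ Rst; have [st1 x1 [v1 f1 m1]] := compile_expr_ok w2 0 Rst.
  have R1 := kR _ _ _ _ Rst f1 m1.
  have [st2 x2 [v2 f2 m2]] := compile_expr_ok w1 1 R1.
  have R2 := kR _ _ _ _ R1 f2 m2; have [r0 r1 rv ma mi] := R2.
  have e0 : reg st2 (rT 0) = eval B g e2 by rewrite f2 ?v1 // => t' t'1; lia.
  have kp l' : reg st2 (rC l') = reg st (rC l') /\ reg st2 (rN l') = reg st (rN l').
    by have [-> ->] := kT _ _ _ l' f2; exact: kT f1.
  exists (expr_cost e2 + (expr_cost e1 + 2)).
  case: ltnP => eB.
    exists (set_mem st2 (eval B g e1) (eval B g e2)); split=> //.
    + apply: ExecSeq x1 _; apply: ExecSeq x2 _; apply: ExecIfTrue.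
        by rewrite v2 r1.
      by rewrite -v2 -e0; constructor.
    + by lia.
    + split=> //=.
        by move=> b' i b'16; case: eqP => [|_]; [lia|rewrite ma].
      by move=> a aB; case: eqP => [|_] //; rewrite mi.
    + by move=> l' _; exact: kp.
  exists st2; split=> //.
  + apply: ExecSeq x1 _; apply: ExecSeq x2 _; apply: ExecIfFalse.
      by rewrite v2 r1.
    by constructor.
  + by lia.
- case/andP=> w1 w2 gK Rst; have [T1 [st1 [x1 t1 R1 k1]]] := IH1 l g st w1 gK Rst.
  have gK1 v : v \in K -> var (run B s1 g) v = rho v.
    by move=> vK; rewrite run_var ?gK //; apply: wellformed_vars w1 _ vK.
  have [T2 [st2 [x2 t2 R2 k2]]] := IH2 l _ st1 w2 gK1 R1.
  exists (T1 + T2), st2; split=> //; first exact: ExecSeq x1 x2.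
    exact: leq_add.
  by move=> l' l'l; have [-> ->] := k2 l' l'l; apply: k1.
- case/and3P=> we w1 w2 gK Rst; have [st0 x0 [v0 f0 m0]] := compile_expr_ok we 0 Rst.
  have R0 := kR _ _ _ _ Rst f0 m0; have [r0 _ _ _ _] := R0.
  case: ltnP => ev.
    have [T1 [st1 [x1 t1 R1 k1]]] := IH1 l g st0 w1 gK R0.
    exists (expr_cost e + T1.+1), st1; split=> //; last 1 first.
    + by move=> l' l'l; have [-> ->] := k1 l' l'l; apply: kT f0.
    + by apply: ExecSeq x0 _; apply: ExecIfTrue => //; rewrite r0 v0.
    + by lia.
  have [T1 [st1 [x1 t1 R1 k1]]] := IH2 l g st0 w2 gK R0.
  exists (expr_cost e + T1.+1), st1; split=> //; last 1 first.
  + by move=> l' l'l; have [-> ->] := k1 l' l'l; apply: kT f0.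
  + by apply: ExecSeq x0 _; apply: ExecIfFalse => //; rewrite r0 v0.
  + by lia.
case/and3P=> xK bK ws gK Rst; have [r0 _ rv _ _] := Rst.
pose F i g' := run B s (set_var g' x i).
set n := var g b; have nE : n = rho b by apply: gK.
pose body := seqs (Add (rV x) (rC l) 0)
   [:: compile s l.+1; Const (rT 0) 1; Add (rC l) (rC l) (rT 0)].
have loop m i st1 : i + m = n -> represents B (iteri i F g) st1 ->
    reg st1 (rC l) = i -> reg st1 (rN l) = n ->
    exists T st2, [/\ exec (WhileLt (rC l) (rN l) body) st1 T st2,
      T <= m * (cost rho s + 4) + 1, represents B (iteri n F g) st2 &
      forall l', l' < l -> reg st2 (rC l') = reg st1 (rC l') /\
        reg st2 (rN l') = reg st1 (rN l')].
  elim: m i st1 => [|m IHm] i st1 imn R1 ci ni.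
    exists 1, st1; split=> //; last by rewrite -imn addn0.
    by apply: ExecWhileFalse; lia.
  pose st2 := set_reg st1 (rV x) (reg st1 (rC l) + reg st1 0).
  have R2 : represents B (set_var (iteri i F g) x i) st2.
    have [r0' _ _ _ _] := R1.
    by apply: represents_var R1 _ _ => // r; rewrite /st2 ci r0' addn0.
  have xn y : y \in K -> y != x by move=> yK; apply: contraNneq xK => <-.
  have [|T3 [st3 [x3 t3 R3 k3]]] := IH l.+1 _ st2 ws _ R2.
    move=> v vK; rewrite /= (negPf (xn v vK)) -gK //.
    elim: (i) => //= i' <-; rewrite /F run_var /=; last first.
      exact: wellformed_vars ws _ vK.
    by rewrite (negPf (xn v vK)).
  pose st4 := set_reg st3 (rT 0) 1.
  pose st5 := set_reg st4 (rC l) (reg st4 (rC l) + reg st4 (rT 0)).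
  have [c3 n3] := k3 l (leqnn _).
  have n1 : (rC l == rV x) = false by lia.
  have n2 : (rN l == rV x) = false by lia.
  have n4 : (rC l == rT 0) = false by lia.
  have n5 : (rN l == rT 0) = false by lia.
  have n6 : (rN l == rC l) = false by lia.
  rewrite /st2 /= n1 in c3; rewrite /st2 /= n2 in n3.
  have R5 : represents B (iteri i.+1 F g) st5.
    apply: represents_keep R3 _ _ _ => //=.
      by move=> r; rewrite !inE => /orP[]/eqP->; do 2 (case: eqP; first lia).
    by move=> y; do 2 (case: eqP; first lia).
  have [|||T6 [st6 [x6 t6 R6 k6]]] := IHm i.+1 st5 _ R5; first lia.
  - by rewrite /st5 /st4 /= !eqxx n4 c3 ci addn1.
  - by rewrite /st5 /st4 /= n6 n5 n3.
  exists ((1 + (T3 + (1 + 1)) + T6).+1), st6; split=> //; last first.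
  - move=> l' l'l; have [-> ->] := k6 l' l'l.
    have [c7 n7] := k3 l' (ltnW l'l); rewrite /st5 /st4 /=.
    have -> : (rC l' == rC l) = false by lia.
    have -> : (rN l' == rC l) = false by lia.
    have -> : (rC l' == rT 0) = false by lia.
    have -> : (rN l' == rT 0) = false by lia.
    rewrite c7 n7 /st2 /=.
    have -> : (rC l' == rV x) = false by lia.
    by have -> : (rN l' == rV x) = false by lia.
  - by move: t3 t6; rewrite mulSn; lia.
  apply: ExecWhileTrue x6; first lia.
  apply: ExecSeq; first by constructor.
  apply: ExecSeq x3 _.
  by apply: ExecSeq; constructor.
pose st1 := set_reg st (rN l) (reg st (rV b) + reg st 0).
pose st2 := set_reg st1 (rC l) 0.
have n6 : (rN l == rC l) = false by lia.
have [||||T3 [st3 [x3 t3 R3 k3]]] := loop n 0 st2.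
- by [].
- apply: represents_keep Rst _ _ _ => //=.
    by move=> r; rewrite !inE => /orP[]/eqP->; do 2 (case: eqP; first lia).
  by move=> y; do 2 (case: eqP; first lia).
- by rewrite /= eqxx.
- by rewrite /= n6 eqxx r0 addn0 rv.
exists (1 + (1 + T3)), st3; split=> //; last first.
- move=> l' l'l; have [-> ->] := k3 l' l'l; rewrite /st2 /st1 /=.
  have -> : (rC l' == rC l) = false by lia.
  have -> : (rC l' == rN l) = false by lia.
  have -> : (rN l' == rC l) = false by lia.
  by have -> : (rN l' == rN l) = false by lia.
- by move: t3; rewrite nE; lia.
apply: ExecSeq; first by constructor.
apply: ExecSeq; first by constructor.
exact: x3.
Qed.

(** * Digits *)

Section Digits.

Variable n : nat.
Hypothesis n0 : 0 < n.

(** A configuration is stored as the number whose digits in base [n] are its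
    vertices. *)
Definition digit (c q : nat) : nat := (c %/ n ^ q) %% n.

Lemma digit_lt c q : digit c q < n.
Proof. by rewrite /digit ltn_mod. Qed.

Let pow_gt0 q : 0 < n ^ q. Proof. by rewrite expn_gt0 n0. Qed.

Lemma digit_low c q q' : q' < q -> digit (c %% n ^ q) q' = digit c q'.
Proof.
move=> qq; rewrite /digit; have -> : n ^ q = n ^ (q - q'.+1) * n * n ^ q'.
  by rewrite -expnSr -expnD; congr (_ ^ _); lia.
by rewrite -modn_divl modn_dvdm // dvdn_mull.
Qed.

Lemma digit_high c q q' : q <= q' -> digit c q' = digit (c %/ n ^ q) (q' - q).
Proof. by move=> qq; rewrite /digit -divnMA -expnD subnKC. Qed.

Lemma digit_top c q : (c %% n ^ q.+1) %/ n ^ q = digit c q.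
Proof. by rewrite /digit expnS modn_divl. Qed.

Lemma modn_digit c q : c %% n ^ q.+1 = digit c q * n ^ q + c %% n ^ q.
Proof.
rewrite {1}(divn_eq (c %% n ^ q.+1) (n ^ q)) digit_top modn_dvdm //.
by rewrite expnS dvdn_mull.
Qed.

(** The new code is computed from multiples of powers of [n] alone, which can be
    tabulated, so that no multiplication is called for. *)
Lemma digit_replace c m q y : c < n ^ m -> q < m -> y < n ->
  let c' := (c + y * n ^ q) - digit c q * n ^ q in
  [/\ c' < n ^ m, digit c' q = y &
      forall q', q' != q -> digit c' q' = digit c q'].
Proof.
move=> cm qm yn c'; set h := c %/ n ^ q.+1; set l := c %% n ^ q.
have cE : c = h * n ^ q.+1 + digit c q * n ^ q + l.
  by rewrite {1}(divn_eq c (n ^ q.+1)) modn_digit addnA.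
have c'E : c' = h * n ^ q.+1 + (y * n ^ q + l) by rewrite /c' {1}cE; lia.
have ln : l < n ^ q by rewrite ltn_mod.
have yl : y * n ^ q + l < n ^ q.+1 by rewrite expnS; nia.
have hi : c' %/ n ^ q.+1 = h by rewrite c'E divnMDl // divn_small // addn0.
have lo : c' %% n ^ q = l.
  by rewrite c'E expnS mulnA addnA -mulnDl modnMDl modn_small.
split=> [||q' nq].
- have hm : h < n ^ (m - q.+1).
    by rewrite ltn_divLR // -expnD addnC subnKC.
  have -> : n ^ m = n ^ (m - q.+1) * n ^ q.+1 by rewrite -expnD subnK.
  rewrite c'E; apply: leq_trans (_ : h.+1 * n ^ q.+1 <= _).
    by rewrite mulSnr ltn_add2l.
  by rewrite leq_mul2r hm orbT.
- rewrite -digit_top c'E modnMDl modn_small // divnMDl // divn_small //.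
  by rewrite addn0.
have [lt|gt|eq] := ltngtP q' q.
- by rewrite -(digit_low _ lt) lo digit_low.
- by rewrite (digit_high _ gt) hi -digit_high.
by rewrite eq eqxx in nq.
Qed.

Lemma digits_exist m (D : nat -> nat) : (forall q, q < m -> D q < n) ->
  exists2 c, c < n ^ m & forall q, q < m -> digit c q = D q.
Proof.
elim: m => [|m IHm] Dn; first by exists 0.
have [q qm|c cm cD] := IHm; first exact/Dn/ltnW.
exists (D m * n ^ m + c) => [|q].
  by have := Dn m (leqnn _); rewrite expnS; nia.
rewrite ltnS leq_eqVlt => /orP[/eqP->|qm].
  rewrite /digit divnMDl // divn_small // addn0 modn_small //; exact: Dn.
by rewrite -(digit_low _ qm) modnMDl digit_low // cD.
Qed.

End Digits.

(** * The program *)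

(** Variables that serve as loop bounds: numbers of vertices and of paths, base
    address, pieces per path, pieces, digits, rows of the tables, rounds and
    codes.  They come first, so that being above 8 means not being one of
    them. *)
Notation vN := 0. Notation vK := 1. Notation vB := 2. Notation vR := 3.
Notation vM := 4. Notation vD := 5. Notation vZ := 6. Notation vT := 7.
Notation vC := 8.

Notation xf := 10. Notation xg := 11. Notation xi := 12. Notation xj := 13.
Notation xp := 14. Notation xq := 15. Notation xr := 16. Notation xu := 17.
Notation xv := 18. Notation xw := 19. Notation xl := 20. Notation xc := 21.
Notation xd := 22. Notation xok := 23. Notation xfound := 24.
Notation xfin := 25. Notation xrem := 26. Notation xprev := 27.
Notation xslack := 28. Notation xlo := 29. Notation xhi := 30.
Notation xoff := 31. Notation xt := 32. Notation xs := 33. Notation xround := 34.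

(** Banks: multiples of [n] for addressing rows, owner of each piece, terminals,
    distance matrix, multiples [v * n ^ q], digits of the code at hand, parents
    of codes and places of the first vertices of the paths in the output. *)
Notation bRow := 0. Notation bOwn := 1. Notation bSrc := 2. Notation bTgt := 3.
Notation bDist := 4. Notation bPow := 5. Notation bDig := 6. Notation bPar := 7.
Notation bOff := 8.

(** Truth values are 0 and 1, and the machine can only compare for [<]. *)
Definition Eq a b := Minus (Cst 1) (Plus (Less a b) (Less b a)).
Definition Not a := Minus (Cst 1) a.
Definition And a b := Less (Cst 1) (Plus a b).
Definition Or a b := Less (Cst 0) (Plus a b).
Definition Leq a b := Not (Less b a).
Definition Dist u v := Get bDist (Plus (Get bRow u) v).
Definition Pow q v := Get bPow (Plus (Get bRow q) v).
Definition Dig p := Get bDig p.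
Definition Own p := Get bOwn p.

Definition Block (s : stmt) (ss : seq stmt) : stmt :=
  foldl Then s ss.
Definition If e s := When e s (Let xf (Cst 0)).
Definition Incr x := Let x (Plus (Var x) (Cst 1)).
Definition Check e := Let xok (And (Var xok) e).

(** The machine cannot multiply: products arise by repeated addition. *)
Definition base_size : stmt :=
  Then (Let vB (Plus (Plus (Var vK) (Var vK)) (Cst 2)))
       (Repeat xi vN (Let vB (Plus (Var vB) (Var vN)))).

(** [(i + 1)!] is [i!] added up [i + 1] times.  The inner loop runs over a fixed
    range and skips the excess, because [xi] is no admissible loop bound. *)
Definition compute_factorial : stmt :=
  Then (Let xf (Cst 1))
    (Repeat xi vK (Block (Let xg (Cst 0))
      [:: Repeat xj vK
            (When (Less (Var xj) (Plus (Var xi) (Cst 1)))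
              (Let xg (Plus (Var xg) (Var xf))) (Let xr (Cst 0)));
          Let xf (Var xg)])).

Definition sizes : stmt :=
  Block compute_factorial
    [:: Let vR (Plus (Plus (Plus (Var xf) (Var xf)) (Plus (Var xf) (Var xf))) (Cst 1));
        Let vM (Cst 0);
        Repeat xi vK (Let vM (Plus (Var vM) (Var vR)));
        Let vD (Plus (Var vM) (Var vM));
        Let vZ (Plus (Var vD) (Var vN));
        Let vT (Cst 0);
        Repeat xi vN (Let vT (Plus (Var vT) (Var vM)))].

Definition fill_rows : stmt :=
  Then (Let xg (Cst 0))
    (Repeat xp vZ (Then (Put bRow (Var xp) (Var xg))
                        (Let xg (Plus (Var xg) (Var vN))))).

Definition fill_owners : stmt :=
  Then (Let xc (Cst 0))
    (Repeat xi vK (Repeat xr vR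
      (Then (Put bOwn (Var xc) (Var xi)) (Incr xc)))).

Definition fill_terminals : stmt :=
  Repeat xi vK
    (Then (Put bSrc (Var xi) (Inp (Plus (Cst 2) (Plus (Var xi) (Var xi)))))
          (Put bTgt (Var xi) (Inp (Plus (Cst 3) (Plus (Var xi) (Var xi)))))).

Definition Edge u v :=
  Inp (Plus (Plus (Plus (Cst 2) (Plus (Var vK) (Var vK))) (Get bRow u)) v).

Definition PutDist u v x := Put bDist (Plus (Get bRow u) v) x.

Definition init_distances : stmt :=
  Repeat xu vN (Repeat xv vN
    (When (Eq (Var xu) (Var xv)) (PutDist (Var xu) (Var xv) (Cst 0))
                                 (PutDist (Var xu) (Var xv) (Var vN)))).

(** Breadth-first search by layers: [v] gets the distance [l + 1] as soon as it
    has a neighbour at the distance [l].  The value [n], larger than every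
    distance, marks cells that are still open. *)
Definition relax : stmt :=
  Repeat xw vN
    (If (And (Eq (Dist (Var xu) (Var xw)) (Var xl)) (Edge (Var xw) (Var xv)))
        (PutDist (Var xu) (Var xv) (Plus (Var xl) (Cst 1)))).

Definition fill_distances : stmt :=
  Then init_distances
    (Repeat xl vN (Repeat xu vN (Repeat xv vN
      (If (Eq (Dist (Var xu) (Var xv)) (Var vN)) relax)))).

Definition fill_powers : stmt :=
  Then (Let vC (Cst 1))
    (Repeat xp vD
      (Block (Let xg (Cst 0))
         [:: Repeat xv vN
              (Then (Put bPow (Plus (Get bRow (Var xp)) (Var xv)) (Var xg))
                    (Let xg (Plus (Var xg) (Var vC))));
             Let vC (Var xg)])).

Definition tables : stmt :=
  Block fill_rows [:: fill_owners; fill_terminals; fill_distances; fill_powers].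

(** The last [v] with [v * n ^ q] not above the remainder overwrites the earlier
    ones. *)
Definition decode_digit : stmt :=
  Repeat xv vN
    (If (Leq (Pow (Var xq) (Var xv)) (Var xrem)) (Put bDig (Var xq) (Var xv))).

Definition decode : stmt :=
  Block (Let xrem (Var xc))
    [:: Let xq (Var vD);
        Repeat xj vD
          (Block (Let xq (Minus (Var xq) (Cst 1)))
             [:: decode_digit;
                 Let xrem (Minus (Var xrem) (Pow (Var xq) (Dig (Var xq))))])].

Definition PieceY p := Dig (Plus (Var vM) p).

(** An entry of [bPar] is 0 for a code that has not been reached and the parent
    plus 1 otherwise; initial configurations are their own parents. *)
Definition try_start : stmt :=
  Block (Let xok (Cst 1))
    [:: Repeat xp vM
         (Then (Check (Eq (Dig (Var xp)) (PieceY (Var xp))))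
           (Repeat xq vM
              (Check (Or (Eq (Own (Var xp)) (Own (Var xq)))
                         (Not (Eq (Dig (Var xp)) (Dig (Var xq))))))));
        If (Var xok) (Put bPar (Var xc) (Plus (Var xc) (Cst 1)))].

(** Moves are tried backwards: [xd] is the code [xc] with the pebble [xp] put back
    on the vertex [xu], and [xc] is reached if [xd] has been and the move from
    [xu] to the present position is legal. *)
Definition try_move : stmt :=
  Block (Let xd (Minus (Plus (Var xc) (Pow (Plus (Var vM) (Var xp)) (Var xu)))
                       (Pow (Plus (Var vM) (Var xp)) (PieceY (Var xp)))))
    [:: Let xok (And (Less (Cst 0) (Get bPar (Var xd)))
          (And (Eq (Plus (Dist (Dig (Var xp)) (Var xu)) (Cst 1))
                   (Dist (Dig (Var xp)) (PieceY (Var xp))))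
               (Eq (Dist (Var xu) (PieceY (Var xp))) (Cst 1))));
        Repeat xq vM
          (Check (Or (Eq (Own (Var xp)) (Own (Var xq)))
             (Not (Eq (Plus (Dist (Dig (Var xq)) (PieceY (Var xp)))
                            (Dist (PieceY (Var xp)) (PieceY (Var xq))))
                      (Dist (Dig (Var xq)) (PieceY (Var xq)))))));
        If (Var xok) (Put bPar (Var xc) (Plus (Var xd) (Cst 1)))].

Definition try_moves : stmt := Repeat xp vM (Repeat xu vN try_move).

Definition orient : stmt :=
  When (Less (Dist (Var xs) (Dig (Var xp))) (Dist (Var xs) (PieceY (Var xp))))
    (Then (Let xlo (Dig (Var xp))) (Let xhi (PieceY (Var xp))))
    (Then (Let xlo (PieceY (Var xp))) (Let xhi (Dig (Var xp)))).

(** [xslack] is 0 for the first piece and 1 later on: a path begins at its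
    terminal, while two pieces may be joined by an edge. *)
Definition check_link : stmt :=
  Block orient
    [:: Check (Eq (Plus (Dist (Var xs) (Var xlo)) (Dist (Var xlo) (Var xhi)))
                  (Dist (Var xs) (Var xhi)));
        Check (Eq (Plus (Dist (Var xs) (Var xprev)) (Dist (Var xprev) (Var xlo)))
                  (Dist (Var xs) (Var xlo)));
        Check (Leq (Dist (Var xprev) (Var xlo)) (Var xslack));
        Let xprev (Var xhi); Let xslack (Cst 1); Incr xp].

Definition check_path : stmt :=
  Block (Let xs (Get bSrc (Var xi)))
    [:: Let xprev (Var xs); Let xslack (Cst 0); Repeat xr vR check_link;
        Check (Eq (Var xprev) (Get bTgt (Var xi)))].

Definition check_accepting : stmt :=
  Block (Let xok (Cst 1)) [:: Let xp (Cst 0); Repeat xi vK check_path].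

Definition visit : stmt :=
  Block decode
    [:: try_start; try_moves;
        If (And (Not (Var xfound)) (Less (Cst 0) (Get bPar (Var xc))))
           (Then check_accepting
             (If (Var xok) (Then (Let xfound (Cst 1)) (Let xfin (Var xc)))))].

(** A round reaches all codes that are one move beyond those reached before, so
    as many rounds as a play can have moves reach everything. *)
Definition search : stmt :=
  Then (Let xfound (Cst 0)) (Repeat xround vT (Repeat xc vC visit)).

Definition emit_sizes : stmt :=
  Block (Emit (Cst 0) (Cst 1))
    [:: Let xoff (Cst 1);
        Repeat xi vK
          (Block (Let xl (Dist (Get bSrc (Var xi)) (Get bTgt (Var xi))))
            [:: Emit (Var xoff) (Plus (Var xl) (Cst 1));
                Put bOff (Var xi) (Plus (Var xoff) (Cst 1));
                Let xoff (Plus (Plus (Var xoff) (Var xl)) (Cst 2))])].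

(** The distance from [s_i] is the place of a vertex in a shortest path from
    [s_i], so each vertex goes to its final place at once and in any order. *)
Definition emit_state : stmt :=
  Repeat xp vM
    (Emit (Plus (Get bOff (Own (Var xp)))
                (Dist (Get bSrc (Own (Var xp))) (PieceY (Var xp))))
          (PieceY (Var xp))).

Definition emit_paths : stmt :=
  Then (Let xc (Var xfin))
    (Repeat xt vT
      (Block decode [:: emit_state; Let xc (Minus (Get bPar (Var xc)) (Cst 1))])).

Definition answer : stmt :=
  When (Var xfound) (Then emit_sizes emit_paths) (Emit (Cst 0) (Cst 0)).

Definition solve : stmt := Then search answer.

Lemma wf_base_size : wellformed [:: vN] base_size. Proof. by []. Qed.
Lemma wf_sizes : wellformed [:: vN; vK] sizes. Proof. by []. Qed.
Lemma wf_tables : wellformed [:: vN; vK; vR; vM; vD; vZ] tables. Proof. by []. Qed.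
Lemma wf_solve : wellformed [:: vN; vK; vR; vM; vD; vZ; vT; vC] solve.
Proof. by []. Qed.

(** * Evaluation, sizes and tables *)
Section Eval.
Variables (B : nat) (g : store).
Lemma eval_Eq a b : eval B g (Eq a b) = (eval B g a == eval B g b).
Proof. by rewrite /=; case: ltngtP. Qed.
Lemma eval_Not a (b : bool) : eval B g a = b -> eval B g (Not a) = ~~ b.
Proof. by move=> /= ->; case: b. Qed.
Lemma eval_And a b (p q : bool) : eval B g a = p -> eval B g b = q ->
  eval B g (And a b) = p && q.
Proof. by move=> /= -> ->; case: p; case: q. Qed.
Lemma eval_Or a b (p q : bool) : eval B g a = p -> eval B g b = q ->
  eval B g (Or a b) = p || q.
Proof. by move=> /= -> ->; case: p; case: q. Qed.
Lemma eval_Leq a b : eval B g (Leq a b) = (eval B g a <= eval B g b).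
Proof. by rewrite /=; case: ltnP. Qed.
End Eval.

Section Stages.

Variable B : nat.
Local Notation run := (run B).
Local Notation eval := (eval B).

Lemma run_then s1 s2 g : run (Then s1 s2) g = run s2 (run s1 g).
Proof. by []. Qed.

Lemma run_when e s1 s2 (c : bool) g : eval g e = c ->
  run (When e s1 s2) g = if c then run s1 g else run s2 g.
Proof. by move=> /= ->; case: c. Qed.

Lemma run_if_var e s (c : bool) g x : eval g e = c -> x != xf ->
  var (run (If e s) g) x = if c then var (run s g) x else var g x.
Proof. by move=> ec nx; rewrite (run_when _ _ ec); case: c {ec} => //=; rewrite (negPf nx). Qed.

Lemma run_if_arr e s (c : bool) g b i : eval g e = c ->
  arr (run (If e s) g) b i = if c then arr (run s g) b i else arr g b i.
Proof. by move=> ec; rewrite (run_when _ _ ec); case: c {ec}. Qed.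

Lemma base_sizeP g : var (run base_size g) vB =
  var g vK + var g vK + 2 + var g vN * var g vN.
Proof.
rewrite run_then; set g1 := run _ g.
have := @run_repeat B (fun i g' => var g' vB = var g vK + var g vK + 2 + i * var g vN
  /\ var g' vN = var g vN) xi vN (Let vB (Plus (Var vB) (Var vN))) g1.
case=> [|i g' _ [h1 h2]|-> _] //=; first by rewrite mul0n addn0.
by split=> //; rewrite h1 h2 mulSnr addnA.
Qed.

Lemma factorialP g : var (run compute_factorial g) xf = (var g vK)`!.
Proof.
rewrite run_then; set g1 := run _ g; set k := var g vK.
pose I i g' := var g' xf = i`! /\ var g' vK = k.
suff [//] : I (var g1 vK) (run (Repeat xi vK (Block (Let xg (Cst 0))
      [:: Repeat xj vK
            (When (Less (Var xj) (Plus (Var xi) (Cst 1)))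
              (Let xg (Plus (Var xg) (Var xf))) (Let xr (Cst 0)));
          Let xf (Var xg)])) g1).
apply: run_repeat => // i g' ik [h1 h2].
rewrite /Block [foldl _ _ _]/= !run_then; set g2 := run (Let xg _) _.
set loop := Repeat xj _ _; set g3 := run loop g2.
have [e1 e2] : var g3 xg = minn (var g2 vK) i.+1 * i`! /\ var g3 xf = i`!.
  pose J j g' := [/\ var g' xg = minn j i.+1 * i`!, var g' xf = i`! & var g' xi = i].
  suff [] : J (var g2 vK) g3 by [].
  apply: run_repeat => [|j g4 jk [j1 j2 j3]]; first by split.
  rewrite (@run_when _ _ _ (j <= i)) /=; last by rewrite j3 addn1.
  by case: leqP => ij; split=> //=; rewrite j1 ?j2 -?mulSnr; congr (_ * _); lia.
have e3 : var g3 vK = k by rewrite run_var // h2.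
split=> //=; rewrite e1 factS; congr (_ * _); apply/minn_idPr.
by rewrite /= h2; apply: ik.
Qed.

Lemma sizesP g n k : var g vN = n -> var g vK = k ->
  let g' := run sizes g in let R := (4 * k`!).+1 in
  [/\ var g' vN = n /\ var g' vK = k, var g' vR = R, var g' vM = k * R /\
    var g' vD = k * R + k * R, var g' vZ = k * R + k * R + n &
    var g' vT = n * (k * R)].
Proof.
move=> gn gk g' R.
have h1 : var g' vN = n /\ var g' vK = k by rewrite !run_var.
rewrite /g' /sizes /Block [foldl _ _ _]/= !run_then.
set g0 := run compute_factorial g.
have f0 : var g0 xf = k`! by rewrite factorialP gk.
set g1 := run (Let vR _) g0.
have r1 : var g1 vR = R by rewrite /= f0 /R; lia.
set g2 := run (Let vM _) g1.
set g3 := run (Repeat _ _ _) g2.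
have k2 : var g2 vK = k by rewrite /= run_var.
have [m3 r3] : var g3 vM = k * R /\ var g3 vR = R.
  pose I i g' := var g' vM = i * R /\ var g' vR = R.
  rewrite -k2; suff : I (var g2 vK) g3 by [].
  apply: run_repeat => [|i g4 ik [i1 i2]]; first by split.
  by split=> //=; rewrite i1 i2 mulSnr.
set g4 := run (Let vD _) g3; set g5 := run (Let vZ _) g4.
set g6 := run (Let vT _) g5; set g7 := run (Repeat _ _ _) g6.
have n3 : var g3 vN = n by rewrite run_var //= run_var.
have t7 : var g7 vT = n * (k * R) /\ var g7 vM = k * R.
  pose I i g' := var g' vT = i * (k * R) /\ var g' vM = k * R.
  have n6 : var g6 vN = n by [].
  rewrite -n6; suff : I (var g6 vN) g7 by [].
  apply: run_repeat => [|i g8 ik [i1 i2]]; first by split.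
  by split=> //=; rewrite i1 i2 mulSnr.
case: t7 => t7 m7; split=> //; first by rewrite run_var.
  by split=> //; rewrite run_var //= m3.
by rewrite run_var //= m3 n3.
Qed.

Section Tables.

Variables n k R : nat.
Hypothesis R0 : 0 < R.
Local Notation M := (k * R).

Variables (S T : nat -> nat) (adj : nat -> nat -> bool) (dn : nat -> nat -> nat).
Hypothesis dn_lt : forall u v, u < n -> v < n -> dn u v < n.
Hypothesis dn_eq0 : forall u v, u < n -> v < n -> (dn u v == 0) = (u == v).
Hypothesis dn_next : forall u v l, u < n -> v < n -> l < dn u v ->
  (dn u v == l.+1) = has (fun w => (dn u w == l) && adj w v) (iota 0 n).

(** The input as it is laid out below the base address. *)
Definition given g :=
  [/\ forall i, i < k -> inp g (2 + (i + i)) = S i,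
      forall i, i < k -> inp g (3 + (i + i)) = T i &
      forall u v, u < n -> v < n -> inp g (2 + (k + k) + u * n + v) = adj u v].

Definition bounds g := [/\ var g vN = n, var g vK = k, var g vR = R, var g vM = M &
  var g vD = M + M /\ var g vZ = M + M + n].

Definition rows g := forall p, p < M + M + n -> arr g bRow p = p * n.

Lemma fill_rowsP g : bounds g -> rows (run fill_rows g).
Proof.
case=> gn _ _ _ [_ gz]; rewrite run_then; set g1 := run _ g.
pose I i g' := [/\ var g' xg = i * n, var g' vN = n &
  forall p, p < i -> arr g' bRow p = p * n].
have z1 : var g1 vZ = M + M + n by [].
suff : I (var g1 vZ) (run (Repeat xp vZ (Then (Put bRow (Var xp) (Var xg))
                        (Let xg (Plus (Var xg) (Var vN))))) g1).
  by case=> _ _; rewrite z1.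
apply: run_repeat => [|i g' ik [i1 i2 i3]]; first by split.
split=> //=; first by rewrite i1 i2 mulSnr.
move=> p; rewrite ltnS leq_eqVlt; case: eqVneq => [->|_ /i3//].
by rewrite i1.
Qed.

Lemma fill_ownersP g : bounds g ->
  forall p, p < M -> arr (run fill_owners g) bOwn p = p %/ R.
Proof.
case=> _ gk gr _ _; rewrite run_then; set g1 := run _ g.
pose J c g' := [/\ var g' xc = c, var g' vR = R &
  forall p, p < c -> arr g' bOwn p = p %/ R].
have k1 : var g1 vK = k by [].
set body := Repeat xr vR _; rewrite -k1.
suff : J (var g1 vK * R) (run (Repeat xi vK body) g1) by case.
pose I i := J (i * R); rewrite -/(I _).
apply: run_repeat => [|i g2 ik [i1 i2 i3]]; first by split.
pose I' r g' := J (i * R + r) g' /\ var g' xi = i.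
rewrite /I mulSnr -[X in _ + X]i2.
suff [] : I' (var (set_var g2 xi i) vR) (run body (set_var g2 xi i)) by [].
apply: run_repeat => [|r g3 rR [[j1 j2 j3] j4]]; first by split; rewrite // addn0; split.
rewrite /= i2 in rR.
split=> //; rewrite addnS; split=> //=; first by rewrite j1 addn1.
move=> p; rewrite ltnS leq_eqVlt j1; case: eqVneq => [->|_ /j3//].
by rewrite j4 divnMDl // divn_small // addn0.
Qed.

Lemma fill_terminalsP g : bounds g -> given g -> k + k + 2 <= B ->
  forall i, i < k -> arr (run fill_terminals g) bSrc i = S i /\
    arr (run fill_terminals g) bTgt i = T i.
Proof.
move=> [_ gk _ _ _] [gs gt _] kB.
pose I m g' := inp g' = inp g /\ forall i, i < m ->
  arr g' bSrc i = S i /\ arr g' bTgt i = T i.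
suff [_] : I (var g vK) (run fill_terminals g) by rewrite gk.
apply: run_repeat => [|m g' mk [i0 i1]]; first by split.
rewrite gk in mk; split=> //= i; rewrite ltnS leq_eqVlt => im.
rewrite i0; have -> : (2 + (m + m) < B) by lia.
have -> : (3 + (m + m) < B) by lia.
rewrite gs // gt //; case: eqVneq im => [->|_ /i1//].
by [].
Qed.

(** Cells of a matrix with [n] columns do not overlap. *)
Lemma cell_inj u v u' v' : v < n -> v' < n ->
  (u * n + v == u' * n + v') = (u == u') && (v == v').
Proof.
move=> vn v'n; apply/eqP/andP => [E|[/eqP-> /eqP->]] //.
have := congr1 (modn^~ n) E; rewrite !modnMDl !modn_small // => vv.
by move: E; rewrite vv => /addIn/eqP; rewrite eqn_pmul2r ?eqxx //; lia.
Qed.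

Lemma bounds_run s g :
  all (fun x => x \notin vars_of s) [:: vN; vK; vR; vM; vD; vZ] ->
  bounds g -> bounds (run s g).
Proof.
move=> /and5P[a1 a2 a3 a4 /and3P[a5 a6 _]] [b1 b2 b3 b4 [b5 b6]].
by split; rewrite ?run_var.
Qed.

Lemma given_run s g : ~~ emits s -> given g -> given (run s g).
Proof. by move=> ne [g1 g2 g3]; split=> *; rewrite run_inp ?g1 ?g2 ?g3. Qed.

Lemma rows_run s g : bRow \notin banks_of s -> rows g -> rows (run s g).
Proof. by move=> nb gr p pz; rewrite run_arr ?gr. Qed.

(** The distance matrix after the layers up to [l]. *)
Definition partial_dist (l u v : nat) : nat := if dn u v <= l then dn u v else n.

Lemma init_distancesP g : bounds g -> rows g -> forall u v, u < n -> v < n ->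
  arr (run init_distances g) bDist (u * n + v) = partial_dist 0 u v.
Proof.
move=> [gn _ _ _ _] gr.
have pE u v : u < n -> v < n -> partial_dist 0 u v = if u == v then 0 else n.
  move=> un vn; rewrite /partial_dist leqn0 dn_eq0 //.
  by case: eqP => // ->; apply/eqP; rewrite dn_eq0.
pose J c g' := [/\ var g' vN = n, rows g' & forall u v, u < n -> v < n ->
  u * n + v < c -> arr g' bDist (u * n + v) = partial_dist 0 u v].
rewrite /init_distances; set body := Repeat xv vN _.
suff : J (var g vN * n) (run (Repeat xu vN body) g).
  by case=> _ _ H u v un vn; apply: H => //; rewrite gn; nia.
pose I i := J (i * n); rewrite -/(I _).
apply: run_repeat => [|u g1 un [i1 i2 i3]]; first by split.
rewrite gn in un; pose I' v g' := J (u * n + v) g' /\ var g' xu = u.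
rewrite /I mulSnr -[X in _ + X]i1.
suff [] : I' (var (set_var g1 xu u) vN) (run body (set_var g1 xu u)) by [].
apply: run_repeat => [|v g2 vn [[j1 j2 j3] j4]]; first by split; rewrite // addn0; split.
rewrite /= i1 in vn; set g3 := set_var g2 xv v.
have -> : run (When (Eq (Var xu) (Var xv)) (PutDist (Var xu) (Var xv) (Cst 0))
    (PutDist (Var xu) (Var xv) (Var vN))) g3 =
    set_arr g3 bDist (u * n + v) (partial_dist 0 u v).
  rewrite (@run_when _ _ _ (u == v)); last by rewrite eval_Eq /= j4.
  by rewrite pE //; case: eqP => _; rewrite /= j4 j2 ?j1 //; lia.
split=> //; split=> //= u' v' u'n v'n; rewrite addnS ltnS leq_eqVlt cell_inj //.
by case: andP => [[/eqP-> /eqP->]|_ /= lt] //; rewrite j3.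
Qed.

(** Inside the loop only the cell of [(u, v)] changes, and neither its old value
    nor the new value [l + 1] is [l]; so the tests for the distance [l] are not
    disturbed. *)
Lemma relaxP g u v l : bounds g -> rows g -> given g ->
  2 + (k + k) + n * n <= B -> u < n -> v < n ->
  var g xu = u -> var g xv = v -> var g xl = l -> l < dn u v ->
  (forall w, w < n -> (arr g bDist (u * n + w) == l) = (dn u w == l)) ->
  let g' := run relax g in
  forall u' v', u' < n -> v' < n -> arr g' bDist (u' * n + v') =
    if [&& u' == u, v' == v & dn u v == l.+1]
    then l.+1 else arr g bDist (u' * n + v').
Proof.
move=> [gn gk _ _ _] gr [_ _ ga] nB un vn gu gv gl ln gd g'.
(* The neighbours of [v] at the distance [l] among the first [m] vertices. *)
pose near m := has (fun w => (dn u w == l) && adj w v) (iota 0 m).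
pose I m g' := [/\ [/\ var g' xu = u, var g' xv = v, var g' xl = l & var g' vK = k],
  rows g', inp g' = inp g & forall u' v', u' < n -> v' < n ->
   arr g' bDist (u' * n + v') =
    if [&& u' == u, v' == v & near m] then l.+1 else arr g bDist (u' * n + v')].
have En : near (var g vN) = (dn u v == l.+1) by rewrite gn /near -dn_next.
suff [_ _ _ H] : I (var g vN) g' by move=> u' v' u'n v'n; rewrite -En; apply: H.
apply: run_repeat => [|w g1 wn [[i1 i2 i3 ik] i4 i5 i6]].
  by split=> // u' v' _ _; rewrite !andbF.
rewrite gn in wn; set g2 := set_var g1 xw w.
have lE : (l.+1 == l) = false by apply/negbTE; rewrite neq_ltn ltnSn orbT.
set c := (dn u w == l) && adj w v.
have cE : eval g2 (And (Eq (Dist (Var xu) (Var xw)) (Var xl)) (Edge (Var xw) (Var xv))) = c.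
  apply: eval_And.
    rewrite eval_Eq /= i1 i3 i4; last by lia.
    rewrite i6 // eqxx -gd //; case: (eqVneq w v) => [->|_] //.
    case: (near v); rewrite /= ?lE gd //; congr (nat_of_bool _).
    by apply/esym/negbTE; rewrite neq_ltn ln orbT.
  rewrite /= i2 ik i4; last by lia.
  by rewrite i5 ga //; case: ifP => //; nia.
have nearS : near w.+1 = near w || c by rewrite /near -addn1 iotaD has_cat /= orbF.
split; rewrite /If (run_when _ _ cE).
- by case: c {cE nearS}.
- by case: c {cE nearS}.
- by case: c {cE nearS}.
move=> u' v' u'n v'n; rewrite nearS; have E := i6 u' v' u'n v'n.
case: c {cE nearS}; last by rewrite orbF -E.
rewrite orbT andbT /= i1 i2 i3 i4 ?cell_inj ?addn1 ?E //; last by lia.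
by case: (u' == u); case: (v' == v).
Qed.

Lemma partial_distS l u v : partial_dist l.+1 u v =
  if (l < dn u v) && (dn u v == l.+1) then l.+1 else partial_dist l u v.
Proof.
rewrite /partial_dist; move: (dn u v) => m; case: (ltngtP m l.+1) => [h|h|->].
- by rewrite andbF -ltnS h.
- by rewrite andbF leqNgt (ltnW h).
by [].
Qed.

Lemma fill_distancesP g : bounds g -> rows g -> given g ->
  2 + (k + k) + n * n <= B -> forall u v, u < n -> v < n ->
  arr (run fill_distances g) bDist (u * n + v) = dn u v.
Proof.
move=> gb gr gg nB; rewrite run_then; set g0 := run _ g.
pose fixed g' := [/\ bounds g', rows g' & given g'].
have fix_run s g' : all (fun x => x \notin vars_of s) [:: vN; vK; vR; vM; vD; vZ] ->
    bRow \notin banks_of s -> ~~ emits s -> fixed g' -> fixed (run s g').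
  by move=> nv nb ne [hb hr hg]; split; [apply: bounds_run|apply: rows_run|apply: given_run].
have fix_var x m g' : x \notin [:: vN; vK; vR; vM; vD; vZ] -> fixed g' -> fixed (set_var g' x m).
  rewrite !inE !negb_or => nx; rewrite -[set_var _ _ _]/(run (Let x (Cst m)) g').
  by apply: fix_run => //=; rewrite !inE ![_ == x]eq_sym andbT.
have f0 : fixed g0 by apply: fix_run.
pose J l c g' := fixed g' /\ forall u v, u < n -> v < n ->
   arr g' bDist (u * n + v) = partial_dist (if u * n + v < c then l.+1 else l) u v.
have [gn _ _ _ _] : bounds g0 by case: f0.
set step := If _ relax; set cols := Repeat xv vN step; set grid := Repeat xu vN cols.
suff [_ H] : J (var g0 vN) 0 (run (Repeat xl vN grid) g0).
  by move=> u v un vn; rewrite H // ltn0 gn /partial_dist (ltnW (dn_lt un vn)).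
pose K l := J l 0; rewrite -/(K _).
apply: run_repeat => [|l g1 ln [i1 i2]].
  by split=> // u v un vn; apply: init_distancesP.
rewrite gn in ln; set g2 := set_var g1 xl l.
have f2 : fixed g2 by apply: fix_var.
suff [h1 [h2 h3]] : var (run grid g2) xl = l /\ J l (n * n) (run grid g2).
  split=> // u v un vn; rewrite h3 //.
  by have -> : u * n + v < n * n by nia.
have [gn2 _ _ _ _] : bounds g2 by case: f2.
pose I1 i g' := var g' xl = l /\ J l (i * n) g'.
suff : I1 (var g2 vN) (run grid g2) by rewrite gn2.
apply: run_repeat => [|u g3 un [j1 [j2 j3]]]; first by split.
rewrite gn2 in un; set g4 := set_var g3 xu u.
have f4 : fixed g4 by apply: fix_var.
have [gn4 _ _ _ _] : bounds g4 by case: f4.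
pose I2 v g' := [/\ var g' xl = l, var g' xu = u & J l (u * n + v) g'].
suff [e1 _ e2] : I2 (var g4 vN) (run cols g4).
  by split=> //; rewrite mulSnr; rewrite gn4 in e2.
apply: run_repeat => [|v g5 vn [k1 k2 [k3 k4]]]; first by split=> //; rewrite addn0.
rewrite gn4 in vn; set g6 := set_var g5 xv v.
have f6 : fixed g6 by apply: fix_var.
have [b6 r6 v6] := f6.
have cell u' v' : u' < n -> v' < n -> arr g6 bDist (u' * n + v') =
    partial_dist (if u' * n + v' < u * n + v then l.+1 else l) u' v' by exact: k4.
have pdE m u' v' : u' < n -> v' < n -> m < n ->
    (partial_dist m u' v' == n) = (m < dn u' v').
  move=> u'n v'n mn; rewrite /partial_dist; case: leqP => h; last by rewrite eqxx.
  by apply/negbTE; rewrite neq_ltn dn_lt.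
have cE : eval g6 (Eq (Dist (Var xu) (Var xv)) (Var vN)) = (l < dn u v).
  rewrite eval_Eq; congr (nat_of_bool _).
  have -> : eval g6 (Dist (Var xu) (Var xv)) = arr g6 bDist (u * n + v).
    by rewrite /= k2 r6 //; lia.
  have -> : eval g6 (Var vN) = n by case: b6.
  by rewrite cell // ltnn pdE.
have stepE u' v' : u' < n -> v' < n -> arr (run step g6) bDist (u' * n + v') =
    if [&& u' == u, v' == v & l < dn u v] && (dn u v == l.+1)
    then l.+1 else arr g6 bDist (u' * n + v').
  move=> u'n v'n; rewrite /step (run_if_arr _ _ _ cE).
  case: (ltnP l (dn u v)) => ldn; last by rewrite !andbF.
  rewrite andbT -andbA (@relaxP g6 u v l) // => w wn; rewrite cell // /partial_dist.
  have nl : (n == l) = false by apply/negbTE; rewrite neq_ltn ln orbT.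
  have nl1 : l.+1 == l = false by apply/negbTE; rewrite neq_ltn ltnSn orbT.
  case: (_ < _ + v); case: leqP => h; rewrite // nl; apply/esym/negbTE;
    by apply: contraTneq h => ->; rewrite -leqNgt ?leqnSn.
split.
- by rewrite run_var.
- by rewrite run_var.
split; first exact: fix_run.
move=> u' v' u'n v'n; rewrite stepE // cell // addnS ltnS.
rewrite [u' * n + v' <= _]leq_eqVlt cell_inj //.
case: (eqVneq u' u) => [->|_] /=; last by [].
case: (eqVneq v' v) => [->|_] /=; last by [].
by rewrite ltnn partial_distS.
Qed.

Lemma fill_powersP g : bounds g -> rows g ->
  (forall q v, q < M + M -> v < n ->
     arr (run fill_powers g) bPow (q * n + v) = v * n ^ q) /\
  var (run fill_powers g) vC = n ^ (M + M).
Proof.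
move=> [gn _ _ _ [gd _]] gr; rewrite run_then; set g0 := run _ g.
pose I q g' := [/\ [/\ var g' vN = n, rows g' & var g' vC = n ^ q] &
  forall q' v, q' < q -> v < n -> arr g' bPow (q' * n + v) = v * n ^ q'].
have d0 : var g0 vD = M + M by [].
set body := Block _ _.
suff [[_ _ e1] e2] : I (var g0 vD) (run (Repeat xp vD body) g0).
  by rewrite d0 in e1 e2.
apply: run_repeat => [|q g1 qd [[i1 i2 i3] i4]]; first by split.
rewrite d0 in qd; rewrite /body /Block [foldl _ _ _]/= !run_then.
set g2 := run (Let xg _) _; set loop := Repeat xv vN _.
pose I2 m g' := [/\ [/\ var g' vN = n, rows g' & var g' vC = n ^ q],
  var g' xp = q, var g' xg = m * n ^ q &
  forall q' v, v < n -> (q' < q) || (q' == q) && (v < m) ->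
    arr g' bPow (q' * n + v) = v * n ^ q'].
have n2 : var g2 vN = n by [].
have [[j1 j2 j3] j4 j5 j6] : I2 (var g2 vN) (run loop g2).
  apply: run_repeat => [|m g3 mn [[k1 k2 k3] k4 k5 k6]].
    by split=> // q' v vn; rewrite ltn0 andbF orbF => qq; apply: i4.
  rewrite n2 in mn; split=> //=; first by rewrite k5 k3 mulSnr.
  move=> q' v vn; rewrite k4 k2; last by lia.
  rewrite cell_inj //; case: (eqVneq q' q) => [->|_] /= qv.
    2: by apply: k6 => //; rewrite orbF in qv; rewrite qv.
  case: eqVneq => [->|nv]; first by rewrite k5.
  apply: k6 => //; rewrite eqxx [v < m]ltn_neqAle nv -ltnS.
  by move: qv; rewrite !ltnn !ltnS.
split=> //=; first by split=> //; rewrite j5 n2 expnS.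
move=> q' v; rewrite ltnS leq_eqVlt n2 in j6 * => qq vn; apply: j6 => //.
by rewrite vn andbT orbC.
Qed.

(** What the tables provide to every later stage; none of them is overwritten
    afterwards. *)
Record env (g : store) : Prop := Env {
  env_bounds : bounds g;
  env_rounds : var g vT = n * M;
  env_codes : var g vC = n ^ (M + M);
  env_rows : rows g;
  env_own : forall p, p < M -> arr g bOwn p = p %/ R;
  env_terminals : forall i, i < k -> arr g bSrc i = S i /\ arr g bTgt i = T i;
  env_dist : forall u v, u < n -> v < n -> arr g bDist (u * n + v) = dn u v;
  env_pow : forall q v, q < M + M -> v < n ->
    arr g bPow (q * n + v) = v * n ^ q }.

Definition keeps_env (s : stmt) : bool :=
  all (fun x => x \notin vars_of s) [:: vN; vK; vR; vM; vD; vZ; vT; vC] &&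
  all (fun b => b \notin banks_of s) [:: bRow; bOwn; bSrc; bTgt; bDist; bPow].

Lemma env_run s g : keeps_env s -> env g -> env (run s g).
Proof.
case/andP=> /= /and5P[v1 v2 v3 v4 /and5P[v5 v6 v7 v8 _]].
move=> /and5P[b1 b2 b3 b4 /and3P[b5 b6 _]] [e1 e2 e3 e4 e5 e6 e7 e8]; split.
- by apply: bounds_run => //; rewrite /= v1 v2 v3 v4 v5 v6.
- by rewrite run_var.
- by rewrite run_var.
- exact: rows_run.
- by move=> p pM; rewrite run_arr ?e5.
- by move=> i ik; rewrite !run_arr //; apply: e6.
- by move=> u v un vn; rewrite run_arr ?e7.
- by move=> q v qM vn; rewrite run_arr ?e8.
Qed.

Lemma env_set_var x m g : 8 < x -> env g -> env (set_var g x m).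
Proof.
move=> x8 eg; rewrite -[set_var _ _ _]/(run (Let x (Cst m)) g).
apply: env_run => //; rewrite /keeps_env /= !inE.
by do 8 (case: eqP => [E|_]; first by rewrite -E in x8).
Qed.

Lemma tablesP g : bounds g -> given g -> 2 + (k + k) + n * n <= B ->
  var g vT = n * M -> env (run tables g).
Proof.
move=> gb gg nB gT; rewrite /tables /Block [foldl _ _ _]/= !run_then.
set g1 := run fill_rows g; set g2 := run fill_owners g1.
set g3 := run fill_terminals g2; set g4 := run fill_distances g3.
have b1 : bounds g1 by apply: bounds_run.
have b2 : bounds g2 by apply: bounds_run.
have b3 : bounds g3 by apply: bounds_run.
have b4 : bounds g4 by apply: bounds_run.
have r1 : rows g1 by apply: fill_rowsP.
have r2 : rows g2 by apply: rows_run.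
have r3 : rows g3 by apply: rows_run.
have r4 : rows g4 by apply: rows_run.
have n1 : given g1 by apply: given_run.
have n2 : given g2 by apply: given_run.
have n3 : given g3 by apply: given_run.
have [p4 c4] := fill_powersP b4 r4.
split=> //.
- exact: bounds_run.
- by rewrite !run_var.
- exact: rows_run.
- by move=> p pM; rewrite (@run_arr B fill_powers g4) // (@run_arr B fill_distances g3) //;
    rewrite (@run_arr B fill_terminals g2) //; exact: fill_ownersP b1 _ pM.
- have kB : k + k + 2 <= B by apply: leq_trans nB; rewrite addnC leq_addr.
  by move=> i ik; rewrite !(@run_arr B fill_powers g4) // !(@run_arr B fill_distances g3) //;
    exact: fill_terminalsP b2 n2 kB _ ik.
- by move=> u v un vn; rewrite run_arr //; apply: fill_distancesP.
Qed.

(** Every loop bound depends on [n] and [k] alone, and so does the running time;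
    terminals and edges do not enter here. *)
Lemma tables_codes g : bounds g -> var (run tables g) vC = n ^ (M + M).
Proof.
move=> gb; rewrite /tables /Block [foldl _ _ _]/= !run_then.
pose g4 := run fill_distances (run fill_terminals (run fill_owners (run fill_rows g))).
have b4 : bounds g4 by do 4 apply: bounds_run => //.
have r4 : rows g4 by do 3 apply: rows_run => //; exact: fill_rowsP.
by case: (fill_powersP b4 r4).
Qed.

End Tables.

End Stages.

(** * The search loop *)
Section SearchLoop.

Variable B : nat.
Local Notation run := (run B).
Local Notation eval := (eval B).

Variables n k R : nat.
Hypotheses (n0 : 0 < n) (R0 : 0 < R).
Local Notation M := (k * R).

Variables (S T : nat -> nat) (dn : nat -> nat -> nat).
Hypothesis S_lt : forall i, i < k -> S i < n.
Hypothesis T_lt : forall i, i < k -> T i < n.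
Hypothesis dn_lt : forall u v, u < n -> v < n -> dn u v < n.

Local Notation env := (env n k R S T dn).
Local Notation digit := (digit n).
Local Notation N := (n ^ (M + M)).

Definition pstart (c p : nat) : nat := digit c p.
Definition pnow (c p : nat) : nat := digit c (M + p).

Lemma pstart_lt c p : pstart c p < n. Proof. exact: digit_lt. Qed.
Lemma pnow_lt c p : pnow c p < n. Proof. exact: digit_lt. Qed.

Definition par (g : store) (c : nat) : nat := arr g bPar c.

Definition decoded (c : nat) (g : store) : Prop :=
  [/\ env g, var g xc = c & forall q, q < M + M -> arr g bDig q = digit c q].

Lemma eval_Pow g q v qn vn : env g -> eval g q = qn -> eval g v = vn ->
  qn < M + M -> vn < n -> eval g (Pow q v) = vn * n ^ qn.
Proof.
move=> [_ _ _ er _ _ _ ep] eq ev qM vM; rewrite /= eq ev er ?ep //.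
exact: leq_trans qM (leq_addr _ _).
Qed.

Lemma eval_Dist g u v un vn : env g -> eval g u = un -> eval g v = vn ->
  un < n -> vn < n -> eval g (Dist u v) = dn un vn.
Proof.
move=> [_ _ _ er _ _ ed _] eu ev uM vM; rewrite /= eu ev er ?ed //.
exact: leq_trans uM (leq_addl _ _).
Qed.

Lemma decode_digitP g q rem : env g -> var g xq = q -> var g xrem = rem ->
  q < M + M -> rem < n ^ q.+1 ->
  let g' := run decode_digit g in arr g' bDig q = rem %/ n ^ q /\
    forall q', q' != q -> arr g' bDig q' = arr g bDig q'.
Proof.
move=> eg gq gr qM rn g'.
pose I m g' := [/\ env g', var g' xq = q, var g' xrem = rem,
  forall q', q' != q -> arr g' bDig q' = arr g bDig q' &
  0 < m -> arr g' bDig q = minn (rem %/ n ^ q) m.-1].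
have gn : var g vN = n by case: eg => -[].
have nq : 0 < n ^ q by rewrite expn_gt0 n0.
suff [_ _ _ h1 h2] : I n g'.
  split=> //; rewrite h2 //; apply/minn_idPl.
  by rewrite -ltnS prednK // ltn_divLR // -expnS.
rewrite -gn; apply: run_repeat => [|m g1 mn [i1 i2 i3 i4 i5]]; first by split.
rewrite gn in mn; set g2 := set_var g1 xv m.
have e2 : env g2 by apply: env_set_var.
have cE : eval g2 (Leq (Pow (Var xq) (Var xv)) (Var xrem)) = (m <= rem %/ n ^ q).
  by rewrite eval_Leq (@eval_Pow _ _ _ q m) //= i3 leq_divRL.
split.
- exact: env_run.
- by rewrite run_var.
- by rewrite run_var.
- move=> q' nqq; rewrite (run_if_arr _ _ _ cE) /= i2 (negPf nqq) /=.
  by rewrite if_same i4.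
move=> _; rewrite (run_if_arr _ _ _ cE) /= i2 eqxx.
case: leqP => h //; have m0 : 0 < m by case: (m) h.
by rewrite i5 //; apply/minn_idPl; rewrite -ltnS prednK.
Qed.

Lemma decodeP g c : env g -> var g xc = c -> c < N -> decoded c (run decode g).
Proof.
move=> eg gc cN; split; [exact: env_run|by rewrite run_var|].
rewrite /decode /Block [foldl _ _ _]/= !run_then; set g1 := run _ g.
set g2 := run _ g1; set body := Then _ _.
have e2 : env g2 by do 2 apply: env_run => //.
have gd : var g2 vD = M + M by case: (env_bounds e2) => _ _ _ _ [].
pose I j g' := [/\ env g', var g' xq = M + M - j,
  var g' xrem = c %% n ^ (M + M - j) &
  forall q, M + M - j <= q < M + M -> arr g' bDig q = digit c q].
suff [_ _ _ H] : I (var g2 vD) (run (Repeat xj vD body) g2).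
  by move=> q qM; apply: H; rewrite gd subnn.
apply: run_repeat => [|j g3 jM [i1 i2 i3 i4]].
  split=> //; rewrite ?subn0 /=; first by case: (env_bounds eg) => _ _ _ _ [].
    by rewrite gc modn_small.
  by move=> q; rewrite ltnNge; case: leqP.
rewrite gd in jM; set g4 := set_var g3 xj j; set q := M + M - j.+1.
have qE : M + M - j = q.+1 by rewrite subnSK.
have qM : q < M + M by rewrite ltn_subrL (leq_ltn_trans _ jM).
rewrite /body !run_then; set g5 := run (Let xq _) g4; set g6 := run decode_digit g5.
have e4 : env g4 by apply: env_set_var.
have e5 : env g5 by apply: env_run.
have e6 : env g6 by apply: env_run.
have q5 : var g5 xq = q by rewrite /= i2 qE subn1.
have r5 : var g5 xrem = c %% n ^ q.+1 by rewrite /= i3 qE.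
have [|d6 f6] := decode_digitP e5 q5 r5 qM; first by rewrite ltn_mod expn_gt0 n0.
have d6' : arr g6 bDig q = digit c q by rewrite d6 digit_top.
have q6 : var g6 xq = q by rewrite run_var.
split.
- exact: env_run.
- by rewrite run_var.
- have -> : var (run (Let xrem (Minus (Var xrem) (Pow (Var xq) (Dig (Var xq))))) g6) xrem =
    var g6 xrem - eval g6 (Pow (Var xq) (Dig (Var xq))) by [].
  rewrite (@eval_Pow _ _ _ q (digit c q)) ?digit_lt //; last by rewrite /= q6.
  by rewrite run_var // r5 modn_digit // addKn.
move=> q'; rewrite run_arr // -/q => /andP[qq q'M].
have [->//|nqq] := eqVneq q' q.
rewrite f6 // -i4 ?q'M ?andbT // qE ltn_neqAle eq_sym nqq //.
Qed.

(** ** Conjunctions computed by loops *)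

(** The second store may differ from the first in the variables [vs] only. *)
Definition like (vs : seq nat) (g g' : store) : Prop :=
  (forall y, y \notin vs -> var g' y = var g y) /\ arr g' =2 arr g.

Lemma like_run vs s g g' : all (mem vs) (vars_of s) -> banks_of s = [::] ->
  like vs g g' -> like vs g (run s g').
Proof.
move=> /allP sub nb [h1 h2]; split=> [y yv|b i]; last by rewrite run_arr ?nb ?h2.
by rewrite run_var ?h1 //; apply: contra yv => /sub.
Qed.

Lemma like_set vs x m g g' : x \in vs -> like vs g g' -> like vs g (set_var g' x m).
Proof.
move=> xv [h1 h2]; split=> // y yv /=; case: eqVneq => [E|_]; last exact: h1.
by rewrite E xv in yv.
Qed.

(** A loop that conjoins tests into [xok] computes the conjunction; the invariant
    only has to say that the variables outside [vs] are as at the beginning. *)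
Lemma run_all vs x b s g (b0 : bool) (P : nat -> bool) :
  x \in vs -> b \notin vs -> all (mem vs) (vars_of s) -> banks_of s = [::] ->
  x != xok -> var g xok = b0 ->
  (forall i g' (c : bool), i < var g b -> like vs g g' -> var g' x = i ->
     var g' xok = c -> var (run s g') xok = c && P i) ->
  var (run (Repeat x b s) g) xok = b0 && all P (iota 0 (var g b)).
Proof.
move=> xv bv sv sb xo g0 H.
pose I m g' := like vs g g' /\ var g' xok = b0 && all P (iota 0 m).
suff [] : I (var g b) (run (Repeat x b s) g) by [].
apply: run_repeat => [|m g' mb [i1 i2]]; first by rewrite /I andbT.
have l1 : like vs g (set_var g' x m) by apply: like_set.
split; first exact: like_run.
rewrite -(addn1 m) iotaD all_cat /= andbT andbA; apply: H => //=; first by rewrite eqxx.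
by rewrite eq_sym (negPf xo).
Qed.

Lemma run_check e g (c p : bool) : var g xok = c -> eval g e = p ->
  var (run (Check e) g) xok = c && p.
Proof. by move=> gc ep; exact: (@eval_And B g (Var xok) e c p gc ep). Qed.

Definition shown (c : nat) (g : store) : Prop :=
  env g /\ forall q, q < M + M -> arr g bDig q = digit c q.

Lemma env_like vs g g' : all (fun x => 8 < x) vs -> like vs g g' -> env g -> env g'.
Proof.
move=> /allP big [h1 h2] [[b1 b2 b3 b4 [b5 b6]] e2 e3 e4 e5 e6 e7 e8].
have nv x : x <= 8 -> var g' x = var g x.
  by move=> x8; apply: h1; apply/negP => /big; rewrite ltnNge x8.
split; rewrite ?nv //.
- by split; rewrite ?nv.
- by move=> p pZ; rewrite h2 e4.
- by move=> p pM; rewrite h2 e5.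
- by move=> i ik; rewrite !h2; apply: e6.
- by move=> u v un vn; rewrite h2 e7.
- by move=> q v qM vn; rewrite h2 e8.
Qed.

Lemma shown_like vs c g g' : all (fun x => 8 < x) vs -> like vs g g' ->
  shown c g -> shown c g'.
Proof.
move=> big l [eg dg]; split; first exact: env_like l eg.
by case: l => _ h q qM; rewrite h dg.
Qed.

Lemma shown_set c x m g : 8 < x -> shown c g -> shown c (set_var g x m).
Proof. by move=> x8 [eg dg]; split=> //; apply: env_set_var. Qed.

Lemma eval_start c g p pv : shown c g -> eval g p = pv -> pv < M ->
  eval g (Dig p) = pstart c pv.
Proof.
move=> [_ dg] ep pM; rewrite [LHS]/= ep dg //.
exact: leq_trans pM (leq_addr _ _).
Qed.

Lemma eval_now c g p pv : shown c g -> eval g p = pv -> pv < M ->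
  eval g (PieceY p) = pnow c pv.
Proof.
move=> [eg dg] ep pM; rewrite [LHS]/= ep; case: (env_bounds eg) => _ _ _ -> _.
by rewrite dg // ltn_add2l.
Qed.

Lemma eval_own c g p pv : shown c g -> eval g p = pv -> pv < M ->
  eval g (Own p) = pv %/ R.
Proof. by move=> [eg _] ep pM; rewrite [LHS]/= ep (env_own eg). Qed.

Definition start_ok (c : nat) : bool :=
  all (fun p => (pstart c p == pnow c p) &&
    all (fun q => (p %/ R == q %/ R) || (pstart c p != pstart c q)) (iota 0 M))
  (iota 0 M).

Lemma shown_M c g : shown c g -> var g vM = M.
Proof. by case=> eg _; case: (env_bounds eg). Qed.

Lemma try_startP c g : decoded c g ->
  forall d, par (run try_start g) d =
    if (d == c) && start_ok c then c.+1 else par g d.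
Proof.
move=> [eg gc dg] d; rewrite /try_start /Block [foldl _ _ _]/= !run_then.
set g1 := run (Let xok _) g; set loop := Repeat xp vM _; set g2 := run loop g1.
pose vs := [:: xok; xp; xq].
have l2 : like vs g g2 by apply: like_run => //; apply: like_set.
have big : all (fun x => 8 < x) vs by [].
have ok2 : var g2 xok = start_ok c.
  have s1 : shown c g1 by apply: shown_set.
  rewrite /g2 (@run_all vs _ _ _ _ true (fun p => (pstart c p == pnow c p) &&
    all (fun q => (p %/ R == q %/ R) || (pstart c p != pstart c q)) (iota 0 M))) //.
    by rewrite (shown_M s1).
  rewrite (shown_M s1) => p g3 b pM l3 g3p g3o; rewrite run_then.
  rewrite -[var g3 xp]/(eval g3 (Var xp)) in g3p.
  have s3 : shown c g3 by apply: shown_like l3 s1.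
  rewrite andbA; set g4 := run (Check _) g3.
  have l4 : like vs g3 g4 by apply: like_run.
  have s4 : shown c g4 by apply: shown_like l4 s3.
  rewrite (@run_all [:: xok; xq] _ _ _ _ (b && (pstart c p == pnow c p))
     (fun q => (p %/ R == q %/ R) || (pstart c p != pstart c q))) //.
  - by rewrite (shown_M s4).
  - apply: run_check => //; rewrite eval_Eq.
    by rewrite (eval_start s3 g3p pM) (eval_now s3 g3p pM).
  rewrite (shown_M s4) => q g5 b' qM l5 g5q g5o.
  rewrite -[var g5 xq]/(eval g5 (Var xq)) in g5q.
  have s5 : shown c g5 by apply: shown_like l5 s4.
  have g5p : eval g5 (Var xp) = p by case: l5 => h _; exact: etrans (h xp isT) g3p.
  apply: run_check => //; apply: eval_Or.
    by rewrite eval_Eq (eval_own s5 g5p pM) (eval_own s5 g5q qM).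
  apply: eval_Not.
  by rewrite eval_Eq (eval_start s5 g5p pM) (eval_start s5 g5q qM).
rewrite /par (@run_if_arr _ _ _ (start_ok c)) //.
have g2c : var g2 xc = c by case: l2 => -> //; rewrite gc.
case: l2 => _ a2; case: start_ok {ok2}; last by rewrite andbF a2.
by rewrite andbT /= g2c addn1 a2.
Qed.

(** ** Moves *)

(** The code [c] with the pebble [p] put back on [u]. *)
Definition before (c p u : nat) : nat :=
  (c + u * n ^ (M + p)) - pnow c p * n ^ (M + p).

Definition legal (c p u : nat) : bool :=
  [&& dn (pstart c p) (pnow c p) == (dn (pstart c p) u).+1,
      dn u (pnow c p) == 1 &
      all (fun q => (p %/ R == q %/ R) ||
         (dn (pstart c q) (pnow c p) + dn (pnow c p) (pnow c q)
            != dn (pstart c q) (pnow c q))) (iota 0 M)].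

Lemma try_moveP c g p u : decoded c g -> var g xp = p -> var g xu = u ->
  p < M -> u < n ->
  forall d, par (run try_move g) d =
    if [&& d == c, 0 < par g (before c p u) & legal c p u]
    then (before c p u).+1 else par g d.
Proof.
move=> [eg gc dg] gp gu pM un d.
rewrite /try_move /Block [foldl _ _ _]/= !run_then.
set g1 := run (Let xd _) g; set g2 := run (Let xok _) g1.
set loop := Repeat xq vM _; set g3 := run loop g2.
pose vs := [:: xok; xd; xq].
rewrite -[var g xp]/(eval g (Var xp)) in gp.
rewrite -[var g xu]/(eval g (Var xu)) in gu.
have s0 : shown c g by [].
have l1 : like vs g g1 by apply: like_run.
have l2 : like vs g g2 by apply: like_run.
have l3 : like vs g g3 by apply: like_run.
have s1 : shown c g1 by apply: shown_like l1 s0.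
have s2 : shown c g2 by apply: shown_like l2 s0.
have MpM : M + p < M + M by rewrite ltn_add2l.
have eMp : eval g (Plus (Var vM) (Var xp)) = M + p by rewrite /= (shown_M s0) -gp.
have d1 : var g1 xd = before c p u.
  have -> : var g1 xd = eval g (Plus (Var xc) (Pow (Plus (Var vM) (Var xp)) (Var xu)))
     - eval g (Pow (Plus (Var vM) (Var xp)) (PieceY (Var xp))) by [].
  have -> : eval g (Plus (Var xc) (Pow (Plus (Var vM) (Var xp)) (Var xu))) =
     c + eval g (Pow (Plus (Var vM) (Var xp)) (Var xu)) by rewrite -gc.
  rewrite (eval_Pow eg eMp gu) // (eval_Pow eg eMp (eval_now s0 gp pM)) //.
  exact: pnow_lt.
have p1 : eval g1 (Var xp) = p by [].
have u1 : eval g1 (Var xu) = u by [].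
pose b0 := 0 < par g (before c p u).
pose b1 := dn (pstart c p) (pnow c p) == (dn (pstart c p) u).+1.
pose b2 := dn u (pnow c p) == 1.
have e1 : env g1 by case: s1.
have ok2 : var g2 xok = [&& b0, b1 & b2].
  have st1 := eval_start s1 p1 pM; have nw1 := eval_now s1 p1 pM.
  apply: eval_And; first by rewrite -[LHS]/(nat_of_bool (0 < par g1 (var g1 xd))) d1.
  apply: eval_And; rewrite eval_Eq.
    rewrite -[eval g1 (Plus _ _)]/(eval g1 (Dist (Dig (Var xp)) (Var xu)) + 1).
    rewrite (eval_Dist e1 st1 u1) ?pstart_lt // addn1.
    by rewrite (eval_Dist e1 st1 nw1) ?pstart_lt ?pnow_lt // eq_sym.
  by rewrite (eval_Dist e1 u1 nw1) ?pnow_lt.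
have ok3 : var g3 xok = b0 && legal c p u.
  rewrite /g3 (@run_all [:: xok; xq] _ _ _ _ [&& b0, b1 & b2] (fun q => (p %/ R == q %/ R) ||
         (dn (pstart c q) (pnow c p) + dn (pnow c p) (pnow c q)
            != dn (pstart c q) (pnow c q)))) //.
    by rewrite (shown_M s2) /legal -/b1 -/b2 !andbA.
  rewrite (shown_M s2) => q g4 b qM l4 g4q g4o.
  rewrite -[var g4 xq]/(eval g4 (Var xq)) in g4q.
  have s4 : shown c g4 by apply: shown_like l4 s2.
  have e4 : env g4 by case: s4.
  have g4p : eval g4 (Var xp) = p by case: l4 => h _; exact: etrans (h xp isT) p1.
  have stq := eval_start s4 g4q qM; have nwq := eval_now s4 g4q qM.
  have nwp := eval_now s4 g4p pM.
  apply: run_check => //; apply: eval_Or.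
    by rewrite eval_Eq (eval_own s4 g4p pM) (eval_own s4 g4q qM).
  apply: eval_Not; rewrite eval_Eq.
  rewrite -[eval g4 (Plus _ _)]/(eval g4 (Dist (Dig (Var xq)) (PieceY (Var xp))) +
    eval g4 (Dist (PieceY (Var xp)) (PieceY (Var xq)))).
  rewrite (eval_Dist e4 stq nwp) ?pstart_lt ?pnow_lt //.
  by rewrite (eval_Dist e4 nwp nwq) ?(eval_Dist e4 stq nwq) ?pstart_lt ?pnow_lt.
rewrite /par (@run_if_arr _ _ _ (b0 && legal c p u)) // -/b0.
have g3c : var g3 xc = c by rewrite -gc; case: l3 => ->.
have g3d : var g3 xd = before c p u by rewrite run_var.
case: l3 => _ a3; case: (b0 && legal c p u) {ok3}; last by rewrite andbF a3.
by rewrite andbT /= g3c g3d addn1 a3.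
Qed.

(** Each reached code is initial or one legal move away from its parent, which is
    reached too.  Since [progress] drops along parents, they lead to an initial
    code. *)
Definition sound (g : store) : Prop := forall c, c < N -> 0 < par g c ->
  let d := (par g c).-1 in
  (d = c /\ start_ok c) \/
  (0 < par g d /\ exists p u, [/\ p < M, u < n, d = before c p u & legal c p u]).

Definition grows (g g' : store) : Prop := forall d, 0 < par g d -> 0 < par g' d.

(** When several moves lead to [c], the last one found provides its parent, and
    any of them would do. *)
Lemma try_movesP c g : decoded c g -> sound g ->
  let g' := run try_moves g in [/\ sound g', grows g g' &
    forall p u, p < M -> u < n -> legal c p u -> 0 < par g (before c p u) ->
      0 < par g' c].
Proof.
move=> dg sg g'.
pose J m g1 := [/\ decoded c g1, sound g1, grows g g1 &
  forall p u, p < M -> u < n -> p * n + u < m -> legal c p u ->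
    0 < par g (before c p u) -> 0 < par g1 c].
have gM : var g vM = M by case: dg => eg _ _; case: (env_bounds eg).
have dset x m g1 : 8 < x -> x != xc -> decoded c g1 -> decoded c (set_var g1 x m).
  move=> x8 nx [e1 c1 d1]; split=> //; first exact: env_set_var.
  by rewrite /= eq_sym (negPf nx).
suff [_ h1 h2 h3] : J (var g vM * n) g'.
  split=> // p u pM un; apply: h3 => //; rewrite gM.
  apply: leq_trans (_ : p.+1 * n <= _); first by rewrite mulSnr ltn_add2l.
  exact: leq_mul.
pose I i := J (i * n); rewrite -/(I _); apply: run_repeat => [|p g1 pM [i1 i2 i3 i4]].
  by split.
rewrite gM in pM; set g2 := set_var g1 xp p.
have d2 : decoded c g2 by apply: dset.
have n2 : var g2 vN = n by case: d2 => e2 _ _; case: (env_bounds e2).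
pose I' m g3 := J (p * n + m) g3 /\ var g3 xp = p.
rewrite /I mulSnr -[X in _ + X]n2.
suff [] : I' (var g2 vN) (run (Repeat xu vN try_move) g2) by [].
apply: run_repeat => [|u g3 un [[j1 j2 j3 j4] j5]]; first by rewrite /I' addn0.
rewrite n2 in un; set g4 := set_var g3 xu u.
have d4 : decoded c g4 by apply: dset.
have H := try_moveP d4 j5 (erefl : var g4 xu = u) pM un.
set g5 := run try_move g4 in H.
have gr : grows g3 g5 by move=> d d0; rewrite H; case: ifP.
split; last by rewrite run_var.
rewrite addnS; split.
- case: d4 => e4 c4 dd4; split; [exact: env_run|by rewrite run_var|].
  by move=> q qM; rewrite run_arr ?dd4.
- move=> d dN; rewrite H; case: ifP => [/and3P[/eqP-> b0 lg] _|_ d0].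
    by right; split; [apply: gr|exists p, u].
  have [[-> so]|[p0 ex]] := j2 d dN d0; first by left.
  by right; split=> //; apply: gr.
- by move=> d d0; apply/gr/j3.
move=> p' u' p'M u'n; rewrite ltnS leq_eqVlt (cell_inj R0) // => /orP[E|lt] lg b0; last first.
  by apply/gr/(j4 _ _ p'M u'n).
case/andP: E => /eqP Ep /eqP Eu; rewrite Ep Eu in lg b0.
by rewrite H eqxx lg (_ : 0 < par g4 _); last exact: j3.
Qed.

(** ** Acceptance *)

Definition low_end (c i p : nat) : nat :=
  if dn (S i) (pstart c p) < dn (S i) (pnow c p) then pstart c p else pnow c p.
Definition high_end (c i p : nat) : nat :=
  if dn (S i) (pstart c p) < dn (S i) (pnow c p) then pnow c p else pstart c p.
Definition frontier (c i r : nat) : nat :=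
  if r is r'.+1 then high_end c i (i * R + r') else S i.

Definition link (c i r : nat) : bool :=
  let l := low_end c i (i * R + r) in let h := high_end c i (i * R + r) in
  [&& dn (S i) l + dn l h == dn (S i) h,
      dn (S i) (frontier c i r) + dn (frontier c i r) l == dn (S i) l &
      dn (frontier c i r) l <= (0 < r)].

Definition path_ok (c i : nat) : bool :=
  all (link c i) (iota 0 R) && (frontier c i R == T i).

Definition accept_ok (c : nat) : bool := all (path_ok c) (iota 0 k).

Lemma low_end_lt c i p : low_end c i p < n.
Proof. by rewrite /low_end; case: ifP => _; rewrite ?pstart_lt ?pnow_lt. Qed.
Lemma high_end_lt c i p : high_end c i p < n.
Proof. by rewrite /high_end; case: ifP => _; rewrite ?pstart_lt ?pnow_lt. Qed.
Lemma frontier_lt c i r : i < k -> frontier c i r < n.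
Proof. by case: r => [|r] /= ik; [exact: S_lt|exact: high_end_lt]. Qed.

Lemma check_linkP c g i r (b : bool) : shown c g -> i < k -> r < R ->
  var g xs = S i -> var g xp = i * R + r -> var g xprev = frontier c i r ->
  var g xslack = (0 < r) -> var g xok = b ->
  let g' := run check_link g in
  [/\ var g' xok = b && link c i r, var g' xprev = frontier c i r.+1,
      var g' xslack = 1 & var g' xp = i * R + r.+1].
Proof.
move=> s0 ik rR gs gp gv gl go; set p := i * R + r in gp.
have pM : p < M by rewrite /p; nia.
rewrite -[var g xs]/(eval g (Var xs)) in gs.
rewrite -[var g xp]/(eval g (Var xp)) in gp.
have [e0 _] := s0; have Sn := S_lt ik.
have st := eval_start s0 gp pM; have nw := eval_now s0 gp pM.
rewrite /check_link /Block [foldl _ _ _]/= !run_then.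
set g1 := run orient g.
pose l := low_end c i p; pose h := high_end c i p.
have l1 : like [:: xlo; xhi] g g1 by apply: like_run.
have s1 : shown c g1 by apply: shown_like l1 s0.
have [e1 _] := s1.
have [lo1 hi1] : eval g1 (Var xlo) = l /\ eval g1 (Var xhi) = h.
  rewrite /g1 /orient /l /h /low_end /high_end.
  rewrite (@run_when B _ _ _ (dn (S i) (pstart c p) < dn (S i) (pnow c p))).
    by case: ltnP => _; split=> //.
  rewrite -[LHS]/(nat_of_bool (eval g (Dist (Var xs) (Dig (Var xp))) <
     eval g (Dist (Var xs) (PieceY (Var xp))))).
  by rewrite (eval_Dist e0 gs st) ?(eval_Dist e0 gs nw) ?pstart_lt ?pnow_lt.
have keep1 x : x \notin [:: xlo; xhi] -> eval g1 (Var x) = var g x.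
  by case: l1 => H _; exact: H.
have s1s : eval g1 (Var xs) = S i by rewrite keep1.
have v1 : eval g1 (Var xprev) = frontier c i r by rewrite keep1.
have ln : l < n := low_end_lt c i p; have hn : h < n := high_end_lt c i p.
have fn : frontier c i r < n := frontier_lt c r ik.
set g2 := run (Check _) g1; set g3 := run (Check _) g2; set g4 := run (Check _) g3.
have ok2 : var g2 xok = b && (dn (S i) l + dn l h == dn (S i) h).
  apply: run_check; first by rewrite -[LHS]/(eval g1 (Var xok)) keep1.
  rewrite eval_Eq -[eval g1 (Plus _ _)]/(eval g1 (Dist (Var xs) (Var xlo)) +
     eval g1 (Dist (Var xlo) (Var xhi))).
  by rewrite (eval_Dist e1 s1s lo1) ?(eval_Dist e1 lo1 hi1) ?(eval_Dist e1 s1s hi1).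
have l2 : like [:: xok] g1 g2 by apply: like_run.
have s2 : shown c g2 by apply: shown_like l2 s1.
have [e2 _] := s2.
have s2s : eval g2 (Var xs) = S i := s1s.
have v2 : eval g2 (Var xprev) = frontier c i r := v1.
have lo2 : eval g2 (Var xlo) = l := lo1.
have ok3 : var g3 xok = (b && (dn (S i) l + dn l h == dn (S i) h)) &&
     (dn (S i) (frontier c i r) + dn (frontier c i r) l == dn (S i) l).
  apply: run_check => //.
  rewrite eval_Eq -[eval g2 (Plus _ _)]/(eval g2 (Dist (Var xs) (Var xprev)) +
     eval g2 (Dist (Var xprev) (Var xlo))).
  by rewrite (eval_Dist e2 s2s v2) ?(eval_Dist e2 v2 lo2) ?(eval_Dist e2 s2s lo2).
have l3 : like [:: xok] g2 g3 by apply: like_run.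
have s3 : shown c g3 by apply: shown_like l3 s2.
have [e3 _] := s3.
have v3 : eval g3 (Var xprev) = frontier c i r := v1.
have lo3 : eval g3 (Var xlo) = l := lo1.
have ok4 : var g4 xok = ((b && (dn (S i) l + dn l h == dn (S i) h)) &&
     (dn (S i) (frontier c i r) + dn (frontier c i r) l == dn (S i) l)) &&
     (dn (frontier c i r) l <= (0 < r)).
  apply: run_check => //; rewrite eval_Leq (eval_Dist e3 v3 lo3) //.
  have -> : eval g3 (Var xslack) = (0 < r); last by [].
  by rewrite -[LHS]/(eval g1 (Var xslack)) keep1.
split.
- by rewrite -[LHS]/(var g4 xok) ok4 /link -/p -/l -/h !andbA.
- by rewrite -[LHS]/(eval g1 (Var xhi)).
- by [].
- rewrite -[LHS]/(eval g1 (Var xp) + 1) keep1 //.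
  by rewrite -[var g xp]/(eval g (Var xp)) gp addn1 addnS.
Qed.

Lemma check_acceptingP c g : shown c g ->
  var (run check_accepting g) xok = accept_ok c.
Proof.
move=> s0; rewrite /check_accepting /Block [foldl _ _ _]/= !run_then.
set g1 := run (Let xok _) g; set g2 := run (Let xp _) g1.
have s2 : shown c g2 by do 2 apply: shown_set => //.
have k2 : var g2 vK = k by case: s2 => e2 _; case: (env_bounds e2).
pose I i g' := [/\ shown c g', var g' xok = all (path_ok c) (iota 0 i) &
  var g' xp = i * R].
suff [_ H _] : I (var g2 vK) (run (Repeat xi vK check_path) g2) by rewrite H k2.
apply: run_repeat => [|i g3 ik [i1 i2 i3]]; first by split.
rewrite k2 in ik; set g4 := set_var g3 xi i.
have s4 : shown c g4 by apply: shown_set.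
rewrite /check_path /Block [foldl _ _ _]/= !run_then.
set g5 := run (Let xs _) g4; set g6 := run (Let xprev _) g5.
set g7 := run (Let xslack _) g6; set g8 := run (Repeat xr vR _) g7.
have [e4 _] := s4; have [src4 tgt4] := env_terminals e4 ik.
have s7 : shown c g7 by do 3 apply: shown_set => //.
have R7 : var g7 vR = R by case: s7 => e7 _; case: (env_bounds e7).
pose J r g' := [/\ shown c g', var g' xs = S i /\ var g' xi = i,
  var g' xok = all (path_ok c) (iota 0 i) && all (link c i) (iota 0 r),
  var g' xp = i * R + r & var g' xprev = frontier c i r /\ var g' xslack = (0 < r)].
have [j1 [_ ji] j3 j4 [j5 _]] : J R g8.
  rewrite -R7; apply: run_repeat => [|r g9 rR [k1 [k2' k2''] k3 k4 [k5 k6]]].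
    by split; rewrite ?andbT ?addn0.
  rewrite R7 in rR; set g10 := set_var g9 xr r.
  have s10 : shown c g10 by apply: shown_set.
  have [||||h1 h2 h3 h4] := @check_linkP c g10 i r _ s10 ik rR _ _ _ _ k3; rewrite //.
  have l10 : like [:: xlo; xhi; xok; xprev; xslack; xp] g10 (run check_link g10).
    by apply: like_run.
  split=> //; first exact: shown_like l10 s10.
  - by case: l10 => H _; rewrite !H.
  - by rewrite h1 -(addn1 r) iotaD all_cat /= andbT andbA.
set g9 := run (Check _) g8.
split.
- apply: shown_like (_ : like [:: xok] g8 g9) _ => //; exact: like_run.
- have -> : var g9 xok = (all (path_ok c) (iota 0 i) && all (link c i) (iota 0 R)) &&
      (frontier c i R == T i).
    apply: run_check => //; rewrite eval_Eq -[eval g8 (Var xprev)]/(var g8 xprev) j5.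
    have [e8 _] := j1; have [_ tgt8] := env_terminals e8 ik.
    by rewrite -[eval g8 (Get _ _)]/(arr g8 bTgt (var g8 xi)) ji tgt8.
  by rewrite -(addn1 i) iotaD all_cat /= andbT /path_ok -!andbA.
by rewrite -[LHS]/(var g8 xp) j4 mulSnr.
Qed.

(** ** The search *)

Inductive coded : nat -> Prop :=
| CodedStart c : c < N -> start_ok c -> coded c
| CodedMove c p u : c < N -> p < M -> u < n -> legal c p u ->
    coded (before c p u) -> coded c.

(** The number of moves made: each increases the distance of one pebble from its
    start by 1. *)
Definition progress (c : nat) : nat :=
  \sum_(p < M) dn (pstart c p) (pnow c p).

Lemma before_digits c p u : c < N -> p < M -> u < n ->
  [/\ before c p u < N, pnow (before c p u) p = u,
      forall q, q < M -> pstart (before c p u) q = pstart c q &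
      forall q, q < M -> q != p -> pnow (before c p u) q = pnow c q].
Proof.
move=> cN pM un; have MpM : M + p < M + M by rewrite ltn_add2l.
have [h1 h2 h3] := digit_replace n0 cN MpM un; split=> // q qM.
  by apply: h3; rewrite neq_ltn (leq_trans qM) ?leq_addr.
by move=> nqp; apply: h3; rewrite eqn_add2l.
Qed.

Lemma progress_before c p u : c < N -> p < M -> u < n -> legal c p u ->
  progress c = (progress (before c p u)).+1.
Proof.
move=> cN pM un /and3P[/eqP d1 _ _]; have [_ h2 h3 h4] := before_digits cN pM un.
rewrite /progress (bigD1 (Ordinal pM)) //= d1 [in RHS](bigD1 (Ordinal pM)) //=.
rewrite h2 h3 // addSn; congr (_ + _).+1; apply: eq_bigr => q nq.
by rewrite h3 // h4.
Qed.

Lemma progress_lt c : 0 < M -> progress c < n * M.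
Proof.
move=> M0; apply: (@leq_ltn_trans (\sum_(p < M) n.-1)).
  apply: leq_sum => p _; rewrite -ltnS prednK //.
  exact: dn_lt (pstart_lt _ _) (pnow_lt _ _).
by rewrite sum_nat_const card_ord mulnC ltn_pmul2r // prednK.
Qed.

Definition found (g : store) : Prop :=
  [/\ var g xfin < N, 0 < par g (var g xfin) & accept_ok (var g xfin)].

Definition status (g : store) : Prop :=
  var g xfound = 0 \/ var g xfound = 1 /\ found g.

(** An accepting code is recorded the first time one is visited; what was
    recorded stays valid as marks are never removed. *)
Lemma visitP c g : env g -> sound g -> status g -> var g xc = c -> c < N ->
  let g' := run visit g in
  [/\ env g', sound g', status g' /\ (var g xfound = 1 -> var g' xfound = 1),
      grows g g' &
      (start_ok c \/ exists p u, [/\ p < M, u < n, legal c p u &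
                                 0 < par g (before c p u)]) ->
      0 < par g' c /\ (accept_ok c -> var g' xfound = 1)].
Proof.
move=> eg sg stg gc cN.
rewrite /visit /Block [foldl _ _ _]/= !run_then.
set g1 := run decode g; set g2 := run try_start g1; set g3 := run try_moves g2.
have d1 : decoded c g1 by apply: decodeP.
have p1 d : par g1 d = par g d by rewrite /par run_arr.
have p2 := try_startP d1; rewrite -/g2 in p2.
have d2 : decoded c g2.
  case: d1 => e1 c1 dd1; split; [exact: env_run|by rewrite run_var|].
  by move=> q qM; rewrite run_arr ?dd1.
have gr2 : grows g g2 by move=> d d0; rewrite p2 p1; case: ifP.
have sg2 : sound g2.
  move=> d dN; rewrite p2 p1; case: ifP => [/andP[/eqP-> so] _|_ d0]; first by left.
  have [|[q0 ex]] := sg d dN d0; first by left.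
  by right; split=> //; apply: gr2.
have [sg3 gr3 h3] := try_movesP d2 sg2; rewrite -/g3 in sg3 gr3 h3.
have d3 : decoded c g3.
  case: d2 => e2 c2 dd2; split; [exact: env_run|by rewrite run_var|].
  by move=> q qM; rewrite run_arr ?dd2.
have [e3 c3 dd3] := d3.
have f3 : var g3 xfound = var g xfound by rewrite !run_var.
have n3 : var g3 xfin = var g xfin by rewrite !run_var.
have st3 : status g3.
  case: stg => [f0|[f1 [a1 a2 a3]]]; [by left; rewrite f3|right; rewrite f3].
  by split=> //; rewrite /found n3; split=> //; apply/gr3/gr2.
have new3 : (start_ok c \/ exists p u, [/\ p < M, u < n, legal c p u &
                                 0 < par g (before c p u)]) -> 0 < par g3 c.
  case=> [so|[p [u [pM un lg b0]]]]; first by apply: gr3; rewrite p2 eqxx so.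
  by apply: (h3 p u) => //; apply: gr2.
set body := Then check_accepting _; set s := If _ body.
have nf : eval g3 (Not (Var xfound)) = (var g xfound == 0).
  by rewrite -f3; case: st3 => [|[]] /= ->.
have cE : eval g3 (And (Not (Var xfound)) (Less (Cst 0) (Get bPar (Var xc)))) =
    (var g xfound == 0) && (0 < par g3 c).
  apply: eval_And => //; by rewrite -[LHS]/(nat_of_bool (0 < par g3 (var g3 xc))) c3.
set g4 := run s g3.
have pe4 d : par g4 d = par g3 d by rewrite /par run_arr.
have e4 : env g4 by apply: env_run.
have sg4 : sound g4.
  by move=> d dN; rewrite pe4 => d0; have := sg3 d dN d0; rewrite /= !pe4.
have gr4 : grows g g4 by move=> d d0; rewrite pe4; apply/gr3/gr2.
have sh3 : shown c g3 by [].
set g5 := run check_accepting g3.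
have ok5 : var g5 xok = accept_ok c by apply: check_acceptingP.
have f4 : (var g4 xfound = if [&& var g xfound == 0, 0 < par g3 c & accept_ok c]
    then 1 else var g xfound) /\
   (var g4 xfin = if [&& var g xfound == 0, 0 < par g3 c & accept_ok c]
    then c else var g xfin).
  rewrite /g4 /s !(@run_if_var _ _ _ _ _ _ cE) // andbA.
  case: (_ && _); last by rewrite f3 n3.
  rewrite andTb /body run_then -/g5.
  rewrite !(@run_if_var _ _ _ (accept_ok c)) //.
  have c5 : var g5 xc = c by rewrite run_var.
  have f5 : var g5 xfound = var g xfound by rewrite run_var.
  have n5 : var g5 xfin = var g xfin by rewrite run_var.
  by case: (accept_ok c); [split; [|exact: c5]|split].
case: f4 => f4 n4; split=> //.
  split; last by move=> f1; rewrite f4 f1.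
  case: ifP f4 n4 => [/and3P[f0 pc ac] f4 n4|_ f4 n4].
    by right; split=> //; rewrite /found n4 pe4.
  case: st3 => [st|[st [a1 a2 a3]]]; first by left; rewrite f4 -f3.
  by right; rewrite f4 -f3; split=> //; rewrite /found n4 pe4 -n3.
move=> /new3 pc; rewrite pe4 pc; split=> // ac; rewrite f4 pc ac andbT andbT.
by case: stg => [->|[->]].
Qed.

(** After [m] rounds the codes with fewer than [m] moves are reached, and
    [progress_lt] bounds the moves by the number of rounds. *)
Lemma searchP g : 0 < M -> env g -> (forall c, par g c = 0) ->
  let g' := run search g in
  [/\ env g', sound g', status g' & var g' xfound = 0 ->
    forall c, coded c -> ~~ accept_ok c].
Proof.
move=> M0 eg g0; rewrite /search !run_then; set g1 := run _ g.
pose good g' := [/\ env g', sound g' & status g'].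
pose done m g' c := progress c < m -> 0 < par g' c /\ (accept_ok c -> var g' xfound = 1).
pose I m g' := good g' /\ forall c, coded c -> done m g' c.
have e1 : env g1 by apply: env_run.
have t1 : var g1 vT = n * M by case: e1.
have good_set x m g' : 8 < x -> x != xfound -> x != xfin -> good g' -> good (set_var g' x m).
  move=> x8 nf nn [h1 h2 h3]; split=> //; first exact: env_set_var.
  by rewrite /status /found /= !(eq_sym _ x) (negPf nf) (negPf nn).
suff [[h1 h2 h3] h4] : I (var g1 vT) (run (Repeat xround vT (Repeat xc vC visit)) g1).
  split=> // f0 c cc; apply/negP => ac.
  have pl : progress c < var g1 vT by rewrite t1; apply: progress_lt.
  by have [_ /(_ ac)] := h4 c cc pl; rewrite f0.
apply: run_repeat => [|m g2 mT [i1 i2]].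
  split=> //; split; [exact: e1| |by left].
  by move=> c _; rewrite -[par g1 c]/(par g c) g0.
set g3 := set_var g2 xround m.
have i3 : good g3 by apply: good_set.
have c3 : var g3 vC = N by case: i3 => -[].
pose J c g' := [/\ good g', forall c', coded c' -> done m g' c' &
  forall c', coded c' -> c' < c -> done m.+1 g' c'].
have [h1 _ h2] : J (var g3 vC) (run (Repeat xc vC visit) g3).
  apply: run_repeat => [|c g4 cN [j1 j2 j3]]; first by split.
  rewrite c3 in cN; set g5 := set_var g4 xc c.
  have [h1 h2 h3] : good g5 by apply: good_set.
  have [k1 k2 [k3 k4] k5 k6] := visitP h1 h2 h3 (erefl : var g5 xc = c) cN.
  have grow m' c' : done m' g4 c' -> done m' (run visit g5) c'.
    by move=> dn' pm; have [q0 qa] := dn' pm; split; [exact: k5|move=> /qa; exact: k4].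
  split=> // [c' cc'|c' cc']; first exact/grow/j2.
  rewrite ltnS leq_eqVlt => /orP[/eqP E|lt]; last exact/grow/j3.
  rewrite E in cc' * => pm; apply: k6.
  case: cc' pm {E} => [c0 _ so|c0 p u c0N pM un lg cb] pm; first by left.
  right; exists p, u; split=> //; have [|b0 _] := j2 _ cb; last exact: b0.
  by rewrite ltnS (progress_before c0N pM un lg) in pm.
by split=> // c cc; apply: h2 => //; rewrite c3; case: cc.
Qed.

(** ** The output *)

Lemma answer_noneP g : var g xfound = 0 -> 0 < B -> inp (run answer g) 0 = 0.
Proof.
by move=> f0 B0; rewrite /answer (@run_when _ _ _ _ false) //= B0.
Qed.

Section Output.

Variable P : nat -> seq nat.

Definition block (i : nat) : seq nat := size (P i) :: P i.
Definition word (m : nat) : seq nat := 1 :: flatten [seq block i | i <- iota 0 m].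

Lemma wordS m : word m.+1 = word m ++ block m.
Proof. by rewrite /word -(addn1 m) iotaD map_cat flatten_cat /= cats0. Qed.

(** Where the block of the path [i] begins. *)
Definition off (i : nat) : nat := size (word i).

Lemma offS i : off i.+1 = off i + (size (P i)).+1.
Proof. by rewrite /off wordS size_cat. Qed.

Lemma word_size m i : i < m -> nth 0 (word m) (off i) = size (P i) /\ off i < off m.
Proof.
elim: m => // m IHm; rewrite ltnS leq_eqVlt => /orP[/eqP->|im].
  by rewrite wordS nth_cat ltnn subnn offS; split=> //; lia.
have [h1 h2] := IHm im; rewrite wordS nth_cat h2 h1; split=> //.
by rewrite offS; lia.
Qed.

Lemma word_vertex m i l : i < m -> l < size (P i) ->
  nth 0 (word m) ((off i).+1 + l) = nth 0 (P i) l /\ (off i).+1 + l < off m.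
Proof.
elim: m => // m IHm; rewrite ltnS leq_eqVlt => /orP[/eqP->|im] lP.
  rewrite wordS nth_cat ltnNge -/(off m).
  have -> : off m <= (off m).+1 + l by lia.
  have -> : (off m).+1 + l - off m = l.+1 by lia.
  by rewrite offS; split=> //; lia.
have [h1 h2] := IHm im lP; rewrite wordS nth_cat h2 h1; split=> //.
by rewrite offS; lia.
Qed.

Lemma word_cases m a : a < off m -> a = 0 \/ exists2 i, i < m &
  a = off i \/ exists2 l, l < size (P i) & a = (off i).+1 + l.
Proof.
elim: m => [|m IHm]; first by rewrite ltnS leqn0 => /eqP; left.
rewrite offS => aM; have [am|ma] := ltnP a (off m).
  have [->|[i im h]] := IHm am; first by left.
  by right; exists i => //; apply: ltnW.
right; exists m => //; have [E|lt] := eqVneq a (off m); first by left.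
by right; exists (a - (off m).+1); lia.
Qed.

Hypothesis size_P : forall i, i < k -> size (P i) = (dn (S i) (T i)).+1.
Hypothesis P_level : forall i v, i < k -> v \in P i ->
  dn (S i) v < size (P i) /\ nth 0 (P i) (dn (S i) v) = v.
Hypothesis word_B : off k <= B.

(** Only finally correct values are written, so correctness of a cell, once
    established, persists and the cells can be treated one at a time. *)
Definition correct (g : store) (a : nat) : Prop := inp g a = nth 0 (word k) a.

Lemma run_emit e1 e2 g a v : eval g e1 = a -> eval g e2 = v -> a < off k ->
  v = nth 0 (word k) a -> let g' := run (Emit e1 e2) g in
  correct g' a /\ forall a', correct g a' -> correct g' a'.
Proof.
move=> ea ev ak va /=; rewrite ea ev (leq_trans ak word_B) /correct /= eqxx.
by split=> // a' ca'; case: eqVneq => [->|].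
Qed.

Lemma emit_sizesP g : env g -> let g' := run emit_sizes g in
  [/\ forall i, i < k -> arr g' bOff i = (off i).+1, correct g' 0 &
      forall i, i < k -> correct g' (off i)].
Proof.
move=> eg; rewrite /emit_sizes /Block [foldl _ _ _]/= !run_then.
set g1 := run (Emit _ _) g; set g2 := run (Let _ _) g1.
have [c1 _] : correct g1 0 /\ forall a', correct g a' -> correct g1 a'.
  by apply: (@run_emit _ _ _ 0 1).
pose I m g' := [/\ env g', var g' xoff = off m,
  forall i, i < m -> arr g' bOff i = (off i).+1, correct g' 0 &
      forall i, i < m -> correct g' (off i)].
have e2 : env g2 by do 2 apply: env_run => //.
have k2 : var g2 vK = k by case: (env_bounds e2).
set body := Then _ _.
suff [_ _ h1 h2 h3] : I k (run (Repeat xi vK body) g2) by split.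
suff : I (var g2 vK) (run (Repeat xi vK body) g2) by rewrite k2.
apply: run_repeat => [|i g3 ik [i1 i2 i3 i4 i5]]; first by split.
rewrite k2 in ik; set g4 := set_var g3 xi i.
have e4 : env g4 by apply: env_set_var.
rewrite /body !run_then; set g5 := run (Let xl _) g4; set g6 := run (Emit _ _) g5.
have [src tgt] := env_terminals e4 ik.
have l5 : var g5 xl = dn (S i) (T i).
  apply: (@eval_Dist g4 (Get bSrc (Var xi)) (Get bTgt (Var xi)));
    by rewrite ?S_lt ?T_lt.
have [w1 w2] := word_size ik.
have [c6 k6] : correct g6 (off i) /\ forall a', correct g5 a' -> correct g6 a'.
  apply: (@run_emit _ _ _ _ (size (P i))) => //.
  by rewrite size_P // -l5 -[RHS]addn1.
have o6 : var g6 xoff = off i by rewrite run_var.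
have l6 : var g6 xl = dn (S i) (T i) by rewrite run_var.
have i6 : var g6 xi = i by rewrite run_var.
split.
- by do 5 apply: env_run => //.
- rewrite offS size_P // -l6 -[LHS]/(var g6 xoff + var g6 xl + 2) o6; lia.
- move=> j; rewrite ltnS leq_eqVlt -[arr _ _ _]/(if (bOff == bOff) && (j == var g6 xi)
    then var g6 xoff + 1 else arr g6 bOff j) i6 o6 run_arr //.
  by case: eqVneq => [-> _|_ ji] /=; [rewrite addn1|apply: i3].
- exact: k6.
move=> j; rewrite ltnS leq_eqVlt => /orP[/eqP->|ji]; first exact: c6.
exact/k6/i5.
Qed.

Lemma emit_stateP c g : shown c g ->
  (forall i, i < k -> arr g bOff i = (off i).+1) ->
  (forall p, p < M -> pnow c p \in P (p %/ R)) ->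
  let g' := run emit_state g in (forall a, correct g a -> correct g' a) /\
    forall p, p < M -> correct g' ((off (p %/ R)).+1 + dn (S (p %/ R)) (pnow c p)).
Proof.
move=> s0 go vis g'.
pose I m g' := [/\ shown c g' /\ forall i, i < k -> arr g' bOff i = (off i).+1,
  forall a, correct g a -> correct g' a &
  forall p, p < m -> p < M -> correct g' ((off (p %/ R)).+1 + dn (S (p %/ R)) (pnow c p))].
have gM := shown_M s0.
suff [_ h1 h2] : I (var g vM) g' by split=> // p pM; apply: h2; rewrite ?gM.
apply: run_repeat => [|p g1 pM [[i1 i0] i2 i3]]; first by split.
rewrite gM in pM; set g2 := set_var g1 xp p.
have s2 : shown c g2 by apply: shown_set.
have ik : p %/ R < k by rewrite ltn_divLR.
have gp : eval g2 (Var xp) = p by [].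
have ow := eval_own s2 gp pM; have nw := eval_now s2 gp pM.
have [e2 _] := s2; have [src _] := env_terminals e2 ik.
have [lv nt] := P_level ik (vis p pM).
have [w1 w2] := word_vertex ik lv.
have ds : eval g2 (Dist (Get bSrc (Own (Var xp))) (PieceY (Var xp))) =
    dn (S (p %/ R)) (pnow c p).
  apply: eval_Dist; rewrite ?pnow_lt ?S_lt //.
  by rewrite -[LHS]/(arr g2 bSrc (eval g2 (Own (Var xp)))) ow src.
have of2 : eval g2 (Get bOff (Own (Var xp))) = (off (p %/ R)).+1.
  by rewrite -[LHS]/(arr g2 bOff (eval g2 (Own (Var xp)))) ow; apply: i0.
set a := (off (p %/ R)).+1 + dn (S (p %/ R)) (pnow c p).
have [||||c3 k3] := @run_emit (Plus (Get bOff (Own (Var xp)))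
    (Dist (Get bSrc (Own (Var xp))) (PieceY (Var xp)))) (PieceY (Var xp)) g2 a (pnow c p).
- by rewrite -[LHS]/(eval g2 (Get bOff (Own (Var xp))) + eval g2
     (Dist (Get bSrc (Own (Var xp))) (PieceY (Var xp)))) of2 ds.
- exact: nw.
- exact: w2.
- by rewrite w1 nt.
set g3 := run (Emit _ _) g2.
have a3 b i : arr g3 b i = arr g1 b i by rewrite run_arr.
split.
- split; last by move=> i i_k; rewrite a3 i0.
  by split; [exact: env_run|move=> q qM; rewrite a3; case: i1 => _ ->].
- by move=> a' ca; apply/k3/i2.
move=> q; rewrite ltnS leq_eqVlt => /orP[/eqP->//|qp] qM.
exact/k3/i3.
Qed.

(** Positions along the parents are the vertices of the trails.  The number of
    steps exceeds the number of moves; the last ones repeat the initial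
    configuration. *)
Lemma emit_pathsP g c : env g -> var g xfin = c ->
  (forall i, i < k -> arr g bOff i = (off i).+1) ->
  let parent d := (par g d).-1 in
  (forall t, iter t parent c < N) ->
  (forall t p, p < M -> pnow (iter t parent c) p \in P (p %/ R)) ->
  let g' := run emit_paths g in (forall a, correct g a -> correct g' a) /\
    forall t p, t < n * M -> p < M ->
      correct g' ((off (p %/ R)).+1 + dn (S (p %/ R)) (pnow (iter t parent c) p)).
Proof.
move=> eg gc go parent cN vis; rewrite /emit_paths !run_then; set g1 := run _ g.
set body := Block decode _.
pose I m g' := [/\ env g', var g' xc = iter m parent c,
  arr g' bOff =1 arr g bOff /\ arr g' bPar =1 arr g bPar,
  forall a, correct g a -> correct g' a &
  forall t p, t < m -> p < M ->
      correct g' ((off (p %/ R)).+1 + dn (S (p %/ R)) (pnow (iter t parent c) p))].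
have e1 : env g1 by apply: env_run.
suff [_ _ _ h1 h2] : I (var g1 vT) (run (Repeat xt vT body) g1).
  by split=> // t p tM pM; apply: h2; rewrite // (env_rounds e1).
apply: run_repeat => [|m g2 mM [i1 i2 [i3 i3'] i4 i5]]; first by split.
rewrite /body /Block [foldl _ _ _]/= !run_then; set g3 := set_var g2 xt m.
set d := iter m parent c in i2.
have e3 : env g3 by apply: env_set_var.
set g4 := run decode g3; set g5 := run emit_state g4.
have [e4 c4 d4] : decoded d g4 by apply: decodeP (cN m).
have o4 i : i < k -> arr g4 bOff i = (off i).+1.
  by move=> ik; rewrite run_arr // -go // -i3.
have p4 : arr g4 bPar =1 arr g bPar by move=> i; rewrite run_arr // -i3'.
have c4' a : correct g2 a -> correct g4 a by rewrite /correct run_inp.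
have [k5 n5] := emit_stateP (conj e4 d4) o4 (vis m).
have c5 : var g5 xc = d by rewrite run_var.
split.
- by do 2 apply: env_run => //.
- rewrite -[LHS]/(arr g5 bPar (var g5 xc) - 1) c5 run_arr // p4.
  by rewrite iterS /parent subn1.
- split=> i; first by rewrite -[LHS]/(arr g5 bOff i) !run_arr // -i3.
  by rewrite -[LHS]/(arr g5 bPar i) run_arr.
- by move=> a ca; apply/k5/c4'/i4.
move=> t p; rewrite ltnS leq_eqVlt => /orP[/eqP->|tm] pM; first exact: n5.
exact/k5/c4'/i5.
Qed.

Lemma answer_foundP g : env g -> var g xfound = 1 ->
  let parent d := (par g d).-1 in let c := var g xfin in
  (forall t, iter t parent c < N) ->
  (forall i v, i < k -> reflect (exists t r,
      [/\ t < n * M, r < R & v = pnow (iter t parent c) (i * R + r)]) (v \in P i)) ->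
  (forall t p, p < M -> pnow (iter t parent c) p \in P (p %/ R)) ->
  (forall i l, i < k -> l < size (P i) -> dn (S i) (nth 0 (P i) l) = l) ->
  forall a, a < off k -> correct (run answer g) a.
Proof.
move=> eg f1 parent c cN vP vis lev a; rewrite /answer (@run_when _ _ _ _ true); last first.
  by rewrite -[LHS]/(var g xfound).
rewrite run_then; set g1 := run emit_sizes g.
have [o1 z1 s1] := emit_sizesP eg; rewrite -/g1 in o1 z1 s1.
have e1 : env g1 by apply: env_run.
have n1 : var g1 xfin = c by rewrite run_var.
have par1 d : par g1 d = par g d by rewrite /par run_arr.
have it1 t : iter t (fun d => (par g1 d).-1) c = iter t parent c.
  by elim: t => //= t ->; rewrite par1.
have [||k2 v2] := @emit_pathsP g1 c e1 n1 o1.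
- by move=> t; rewrite it1.
- by move=> t p pM; rewrite it1; apply: vis.
case/word_cases => [->|[i ik [->|[l lP ->]]]].
- exact/k2/z1.
- exact/k2/s1.
have [t [r [tM rR E]]] := elimT (vP i _ ik) (mem_nth 0 lP).
have pM : i * R + r < M by nia.
have := v2 t _ tM pM; rewrite it1 -E divnMDl // divn_small // addn0.
by rewrite lev.
Qed.

End Output.

End SearchLoop.

(** * Running time *)

Fixpoint coefficient (s : stmt) : nat :=
  match s with
  | Let _ e => expr_cost e + 1
  | Put _ e1 e2 => expr_cost e1 + expr_cost e2 + 8
  | Emit e1 e2 => expr_cost e1 + expr_cost e2 + 2
  | Then s1 s2 => coefficient s1 + coefficient s2
  | When e s1 s2 => expr_cost e + coefficient s1 + coefficient s2 + 1
  | Repeat _ _ s1 => coefficient s1 + 7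
  end.

Fixpoint loop_bounds (s : stmt) : seq nat :=
  match s with
  | Then s1 s2 | When _ s1 s2 => loop_bounds s1 ++ loop_bounds s2
  | Repeat _ b s1 => b :: loop_bounds s1
  | _ => [::]
  end.

Definition straight (s : stmt) : bool := nilp (loop_bounds s).

(** The largest product of nested loop bounds.  Loop-free parts contribute no
    factor, which keeps the formula for a concrete program short. *)
Fixpoint monomial (r : nat -> nat) (s : stmt) : nat :=
  match s with
  | Then s1 s2 | When _ s1 s2 =>
      if straight s1 then monomial r s2 else
      if straight s2 then monomial r s1 else maxn (monomial r s1) (monomial r s2)
  | Repeat _ b s1 => if straight s1 then r b else r b * monomial r s1
  | _ => 1
  end.

Lemma monomial_straight r s : straight s -> monomial r s = 1.
Proof.
by elim: s => //= [s1 IH1 s2 IH2|e s1 IH1 s2 IH2];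
  rewrite /straight /nilp /= size_cat addn_eq0 -!/(nilp _) -!/(straight _);
  case/andP=> /[dup] /IH1 -> -> /IH2 ->.
Qed.

Lemma monomial_seq r s1 s2 : 0 < monomial r s1 -> 0 < monomial r s2 ->
  let p := if straight s1 then monomial r s2 else
    if straight s2 then monomial r s1 else maxn (monomial r s1) (monomial r s2) in
  [/\ 0 < p, monomial r s1 <= p & monomial r s2 <= p].
Proof.
move=> p1 p2 p; rewrite {}/p; case: ifP => [st1|_]; first by rewrite (monomial_straight r st1).
case: ifP => [st2|_]; first by rewrite (monomial_straight r st2).
by rewrite leq_max p1 leq_maxl leq_maxr.
Qed.

(** The constant depends on the text of the program only. *)
Lemma cost_monomial r s : all (fun b => 0 < r b) (loop_bounds s) ->
  0 < monomial r s /\ cost r s <= coefficient s * monomial r s.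
Proof.
elim: s => [x e|b e1 e2|e1 e2|s1 IH1 s2 IH2|e s1 IH1 s2 IH2|x b s IH] /=;
  rewrite ?muln1 //.
- rewrite all_cat => /andP[/IH1[p1 c1] /IH2[p2 c2]].
  have [p0 m1 m2] := monomial_seq p1 p2; split=> //.
  rewrite mulnDl; apply: leq_add.
    by apply: leq_trans c1 _; rewrite leq_mul2l m1 orbT.
  by apply: leq_trans c2 _; rewrite leq_mul2l m2 orbT.
- rewrite all_cat => /andP[/IH1[p1 c1] /IH2[p2 c2]].
  have [p0 m1 m2] := monomial_seq p1 p2; split=> //.
  rewrite !mulnDl; apply: leq_add; last by rewrite mul1n.
  apply: leq_add; first apply: leq_add.
  + by rewrite leq_pmulr.
  + by apply: leq_trans c1 _; rewrite leq_mul2l m1 orbT.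
  + by apply: leq_trans c2 _; rewrite leq_mul2l m2 orbT.
case/andP=> rb /IH[p0 c0].
have -> : (if straight s then r b else r b * monomial r s) = r b * monomial r s.
  by case: ifP => // /(monomial_straight r) ->; rewrite muln1.
have rp : 0 < r b * monomial r s by rewrite muln_gt0 rb.
split=> //; rewrite mulnDl mulnDr -addnA; apply: leq_add.
  by rewrite mulnCA leq_mul2l c0 orbT.
have rb' : r b <= r b * monomial r s by rewrite leq_pmulr.
lia.
Qed.

Section Bounds.

Variables n k : nat.
Hypotheses (k0 : 0 < k) (kn : k <= n).
Local Notation m := (k * k`!).
Local Notation R := (4 * k`!).+1.
Local Notation M := (k * R).
Local Notation N := (n ^ (M + M)).

(** The search makes [n M] rounds over [N] codes, at [M ^ 2 * n] steps per code up
    to constants; the power [n ^ 4] also covers the distance matrix. *)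
Definition work : nat := 3 * (M ^ 3 * n ^ 4 * N).

Let n0 : 0 < n. Proof. exact: leq_trans k0 kn. Qed.
Let M0 : 0 < M. Proof. by rewrite muln_gt0 k0. Qed.
Let N0 : 0 < N. Proof. by rewrite expn_gt0 n0. Qed.

(** [M <= 5 m] and [m < 2 ^ m <= n ^ m]; the case [n = 1] forces [k = 1]. *)
Lemma pieces_pow : M ^ 3 <= 125 * n ^ (3 * m).
Proof.
have m0 : 0 < m by rewrite muln_gt0 k0 fact_gt0.
have Mm : M <= 5 * m by have := fact_gt0 k; nia.
apply: (@leq_trans ((5 * m) ^ 3)); first by rewrite leq_exp2r.
rewrite expnMn leq_mul2l /= (mulnC 3 m) expnM leq_exp2r //.
have [n1|n1] := leqP n 1; last first.
  by apply: leq_trans (ltnW (ltn_expl m (ltnSn 1))) _; rewrite leq_exp2r.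
have n1' : n = 1 by lia.
have k1 : k = 1 by lia.
by rewrite n1' exp1n k1.
Qed.

(** [2 M = 8 m + 2 k], so the exponent is [11 m + 2 k + 4], and [k + 3 <= 5 m]. *)
Lemma work_bound : work <= 375 * (k * n ^ (16 * k * k`! + k + 1)).
Proof.
have km : k <= m by rewrite leq_pmulr // fact_gt0.
have m0 : 0 < m by apply: leq_trans km.
set X := k * n ^ _; have -> : 375 * X = 3 * (125 * X) by rewrite mulnA.
rewrite /work leq_mul2l /=.
apply: (@leq_trans (125 * n ^ (3 * m) * n ^ 4 * N)).
  by apply: leq_mul => //; apply: leq_mul => //; exact: pieces_pow.
rewrite -!(mulnA 125) leq_mul2l /= -!expnD.
apply: (@leq_trans (n ^ (16 * k * k`! + k + 1))); last exact: leq_pmull.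
by rewrite leq_pexp2l //; lia.
Qed.

Lemma solve_work rho : rho vN = n -> rho vK = k -> rho vR = R -> rho vM = M ->
  rho vD = M + M -> rho vZ = M + M + n -> rho vT = n * M -> rho vC = N ->
  [/\ monomial rho base_size <= work, monomial rho sizes <= work,
   monomial rho tables <= work & monomial rho solve <= work].
Proof.
move=> hN hK hR hM hD hZ hT hC.
have kM : k <= M by rewrite leq_pmulr.
have P i j : i <= 3 -> j <= 4 -> M ^ i * n ^ j <= M ^ 3 * n ^ 4.
  by move=> i3 j4; apply: leq_mul; rewrite leq_pexp2l.
set Q := M ^ 3 * n ^ 4 in P.
have QW x : x <= 3 * Q -> x <= work.
  by move=> xQ; apply: leq_trans xQ _; rewrite leq_mul2l /= leq_pmulr.
have p01 := P 0 1 isT isT; have p10 := P 1 0 isT isT; have p11 := P 1 1 isT isT.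
have p20 := P 2 0 isT isT; have p02 := P 0 2 isT isT; have p04 := P 0 4 isT isT.
have p22 := P 2 2 isT isT.
have kk : k * k <= M * M by apply: leq_mul.
rewrite !(expn0, expn1, mul1n, muln1) -!mulnn in p01 p10 p11 p20 p02 p22.
split; rewrite /= ?hN ?hK ?hR ?hM ?hD ?hZ ?hT ?hC.
- by apply: QW; lia.
- by rewrite !geq_max -!andbA; apply/and3P; split; apply: QW; lia.
- have n4 : n * (n * (n * n)) <= Q by move: p04; rewrite expn0 mul1n !expnS expn0 muln1.
  by rewrite !geq_max; do 5 (try (apply/andP; split)); apply: QW; rewrite ?mulnDl; lia.
have V : maxn (maxn (maxn ((M + M) * n) (M * M)) (M * (n * M))) M <= 3 * (M ^ 2 * n).
  have M2 : M <= M ^ 2 by rewrite -{1}(expn1 M) leq_pexp2l.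
  have Mn : M ^ 2 <= M ^ 2 * n by rewrite leq_pmulr.
  have Mn' : M * n <= M ^ 2 * n by rewrite leq_mul2r M2 orbT.
  have E : M * (n * M) = M ^ 2 * n by rewrite mulnA mulnAC mulnn.
  have E' : M * M = M ^ 2 by rewrite mulnn.
  by rewrite !geq_max E E' mulnDl; do 3 (try (apply/andP; split)); lia.
rewrite !geq_max; apply/and3P; split.
- apply: leq_trans (leq_mul (leqnn _) (leq_mul (leqnn N) V)) _.
  have -> : n * M * (N * (3 * (M ^ 2 * n))) = 3 * (n * M * (M ^ 2 * n) * N).
    by move: (M ^ 2) N M => a b c; lia.
  rewrite /work leq_mul2l /=; apply: leq_mul => //.
  have -> : n * M * (M ^ 2 * n) = M ^ 3 * n ^ 2.
    by rewrite (expnS M 2) -(mulnn n); lia.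
  exact: P.
- by apply: QW; lia.
apply: QW; apply: leq_trans (_ : n * M * (2 * (M * n)) <= _).
  rewrite leq_mul2l geq_max; apply/orP; right; apply/andP; split; first lia.
  by apply: leq_trans (leq_pmulr M n0) _; lia.
have -> : n * M * (2 * (M * n)) = 2 * (M * M * (n * n)) by lia.
lia.
Qed.

End Bounds.

(** * Codes and plays *)

Section Codes.

Variables (n k : nat) (e : rel 'I_n) (v0 : 'I_n).
Hypothesis e_conn : forall x y, connect e x y.
Hypothesis e_sym : symmetric e.
Variable R : nat.
Hypothesis R0 : 0 < R.
Variables SV TV : nat -> 'I_n.

Local Notation M := (k * R).
Local Notation N := (n ^ (M + M)).
Local Notation d := (dist e).

Definition vtx (x : nat) : 'I_n := insubd v0 x.
Definition dn (u v : nat) : nat := d (vtx u) (vtx v).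
Definition sn (i : nat) : nat := val (SV i).
Definition tn (i : nat) : nat := val (TV i).

Lemma vtxK x : x < n -> val (vtx x) = x.
Proof. by move=> xn; rewrite /vtx val_insubd xn. Qed.

Lemma valK' (v : 'I_n) : vtx v = v.
Proof. by apply/val_inj; rewrite vtxK. Qed.

Let n0 : 0 < n. Proof. exact: leq_ltn_trans (ltn_ord v0). Qed.

Lemma vtx_eq x y : x < n -> y < n -> (vtx x == vtx y) = (x == y).
Proof. by move=> xn yn; rewrite -val_eqE /= !vtxK. Qed.

Lemma dn_lt u v : dn u v < n.
Proof. by have := dist_lt e_conn (vtx u) (vtx v); rewrite card_ord. Qed.

Lemma dn_eq0 u v : u < n -> v < n -> (dn u v == 0) = (u == v).
Proof. by move=> un vn; rewrite /dn dist_eq0 // vtx_eq. Qed.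

Lemma dn_next u v l : u < n -> v < n -> l < dn u v ->
  (dn u v == l.+1) = has (fun w => (dn u w == l) && e (vtx w) (vtx v)) (iota 0 n).
Proof.
move=> un vn ldn; apply/eqP/hasP => [/(dist_pred e_conn)[w dw ew]|[w]].
  by exists (val w); rewrite ?mem_iota ?ltn_ord // /dn valK' dw eqxx.
move=> _ /andP[/eqP dw ew]; apply/eqP; rewrite eqn_leq ldn andbT.
have := dist_tri e_conn (vtx w) (vtx u) (vtx v); rewrite -/(dn u w) dw => h.
by apply: leq_trans h _; rewrite -addn1 leq_add2l dist_le1.
Qed.

Definition pebble_start (c p : nat) : 'I_n := vtx (pstart n c p).
Definition pebble_now (c p : nat) : 'I_n := vtx (pnow n k R c p).

Local Notation A := pebble_start.
Local Notation Y := pebble_now.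

Lemma start_okP c : start_ok n k R c ->
  (forall p, p < M -> Y c p = A c p) /\ distinct_starts k R (A c).
Proof.
move=> /allP so; split=> [p pM|p q pM qM npq].
  by have /andP[/eqP E _] := so p ltac:(by rewrite mem_iota); rewrite /Y /A E.
have /andP[_ /allP al] := so p ltac:(by rewrite mem_iota).
have := al q ltac:(by rewrite mem_iota); rewrite -!/(own _ _) (negPf npq) /=.
by rewrite /A vtx_eq ?pstart_lt.
Qed.

Lemma start_ok_intro c : (forall p, p < M -> Y c p = A c p) ->
  distinct_starts k R (A c) -> start_ok n k R c.
Proof.
move=> ya da; apply/allP => p; rewrite mem_iota /= => pM; apply/andP; split.
  have /eqP := ya p pM; rewrite /Y /A vtx_eq ?pnow_lt ?pstart_lt //.
  by rewrite eq_sym.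
apply/allP => q; rewrite mem_iota /= => qM; rewrite -!/(own _ _).
case: eqVneq => //= npq; have := da p q pM qM npq.
by rewrite /A vtx_eq ?pstart_lt.
Qed.

(** The code [c] is the configuration after the move, [a] and [y] describe the
    one before. *)
Lemma legalP c p u a y : p < M -> u < n -> y p = vtx u ->
  (forall q, q < M -> a q = A c q) ->
  (forall q, q < M -> q != p -> y q = Y c q) ->
  legal n k R dn c p u <-> move_ok e k R a y p (Y c p).
Proof.
move=> pM un yp aq yq; rewrite /legal /move_ok aq // yp -/(dn _ u) -/(dn _ _).
split=> [/and3P[/eqP h1 /eqP h2 /allP h3]|[h1 h2 h3]].
  split=> // q qM nqp; have := h3 q ltac:(by rewrite mem_iota).
  rewrite -!/(own _ _) eq_sym (negPf nqp) /= /between aq // yq //.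
  by apply: contraNneq nqp => ->.
apply/and3P; split; [exact/eqP|exact/eqP|].
apply/allP => q; rewrite mem_iota /= => qM; rewrite -!/(own _ _).
case: eqVneq => //= npq; have := h3 q qM; rewrite eq_sym => /(_ npq).
rewrite /between aq // yq //; by apply: contraNneq npq => ->.
Qed.

(** Every play can be followed by codes, replacing one digit per move. *)
Lemma play_coded a y W : play e k R a y W -> forall c, c < N ->
  (forall p, p < M -> A c p = a p /\ Y c p = y p) -> coded n k R dn c.
Proof.
elim=> {a y W} [a y W da ya _|a y W a' y' W' p _ IH pM aa yW mv _] c cN m.
  apply: CodedStart => //; apply: start_ok_intro => [p pM|p q pM qM npq].
    by have [-> ->] := m p pM; rewrite ya.
  by have [-> _] := m p pM; have [-> _] := m q qM; apply: da.
have [b1 b2 b3 b4] := before_digits n0 cN pM (ltn_ord (y p)).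
apply: (CodedMove cN pM (ltn_ord (y p))).
  apply/(@legalP c p (y p) a y) => //.
  - by rewrite valK'.
  - by move=> q qM; rewrite -aa //; have [] := m q qM.
  - by move=> q qM nqp; have [_ ->] := m q qM; have [->] := yW q qM nqp.
  - by have [_ ->] := m p pM.
apply: IH => // q qM; rewrite /A /Y b3 // -aa //; have [mA mY] := m q qM.
split=> //; have [->|nqp] := eqVneq q p; first by rewrite b2 valK'.
by rewrite b4 //; have [<- _] := yW q qM nqp.
Qed.

(** ** Acceptance *)

Lemma near_endE c i p : near_end e SV (A c) (Y c) i p = vtx (low_end n k R sn dn c i p).
Proof.
by rewrite /near_end /low_end /dn /sn valK' -/(A c p) -/(Y c p); case: ifP.
Qed.

Lemma far_endE c i p : far_end e SV (A c) (Y c) i p = vtx (high_end n k R sn dn c i p).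
Proof.
by rewrite /far_end /high_end /dn /sn valK' -/(A c p) -/(Y c p); case: ifP.
Qed.

Lemma reachedE c i r :
  reached e R SV (A c) (Y c) i r = vtx (frontier n k R sn dn c i r).
Proof. by case: r => [|r] /=; rewrite ?far_endE // valK'. Qed.

Lemma linkE c i r : link_ok e R SV (A c) (Y c) i r = link n k R sn dn c i r.
Proof.
by rewrite /link_ok /link near_endE far_endE reachedE -!/(dn _ _) /sn /dn !valK'.
Qed.

Lemma accept_okP c : (accept_ok n k R sn tn dn c) <->
  accepting e k R SV TV (A c) (Y c).
Proof.
have fE i : i < k -> (reached e R SV (A c) (Y c) i R == TV i) =
   (frontier n k R sn dn c i R == tn i).
  move=> ik; rewrite reachedE -(valK' (TV i)) vtx_eq ?ltn_ord //.
  by apply: frontier_lt => // *; exact: ltn_ord.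
split=> [/allP al i ik|acc].
  have /andP[/allP lk fr] := al i ltac:(by rewrite mem_iota).
  split; last by apply/eqP; rewrite fE.
  by move=> r rR; rewrite linkE; apply: lk; rewrite mem_iota.
apply/allP => i; rewrite mem_iota /= => ik; have [lk fr] := acc i ik.
apply/andP; split; last by rewrite -fE // fr.
by apply/allP => r; rewrite mem_iota /= => rR; rewrite -linkE; apply: lk.
Qed.

Lemma accepting_ext a y a' y' : (forall p, p < M -> a p = a' p /\ y p = y' p) ->
  accepting e k R SV TV a y -> accepting e k R SV TV a' y'.
Proof.
move=> E acc i ik; have [lk fr] := acc i ik.
have pE r : r < R -> a (i * R + r) = a' (i * R + r) /\ y (i * R + r) = y' (i * R + r).
  by move=> rR; apply: E; nia.
have nE r : r < R -> near_end e SV a y i (i * R + r) = near_end e SV a' y' i (i * R + r).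
  by move=> rR; rewrite /near_end; have [-> ->] := pE r rR.
have fE r : r < R -> far_end e SV a y i (i * R + r) = far_end e SV a' y' i (i * R + r).
  by move=> rR; rewrite /far_end; have [-> ->] := pE r rR.
have rE r : r <= R -> reached e R SV a y i r = reached e R SV a' y' i r.
  by case: r => //= r rR; apply: fE.
split=> [r rR|]; last by rewrite -rE.
by have := lk r rR; rewrite /link_ok nE // fE // rE // ltnW.
Qed.

(** ** Trails *)

(** Induction on [progress], which drops along parents.  The trails are the
    positions met on the way to the initial code, where the iteration of
    [parent] stays. *)
Lemma sound_play g (parent := fun c => (par g c).-1) :
  sound n k R dn g -> forall m c, progress n k R dn c = m -> c < N -> 0 < par g c ->
  exists W, [/\ play e k R (A c) (Y c) W,
    forall p, p < M -> forall v, v \in W p <->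
      exists2 t, t <= m & v = Y (iter t parent c) p,
    forall t, iter t parent c < N &
    forall t, m <= t -> iter t parent c = iter m parent c].
Proof.
move=> sg; elim=> [|m IHm] c prog cN pc; have [[dc so]|[pd [p [u [pM un db lg]]]]] := sg c cN pc.
- have fixc t : iter t parent c = c by elim: t => //= t ->; rewrite /parent dc.
  have [ya da] := start_okP so.
  exists (fun p => [:: A c p]); split=> //.
  + exact: PlayStart.
  + move=> p pM v; rewrite inE; split=> [/eqP->|[t _ ->]].
      by exists 0 => //=; rewrite ya.
    by rewrite fixc ya.
  + by move=> t; rewrite fixc.
- by rewrite (progress_before n0 cN pM un lg) in prog.
- have [ya da] := start_okP so.
  move: prog; rewrite /progress big1 // => q _.
  have := ya q (ltn_ord q); rewrite /Y /A /dn => ->; exact: dist0.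
have bN : before n k R c p u < N by have [] := before_digits n0 cN pM un.
have [b1 b2 b3 b4] := before_digits n0 cN pM un.
rewrite db in pd.
have [|W [pl Wv itN itm]] := IHm _ _ bN pd.
  by apply: succn_inj; rewrite -prog (progress_before n0 cN pM un lg).
have itS t : iter t.+1 parent c = iter t parent (before n k R c p u).
  by rewrite iterSr; congr (iter _ _ _); rewrite /parent db.
exists (fun q => if q == p then Y c p :: W p else W q); split.
- apply: (@PlayMove _ _ _ _ _ _ _ _ _ _ p pl) => //; last by rewrite eqxx.
  + by move=> q qM; rewrite /A b3.
  + by move=> q qM nqp; rewrite (negPf nqp) /Y b4.
  apply/(@legalP c p u) => //.
  + by rewrite /Y b2.
  + by move=> q qM; rewrite /A b3.
  + by move=> q qM nqp; rewrite /Y b4.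
- move=> q qM v; have [->|nqp] := eqVneq q p.
    rewrite inE; split=> [/orP[/eqP->|/(Wv p pM)[t tm ->]]|[[|t] tm ->]].
    + by exists 0.
    + by exists t.+1; rewrite // itS.
    + by rewrite eqxx.
    by rewrite itS; apply/orP; right; apply/(Wv p pM); exists t.
  split=> [/(Wv q qM)[t tm ->]|[[|t] tm ->]].
  + by exists t.+1; rewrite // itS.
  + by apply/(Wv q qM); exists 0; rewrite //= /Y b4.
  by rewrite itS; apply/(Wv q qM); exists t.
- by case=> // t; rewrite itS.
by case=> // t tm; rewrite !itS itm.
Qed.

End Codes.

(** * The machine program *)

(** The first two memory cells are [n] and [k].  The base address is computed
    while register 1 is still 0, and set to the size of the input afterwards. *)
Definition program : cmd :=
  seqs (Fetch (rV vN) 0)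
    [:: Const (rT 0) 1; Fetch (rV vK) (rT 0);
        IfLt (rV vN) (rV vK) (Store 0 0)
          (seqs (compile base_size 0)
             [:: Add 1 (rV vB) 0; compile sizes 0; compile tables 0; compile solve 0])].

Definition time_factor : nat :=
  coefficient base_size + coefficient sizes + coefficient tables +
  coefficient solve + 6.

Lemma total_time t1 t2 t3 t4 a b c d x : 0 < x ->
  t1 <= a * x -> t2 <= b * x -> t3 <= c * x -> t4 <= d * x ->
  1 + (1 + (1 + (t1 + (1 + (t2 + (t3 + t4)))).+1)) <= (a + b + c + d + 6) * x.
Proof. by rewrite !mulnDl; lia. Qed.

(** Cell 0 holds [n]; storing register 0 there writes the negative answer. *)
Lemma program_none w : nth 0 w 0 < nth 0 w 1 -> exists T st,
  [/\ exec program (init_state w) T st, T <= 6 & Defs.mem st 0 = 0].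
Proof.
move=> nk; eexists; eexists; split.
- apply: exec_seqs; first by constructor.
  apply: exec_seqs; first by constructor.
  apply: exec_seqs; first by constructor.
  by apply: ExecIfTrue; [exact: nk|constructor].
- by [].
- by [].
Qed.

Section Run.

Variables (w : seq nat) (n k : nat).
Hypotheses (wn : nth 0 w 0 = n) (wk : nth 0 w 1 = k).
Hypotheses (k0 : 0 < k) (kn : k <= n).
Local Notation R := (4 * k`!).+1.
Local Notation M := (k * R).
Local Notation B := (k + k + 2 + n * n).
Hypothesis wB : size w = B.

Let n0 : 0 < n. Proof. exact: leq_trans k0 kn. Qed.

Definition loop_value (x : nat) : nat :=
  nth 0 [:: n; k; B; R; M; M + M; M + M + n; n * M; n ^ (M + M)] x.

Lemma cost_work s : monomial loop_value s <= work n k ->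
  all [in [:: vN; vK; vR; vM; vD; vZ; vT; vC]] (loop_bounds s) ->
  cost loop_value s <= coefficient s * work n k.
Proof.
move=> mw /allP al; have [|_ c] := @cost_monomial loop_value s.
  have M0 : 0 < M by rewrite muln_gt0 k0.
  have N0 : 0 < n ^ (M + M) by rewrite expn_gt0 n0.
  have /allP pos : all (fun b => 0 < loop_value b)
      [:: vN; vK; vR; vM; vD; vZ; vT; vC].
    have MM : 0 < M + M by rewrite addn_gt0 M0.
    have MMn : 0 < M + M + n by rewrite addn_gt0 MM.
    have nM : 0 < n * M by rewrite muln_gt0 n0.
    by do ?(apply/andP; split).
  by apply/allP => b /al /pos.
by apply: leq_trans c _; rewrite leq_mul2l mw orbT.
Qed.

(** For base address 0 the whole memory belongs to the banks, so [base_size], which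
    uses none, may run before the base is known.  Beyond the input the memory is
    zero, which makes all banks zero initially. *)
Lemma program_some : exists g, [/\ var g vN = n /\ var g vK = k,
    inp g = nth 0 w, forall b i, b < 16 -> arr g b i = 0 &
  exists T st, [/\ exec program (init_state w) T st, T <= time_factor * work n k &
    represents B (run B solve (run B tables (run B sizes g))) st]].
Proof.
pose st1 := set_reg (set_reg (set_reg (init_state w) (rV vN) (nth 0 w 0)) (rT 0) 1)
  (rV vK) (nth 0 w 1).
have e1 : reg st1 (rV vN) = n /\ reg st1 (rV vK) = k by [].
pose g1 := MkStore (fun x => reg st1 (rV x))
  (fun b i => nth 0 w (0 + (16 * i + b))) (fun=> 0).
have vn : loop_value vN = n by [].
have rep1 : represents 0 g1 st1.
  by [].
have [T2 [st2 [x2 t2 rep2 _]]] := @compile_ok 0 [:: vN] loop_value base_size 0 g1 st1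
  wf_base_size ltac:(by move=> v; rewrite inE => /eqP->) rep1.
pose st3 := set_reg st2 1 (reg st2 (rV vB) + reg st2 0).
set g2 := run 0 base_size g1 in rep2.
have [r0 r1 rv ma mi] := rep2.
have B2 : var g2 vB = B.
  by rewrite base_sizeP -[var g1 vN]/(reg st1 (rV vN)) -[var g1 vK]/(reg st1 (rV vK)) e1.1 e1.2.
have mem2 a : Defs.mem st2 a = nth 0 w a.
  have := ma (a %% 16) (a %/ 16) (ltn_pmod a (isT : 0 < 16)).
  by rewrite run_arr //= !add0n mulnC -divn_eq.
pose g3 := MkStore (var g2) (fun b i => nth 0 w (B + (16 * i + b))) (nth 0 w).
have rep3 : represents B g3 st3.
  split=> //=; first by rewrite rv r0 addn0.
  - by move=> x; rewrite -rv; case: eqP => //; lia.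
have n3 : var g3 vN = n by rewrite /= run_var.
have k3 : var g3 vK = k by rewrite /= run_var.
exists g3; split=> //.
  by move=> b i _; rewrite /= nth_default // wB leq_addr.
have [T4 [st4 [x4 t4 rep4 _]]] := @compile_ok B [:: vN; vK] loop_value sizes 0 g3 st3
  wf_sizes ltac:(by move=> v; rewrite !inE => /orP[]/eqP->) rep3.
have [[n4 k4] R4 [M4 D4] Z4 T4'] := @sizesP B g3 n k n3 k3.
set g4 := run B sizes g3 in rep4 n4 k4 R4 M4 D4 Z4 T4'.
have K4 v : v \in [:: vN; vK; vR; vM; vD; vZ] -> var g4 v = loop_value v.
  have /allP H : all (fun v => var g4 v == loop_value v) [:: vN; vK; vR; vM; vD; vZ].
    by rewrite /= n4 k4 R4 M4 D4 Z4 /loop_value /= !eqxx.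
  by move/H/eqP.
have [T5 [st5 [x5 t5 rep5 _]]] := @compile_ok B _ loop_value tables 0 g4 st4
  wf_tables K4 rep4.
set g5 := run B tables g4 in rep5.
have b4 : bounds n k R g4 by [].
have p5 : var g5 vC = n ^ (M + M) := @tables_codes B n k R isT g4 b4.
have K5 v : v \in [:: vN; vK; vR; vM; vD; vZ; vT; vC] -> var g5 v = loop_value v.
  rewrite !inE !orbA => /orP[|/eqP->]; last exact: p5.
  case/orP=> [v6|/eqP->]; last by rewrite run_var.
  have v6' : v \in [:: vN; vK; vR; vM; vD; vZ] by rewrite !inE !orbA.
  rewrite -K4 // run_var //; exact: wellformed_vars wf_tables _ v6'.
have [T6 [st6 [x6 t6 rep6 _]]] := @compile_ok B _ loop_value solve 0 g5 st5
  wf_solve K5 rep5.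
have [m2 m4 m5 m6] := @solve_work n k k0 kn loop_value erefl erefl erefl erefl
  erefl erefl erefl erefl.
have c2 := cost_work m2 isT; have c4 := cost_work m4 isT.
have c5 := cost_work m5 isT; have c6 := cost_work m6 isT.
exists (1 + (1 + (1 + (T2 + (1 + (T4 + (T5 + T6)))).+1))), st6; split; last exact: rep6.
- apply: exec_seqs; first by constructor.
  apply: exec_seqs; first by constructor.
  apply: exec_seqs; first by constructor.
  apply: (@ExecIfFalse _ _ _ _ st1); first by rewrite e1.1 e1.2.
  apply: exec_seqs x2 _; apply: exec_seqs; first by constructor.
  apply: exec_seqs x4 _; apply: exec_seqs x5 _; exact: x6.
have w0 : 0 < work n k.
  by rewrite /work !muln_gt0 !expn_gt0 ?muln_gt0 k0 n0.
exact: total_time w0 (leq_trans t2 c2) (leq_trans t4 c4) (leq_trans t5 c5)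
  (leq_trans t6 c6).
Qed.

End Run.

(** * Inputs and outputs *)

Section Blocks.

Variables (T : Type) (t0 : T) (F : T -> seq nat) (m : nat).
Hypothesis size_F : forall t, size (F t) = m.

Lemma size_blocks s : size (flatten (map F s)) = size s * m.
Proof. by elim: s => //= t s IHs; rewrite size_cat size_F IHs mulSn. Qed.

Lemma nth_blocks s a b : a < size s -> b < m ->
  nth 0 (flatten (map F s)) (a * m + b) = nth 0 (F (nth t0 s a)) b.
Proof.
elim: s a => // t s IHs [|a] /= am bm; rewrite nth_cat size_F ?bm //.
by rewrite mulSn -addnA ltnNge leq_addr /= addKn IHs.
Qed.

End Blocks.

Section Instance.

Variables (n k : nat) (e : rel 'I_n) (s t : 'I_k -> 'I_n).
Hypothesis k0 : 0 < k.

Let o0 : 'I_k := Ordinal k0.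
Definition idx (i : nat) : 'I_k := insubd o0 i.
Let v0 : 'I_n := s o0.

Lemma idxK i : i < k -> val (idx i) = i.
Proof. by move=> ik; rewrite /idx val_insubd ik. Qed.

Lemma idx_val (i : 'I_k) : idx i = i.
Proof. by apply/val_inj; rewrite idxK. Qed.

Local Notation w := (dsp_input e s t).
Local Notation SV := (fun i => s (idx i)).
Local Notation TV := (fun i => t (idx i)).

Lemma dsp_inputE : w = [:: n, k &
  flatten [seq [:: val (s i); val (t i)] | i <- enum 'I_k] ++
  flatten [seq [seq nat_of_bool (e u v) | v <- enum 'I_n] | u <- enum 'I_n]].
Proof. by []. Qed.

Lemma size_input : size w = k + k + 2 + n * n.
Proof.
rewrite dsp_inputE /= size_cat (@size_blocks _ _ 2) // (@size_blocks _ _ n).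
  by rewrite !size_enum_ord muln2 addnn; lia.
by move=> u; rewrite size_map size_enum_ord.
Qed.

Lemma input_terminals i : i < k -> nth 0 w (2 + (i + i)) = sn SV i /\
  nth 0 w (3 + (i + i)) = tn TV i.
Proof.
move=> ik.
have E : nth o0 (enum 'I_k) i = idx i.
  by apply/val_inj; rewrite /= nth_enum_ord // idxK.
pose F := fun i : 'I_k => [:: val (s i); val (t i)].
have L b : b < 2 -> nth 0 w (2 + (i * 2 + b)) = nth 0 (F (idx i)) b.
  move=> b2; rewrite dsp_inputE /= nth_cat (@size_blocks _ F 2) // size_enum_ord.
  have -> : i * 2 + b < k * 2 by lia.
  by rewrite (@nth_blocks _ o0 F 2) ?E ?size_enum_ord.
have := L 0 isT; have := L 1 isT; rewrite addn0 muln2 -addnn => h1 h0.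
by split; [rewrite h0|rewrite -[3 + _](_ : 2 + (i + i + 1) = _) ?h1 //; lia].
Qed.

Lemma input_edges u v : u < n -> v < n ->
  nth 0 w (2 + (k + k) + u * n + v) = e (vtx v0 u) (vtx v0 v).
Proof.
move=> un vn; have E x : x < n -> nth v0 (enum 'I_n) x = vtx v0 x.
  by move=> xn; apply/val_inj; rewrite /= nth_enum_ord // vtxK.
pose F := fun u : 'I_n => [seq nat_of_bool (e u v) | v <- enum 'I_n].
have sF u' : size (F u') = n by rewrite size_map size_enum_ord.
have -> : 2 + (k + k) + u * n + v = (k * 2 + (u * n + v)).+2 by lia.
rewrite dsp_inputE [nth _ _ _]/= nth_cat (@size_blocks _ _ 2) // size_enum_ord.
rewrite ltnNge leq_addr /= addKn.
rewrite (@nth_blocks _ v0 F n) ?size_enum_ord // E // /F.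
by rewrite (nth_map v0) ?size_enum_ord // E.
Qed.

Hypothesis e_sym : symmetric e.
Hypothesis e_conn : forall x y, connect e x y.

Lemma geodesicP x y p : is_shortest_path e x y p <-> geodesic e x y p.
Proof. exact: shortest_pathP. Qed.

Lemma solution_geodesics P : dsp_solution e s t P ->
  disjoint_geodesics e k SV TV (fun i => P (idx i)).
Proof.
case=> sp dj; split=> [i ik|i j v ik jk nij vi]; first exact/geodesicP/sp.
have nij' : idx i != idx j by rewrite -val_eqE /= !idxK.
by have := dj _ _ nij'; rewrite disjoint_has => /hasPn/(_ _ vi).
Qed.

Lemma geodesics_solution P : disjoint_geodesics e k SV TV P ->
  dsp_solution e s t (fun i : 'I_k => P i).
Proof.
case=> sp dj; split=> [i|i j nij].
  by have := sp i (ltn_ord i); rewrite idx_val => /geodesicP.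
rewrite disjoint_has; apply/hasPn => v vi; apply: dj vi => //.
Qed.

(** The terminals [s_i] are distinct, being on disjoint paths. *)
Lemma solution_card P : dsp_solution e s t P -> k <= n.
Proof.
case=> sp dj; have inj : injective s.
  move=> i j E; apply/eqP; apply: contraT => nij.
  have hd l : s l \in P l.
    by have /geodesicP/geodesic_mem/andP[] := sp l.
  have := dj i j nij; rewrite disjoint_has => /hasPn/(_ _ (hd i)).
  by rewrite E hd.
by have := leq_card s inj; rewrite !card_ord.
Qed.

Local Notation R := (4 * k`!).+1.
Local Notation M := (k * R).

Lemma dsp_foundE (P : nat -> seq 'I_n) : dsp_found (fun i : 'I_k => P i) =
  word (fun i => map val (P i)) k.
Proof.
rewrite /dsp_found /word -val_enum_ord -map_comp; congr (_ :: flatten _).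
by apply: eq_map => i; rewrite /= /block size_map.
Qed.

Hypothesis kn : k <= n.

Let n0 : 0 < n. Proof. exact: leq_trans k0 kn. Qed.

(** An output of at most [1 + k (n + 1)] cells fits below the base address, so it
    is not confused with the banks it is computed from. *)
Lemma program_correct : exists T st,
  [/\ exec program (init_state w) T st, T <= time_factor * work n k &
      (exists P, dsp_solution e s t P /\ outputs st (dsp_found P)) \/
      ((~ exists P, dsp_solution e s t P) /\ outputs st dsp_none)].
Proof.
have [g [[gn gk] gi ga [T [st [ex Tle rp]]]]] :=
  @program_some w n k erefl erefl k0 kn size_input.
exists T, st; split=> //.
set B := k + k + 2 + n * n in ex rp.
have R0 : 0 < R by [].
have M0 : 0 < M by rewrite muln_gt0 k0.
set dn' := dn e v0; set S := sn SV; set T' := tn TV.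
have S_lt i : i < k -> S i < n by move=> _; apply: ltn_ord.
have T_lt i : i < k -> T' i < n by move=> _; apply: ltn_ord.
have dlt u v : u < n -> v < n -> dn' u v < n by move=> _ _; apply: dn_lt.
have [[n1 k1] R1 [M1 D1] Z1 T1] := @sizesP B g n k gn gk.
set g1 := run B sizes g in n1 k1 R1 M1 D1 Z1 T1 rp.
have gv : given n k S T' (fun u v => e (vtx v0 u) (vtx v0 v)) g1.
  split=> [i ik|i ik|u v un vn]; rewrite run_inp // gi.
  - by have [] := input_terminals ik.
  - by have [] := input_terminals ik.
  exact: input_edges.
have b1 : bounds n k R g1 by [].
have nB : 2 + (k + k) + n * n <= B by rewrite /B (addnC 2).
have e2 : env n k R S T' dn' (run B tables g1).
  apply: tablesP gv nB T1 => //.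
  - exact: dn_eq0.
  - exact: dn_next.
set g2 := run B tables g1 in rp e2.
have par2 c : par g2 c = 0 by rewrite /par !run_arr // ga.
move: rp; rewrite /solve run_then; set g3 := run B search g2 => rp.
have [e3 s3 st3 nf3] := @searchP B n k R n0 R0 S T' dn' S_lt dlt g2 M0 e2 par2.
have [_ _ _ _ mi] := rp.
case: st3 => [f0|[f1 [fN f0 fa]]].
  right; split; last first.
    move=> [|//] _; rewrite mi ?answer_noneP // /B; lia.
  case=> P /solution_geodesics sol.
  have [a [y [W [pl acc]]]] := search_complete e_conn e_sym (leqnn _ : 4 * k`! < R) sol.
  (* The configuration at the end of the play, digit by digit. *)
  pose D q := if q < M then val (a q) else val (y (q - M)).
  have [|c cN cD] := @digits_exist n n0 (M + M) D.
    by move=> q _; rewrite /D; case: ifP => _; apply: ltn_ord.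
  have cE p : p < M -> pebble_start v0 c p = a p /\ pebble_now k v0 R c p = y p.
    move=> pM; rewrite /pebble_start /pebble_now /pstart /pnow !cD ?ltn_add2l //; last first.
      exact: leq_trans pM (leq_addr _ _).
    by rewrite /D pM ltnNge leq_addr /= addKn !valK'.
  have cc : coded n k R dn' c by apply: play_coded pl c cN cE.
  have /negP := nf3 f0 c cc; apply; apply/accept_okP => //.
  by apply: accepting_ext acc => // p pM; have [-> ->] := cE p pM.
left; set c := var g3 xfin in fN f0 fa.
have [W [pl Wv itN itm]] := @sound_play n k e v0 e_conn R g3 s3 _ c erefl fN f0.
set parent := fun c => (par g3 c).-1 in Wv itN itm.
have acc : accepting e k R SV TV (pebble_start v0 c) (pebble_now k v0 R c).
  by apply/accept_okP.
have [P solP PW] := accepting_sound e_conn e_sym R0 pl acc.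
exists (fun i : 'I_k => P i); split; first exact: geodesics_solution.
pose Pn i := map val (P i).
have geo i : i < k -> geodesic e (SV i) (TV i) (P i) by case: solP => H _; apply: H.
have dE i u : dn' (S i) (val u) = dist e (SV i) u by rewrite /dn' /dn /S /sn !valK'.
have size_Pn i : i < k -> size (Pn i) = (dn' (S i) (T' i)).+1.
  move=> ik; rewrite size_map /T' /tn dE; have [q -> [_ _ sq]] := geo i ik.
  by rewrite /= sq.
have level i l : i < k -> l < size (Pn i) -> dn' (S i) (nth 0 (Pn i) l) = l.
  move=> ik; rewrite size_map => lP; rewrite (nth_map v0) // dE.
  have [q Pq [pq lq sq]] := geo i ik; rewrite Pq /= ltnS in lP.
  have sq' : size q = dist e (SV i) (last (SV i) q) by rewrite lq.
  have := geodesic_dist e_conn pq sq' (i := 0) (j := l) lP.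
  by rewrite subn0 Pq /= => E; rewrite -[RHS]E; congr (dist e _ _); apply: set_nth_default.
have mem_level i v : i < k -> v \in Pn i ->
    dn' (S i) v < size (Pn i) /\ nth 0 (Pn i) (dn' (S i) v) = v.
  move=> ik vP; have iv : index v (Pn i) < size (Pn i) by rewrite index_mem.
  have E := level i _ ik iv; rewrite nth_index // in E.
  by rewrite E nth_index.
have off_B i : i <= k -> off Pn i <= 1 + i * n.+1.
  elim: i => // i IHi ik; rewrite offS size_Pn // mulSnr addnA.
  by apply: leq_add; [exact/IHi/ltnW|rewrite ltnS; apply: dlt; [exact: S_lt|exact: T_lt]].
have off_k : off Pn k <= B.
  apply: leq_trans (off_B k (leqnn k)) _.
  have kkn : k * n <= n * n by rewrite leq_mul2r kn orbT.
  by rewrite /B mulnS; lia.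
have mM : progress n k R dn' c < n * M by apply: progress_lt.
have memP i v : i < k -> reflect (exists tm r,
    [/\ tm < n * M, r < R & v = pnow n k R (iter tm parent c) (i * R + r)]) (v \in Pn i).
  move=> ik; have rM r : r < R -> i * R + r < M by nia.
  apply: (iffP mapP) => [[u uP ->]|[tm [r [tM rR ->]]]].
    move: uP; rewrite PW // => /flattenP[_ /mapP[r rR ->]].
    rewrite mem_iota /= in rR => /(Wv _ (rM r rR))[tm tmle ->].
    exists tm, r; split=> //; first exact: leq_ltn_trans tmle mM.
    by rewrite vtxK // pnow_lt.
  exists (pebble_now k v0 R (iter tm parent c) (i * R + r)); last first.
    by rewrite vtxK // pnow_lt.
  rewrite PW //; apply/flattenP; exists (W (i * R + r)).
    by apply: map_f; rewrite mem_iota.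
  apply/(Wv _ (rM r rR)).
  have [le|gt] := leqP tm (progress n k R dn' c); first by exists tm.
  by exists (progress n k R dn' c) => //; rewrite itm // ltnW.
rewrite dsp_foundE => a aw; rewrite mi; last exact: leq_trans aw off_k.
apply: (@answer_foundP B n k R n0 R0 S T' dn' S_lt T_lt Pn size_Pn mem_level off_k
  g3 e3 f1 itN memP) => //.
move=> tm p pM; apply/memP; first by rewrite ltn_divLR.
have E : p %/ R * R + p %% R = p by rewrite -divn_eq.
have [le|gt] := leqP tm (progress n k R dn' c).
  exists tm, (p %% R); rewrite E ltn_mod; split=> //; exact: leq_ltn_trans le mM.
exists (progress n k R dn' c), (p %% R); rewrite E ltn_mod; split=> //.
by rewrite -/c -/parent itm // ltnW.
Qed.

End Instance.

Theorem theorem2 :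
  exists (prog : cmd) (c : nat),
  forall (n k : nat) (e : rel 'I_n) (s t : 'I_k -> 'I_n),
    0 < k ->
    symmetric e -> irreflexive e -> (forall x y : 'I_n, connect e x y) ->
    exists (T : nat) (st : state),
      [/\ exec prog (init_state (dsp_input e s t)) T st,
          T <= c * (k * n ^ (16 * k * k`! + k + 1)) &
          (exists P : 'I_k -> seq 'I_n,
             dsp_solution e s t P /\ outputs st (dsp_found P))
          \/ ((~ exists P : 'I_k -> seq 'I_n, dsp_solution e s t P)
              /\ outputs st dsp_none)].
Proof.
exists program, (time_factor * 375) => n k e s t k0 e_sym _ e_conn.
have [kn|nk] := leqP k n.
  have [T [st [ex Tle out]]] := program_correct s t k0 e_sym e_conn kn.
  exists T, st; split=> //; apply: leq_trans Tle _.
  by rewrite -mulnA leq_mul2l work_bound // orbT.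
have [T [st [ex T6 out]]] := @program_none (dsp_input e s t) nk.
have n0 : 0 < n by apply: leq_ltn_trans (ltn_ord (s (Ordinal k0))).
exists T, st; split=> //.
  apply: leq_trans T6 _; rewrite -mulnA.
  have p0 : 0 < 375 * (k * n ^ (16 * k * k`! + k + 1)).
    by rewrite !muln_gt0 k0 expn_gt0 n0.
  by apply: leq_trans (leq_pmulr _ p0); rewrite /time_factor.
right; split=> [[P /(solution_card e_conn)]|[|//] _ //]; last first.
by rewrite leqNgt nk.
Qed.
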